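(* Let $p>2$, $b\in\mathbb{R}\setminus\{0\}$, $1<\beta<p-1$, $\alpha\ge\frac p{p-1-\beta}$, $C>0$. Let $u_0\ge0$ be continuous on $\mathbb{R}$ with $\sup\{x:u_0(x)>0\}=0$ and $u_0(x)\sim C(-x)^\alpha$ as $x\to0-$, and let $u$ be the solution of $$u_t-(|u_x|^{p-2}u_x)_x+bu^\beta=0\ \ (x\in\mathbb{R},\ 0<t<T),\qquad u(x,0)=u_0(x).$$ Then for every $\varepsilon\in(0,C)$ there exist $x_\varepsilon<0$ and $\delta_\varepsilon>0$ such that $$g_{-\varepsilon}(x,t)\le u(x,t)\le g_{\varepsilon}(x,t),\qquad x\ge x_\varepsilon,\ 0\le t\le\delta_\varepsilon,$$ where, for $\epsilon\in\{\varepsilon,-\varepsilon\}$, $$g_\epsilon(x,t)=\begin{cases}\big[(C+\epsilon)^{1-\beta}|x|^{\alpha(1-\beta)}+b(\beta-1)(1-d_\epsilon)t\big]^{1/(1-\beta)},&x_\varepsilon\le x<0,\\0,&x\ge0,\end{cases}$$ $$d_\epsilon=\begin{cases}\epsilon\,\operatorname{sign}b,&\alpha>p/(p-1-\beta),\\\Big(\big((C+\epsilon)/C_*\big)^{p-1-\beta}+\epsilon\Big)\operatorname{sign}b,&\alpha=p/(p-1-\beta),\end{cases}\qquad C_*=\Big[\frac{|b|(p-1-\beta)^p}{(1+\beta)p^{p-1}(p-1)}\Big]^{\frac1{p-1-\beta}}.$$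
   Context: Notation: $F\sim G$ means $F/G\to1$ in the indicated limit. Weak solution: a measurable $u\ge0$ with $u\in C_{loc}(0,T;L^2_{loc}(\mathbb{R}))\cap L^p_{loc}(0,T;W^{1,p}_{loc}(\mathbb{R})\cap L^{1+\beta}_{loc}(\mathbb{R}))$ such that for every $[t_0,t_1]\subset(0,T]$ and all $\mu_1<\mu_2$ in $C^1[t_0,t_1]$, $$\int_{\mu_1(t)}^{\mu_2(t)}u\phi\,dx\Big|_{t_0}^{t_1}+\int_{t_0}^{t_1}\int_{\mu_1(t)}^{\mu_2(t)}\big(-u\phi_t+|u_x|^{p-2}u_x\phi_x+bu^\beta\phi\big)dx\,dt=0$$ for every $\phi\in C^{2,1}_{x,t}(\overline D)$ vanishing on $x=\mu_i(t)$, where $D=\{\mu_1(t)<x<\mu_2(t),\,t_0<t<t_1\}$. A solution of the Cauchy problem is a weak solution continuous up to $t=0$ with the prescribed initial values. Standing growth assumption: either $u_0$ is bounded (and $u$ is the unique solution bounded on $\mathbb{R}\times[0,T']$ for $T'<T$), or $b\ge0$ and $u_0(x)\le K(1+|x|)^\gamma$ for some $K>0$, $0<\gamma<p/(p-2)$ (and $u$ is the unique solution). Comparison holds in these classes. *)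

(* Defs.v *)
(* MathComp-Analysis, over an arbitrary R : realType. *)
From HB Require Import structures.
From mathcomp Require Import all_boot all_order all_algebra.
From mathcomp Require Import all_classical all_reals all_analysis.

Set Implicit Arguments.
Unset Strict Implicit.
Unset Printing Implicit Defensive.
Import Order.TTheory GRing.Theory Num.Theory.
Import numFieldNormedType.Exports.
Local Open Scope classical_set_scope.
Local Open Scope ring_scope.

Section Sobolev.
Context {R : realType}.
Local Notation mu := (@lebesgue_measure R).

Definition Lnorm_on (q : R) (K : set R) (f : R -> R) : \bar R :=
  ('N[mu]_(q%:E)[EFin \o (f \_ K)])%E.

Definition test_function (phi : R -> R) : Prop :=
  (forall (n : nat) (x : R), derivable (derive1n n phi) x 1) /\
  (exists M : R, forall x : R, M < `|x| -> phi x = 0).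

Definition weak_derivative (f f' : R -> R) : Prop :=
  [/\ locally_integrable setT f,
      locally_integrable setT f' &
      forall phi : R -> R, test_function phi ->
        \int[mu]_x (f x * derive1 phi x) = - \int[mu]_x (f' x * phi x)].

End Sobolev.

Section WeakSolution.
Context {R : realType}.
Local Notation mu := (@lebesgue_measure R).

(* Functions of (x, t) are curried, with x first.  The final time T may
   be +oo.  A function f lives on the open strip, t in ]0, T[; its values at
   other times are irrelevant unless explicitly mentioned. *)
Definition open_strip (T : \bar R) : set (R * R) :=
  [set z | 0 < z.2 /\ (z.2%:E < T)%E].

Definition half_open_strip (T : \bar R) : set (R * R) :=
  [set z | 0 <= z.2 /\ (z.2%:E < T)%E].

(* u in C_loc(0, T; L^2_loc(R)) *)
Definition C_loc_L2_loc (T : \bar R) (u : R -> R -> R) : Prop :=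
  forall a c t : R, a < c -> 0 < t -> (t%:E < T)%E ->
    (Lnorm_on 2 `[a, c] (u ^~ t) < +oo)%E /\
    Lnorm_on 2 `[a, c] (fun x => u x s - u x t) @[s --> t] --> 0%E.

(* u in L^p_loc(0, T; W^{1,p}_loc(R) `&` L^q_loc(R)), ux being the weak
   derivative of u in x. The integrand is, up to equivalence of norms, the p-th
   power of the norm of u(., t) in W^{1,p}(a, c) `&` L^q(a, c); measurability
   in time comes from the joint measurability of u and ux. *)
Definition Lp_loc_W1p_loc_Lq_loc (p q : R) (T : \bar R)
    (u ux : R -> R -> R) : Prop :=
  [/\ measurable_fun (open_strip T) (fun z : R * R => u z.1 z.2),
      measurable_fun (open_strip T) (fun z : R * R => ux z.1 z.2),
      {ae mu, forall t : R, 0 < t -> (t%:E < T)%E ->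
         weak_derivative (u ^~ t) (ux ^~ t)} &
      forall a c t0 t1 : R, a < c -> 0 < t0 -> t0 < t1 -> (t1%:E < T)%E ->
        (\int[mu]_(t in `[t0, t1])
           (Lnorm_on p `[a, c] (u ^~ t) `^ p +
            Lnorm_on p `[a, c] (ux ^~ t) `^ p +
            Lnorm_on q `[a, c] (u ^~ t) `^ p) < +oo)%E].

(* f in C^1[a, b] *)
Definition C1_on (a b : R) (f : R -> R) : Prop :=
  {within `[a, b], continuous f} /\
  exists f' : R -> R, {within `[a, b], continuous f'} /\
    forall t : R, a < t < b -> is_derive t 1 f (f' t).

(* D = { mu1(t) < x < mu2(t), t0 < t < t1 } *)
Definition curved_domain (t0 t1 : R) (mu1 mu2 : R -> R) : set (R * R) :=
  [set z | t0 < z.2 < t1 /\ mu1 z.2 < z.1 < mu2 z.2].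

(* phi in C^{2,1}_{x,t}(closure D), for D open: phi_x, phi_xx and phi_t are the
   derivatives in D, extended by continuity to the closure. *)
Definition C21_closure (D : set (R * R))
    (phi phi_x phi_xx phi_t : R -> R -> R) : Prop :=
  [/\ {within closure D, continuous (fun z : R * R => phi z.1 z.2)},
      {within closure D, continuous (fun z : R * R => phi_x z.1 z.2)},
      {within closure D, continuous (fun z : R * R => phi_xx z.1 z.2)},
      {within closure D, continuous (fun z : R * R => phi_t z.1 z.2)} &
      forall x t : R, D (x, t) ->
        [/\ is_derive x 1 (phi ^~ t) (phi_x x t),
            is_derive x 1 (phi_x ^~ t) (phi_xx x t) &
            is_derive t 1 (phi x) (phi_t x t)]].

Definition weak_solution (p b beta : R) (T : \bar R) (u : R -> R -> R) : Prop :=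
  [/\ measurable_fun (open_strip T) (fun z : R * R => u z.1 z.2),
      forall x t : R, 0 < t -> (t%:E < T)%E -> 0 <= u x t,
      C_loc_L2_loc T u &
      exists ux : R -> R -> R,
        Lp_loc_W1p_loc_Lq_loc p (1 + beta) T u ux /\
        forall (t0 t1 : R) (mu1 mu2 : R -> R),
          0 < t0 -> t0 < t1 -> (t1%:E <= T)%E ->
          C1_on t0 t1 mu1 -> C1_on t0 t1 mu2 ->
          (forall t, t0 <= t <= t1 -> mu1 t < mu2 t) ->
          forall phi phi_x phi_xx phi_t : R -> R -> R,
          C21_closure (curved_domain t0 t1 mu1 mu2) phi phi_x phi_xx phi_t ->
          (forall t, t0 <= t <= t1 ->
             phi (mu1 t) t = 0 /\ phi (mu2 t) t = 0) ->
          \int[mu]_(x in `[mu1 t1, mu2 t1]) (u x t1 * phi x t1)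
          - \int[mu]_(x in `[mu1 t0, mu2 t0]) (u x t0 * phi x t0)
          + \int[mu]_(t in `[t0, t1]) (\int[mu]_(x in `[mu1 t, mu2 t])
              (- (u x t * phi_t x t)
               + `|ux x t| `^ (p - 2) * ux x t * phi_x x t
               + b * u x t `^ beta * phi x t)) = 0].

Definition cauchy_solution (p b beta : R) (T : \bar R) (u0 : R -> R)
    (u : R -> R -> R) : Prop :=
  [/\ weak_solution p b beta T u,
      {within half_open_strip T, continuous (fun z : R * R => u z.1 z.2)} &
      forall x : R, u x 0 = u0 x].

(* The class of data and solutions in which the solution is unique.  The bound
   is imposed on u as well as on u0: a bound on u0 alone does not control u
   at infinity at positive times. *)
Definition growth_class (p b : R) (T : \bar R) (u0 : R -> R)
    (u : R -> R -> R) : Prop :=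
  ((exists M : R, forall x : R, u0 x <= M) /\
   (forall T' : R, 0 < T' -> (T'%:E < T)%E ->
      exists M : R, forall x t : R, 0 <= t <= T' -> u x t <= M))
  \/
  (0 <= b /\
   exists K gamma : R,
     [/\ 0 < K, 0 < gamma < p / (p - 2),
         (forall x : R, u0 x <= K * (1 + `|x|) `^ gamma) &
         forall T' : R, 0 < T' -> (T'%:E < T)%E ->
           exists K' : R, forall x t : R, 0 <= t <= T' ->
             u x t <= K' * (1 + `|x|) `^ gamma]).

End WeakSolution.

Section Barrier.
Context {R : realType}.

Definition Cstar (p b beta : R) : R :=
  (`|b| * (p - 1 - beta) `^ p
     / ((1 + beta) * p `^ (p - 1) * (p - 1))) `^ (1 / (p - 1 - beta)).

(* d_e; only used for alpha >= p / (p - 1 - beta) *)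
Definition dcoef (p b beta alpha C e : R) : R :=
  if p / (p - 1 - beta) < alpha then e * Num.sg b
  else (((C + e) / Cstar p b beta) `^ (p - 1 - beta) + e) * Num.sg b.

Definition gbase (p b beta alpha C e x t : R) : R :=
  (C + e) `^ (1 - beta) * `|x| `^ (alpha * (1 - beta))
  + b * (beta - 1) * (1 - dcoef p b beta alpha C e) * t.

(* g_e, meaningful when gbase is positive for x < 0 (powR has a junk value at
   a nonpositive base) *)
Definition gbarrier (p b beta alpha C e x t : R) : R :=
  if x < 0 then gbase p b beta alpha C e x t `^ (1 / (1 - beta)) else 0.

End Barrier.

(* Main.v *)
Require Import Defs.
From HB Require Import structures.
From mathcomp Require Import all_boot all_order all_algebra.
From mathcomp Require Import all_classical all_reals all_analysis.
From mathcomp Require Import measurable_realfun ring lra.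
Set Implicit Arguments.
Unset Strict Implicit.
Unset Printing Implicit Defensive.
Import Order.TTheory GRing.Theory Num.Theory.
Import numFieldNormedType.Exports.
Local Open Scope classical_set_scope.
Local Open Scope ring_scope.

(** Both barriers are compared with u by a weak comparison principle.  In y = |x| and
    A = C + e the barrier is A y^alpha (1 + k y^(alpha (beta - 1)) t)^(-1/(beta - 1)), where
    k = b (beta - 1) (1 - d) A^(beta - 1).  It solves the ordinary equation v_t = - b (1 - d) v^beta,
    and (|v_x|^(p-2) v_x)_x is a multiple of y^n (1 + o(1)) as t -> 0, with
    n = (alpha - 1)(p - 1) - 1 >= alpha beta.  Hence the diffusion is negligible against v^beta for
    alpha > p/(p - 1 - beta) and is balanced by the choice of d, through C_*, in the case of equality;
    in both cases the parameter epsilon leaves a margin of a fixed sign.  As n >= alpha beta > 0, the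
    barrier extended by 0 is a classical super- or subsolution across x = 0.

    On the half line x >= 1 the solution vanishes for a short time, uniformly in x, by comparison on
    [y/2, 3y/2] with a (1 + N t) |x - y|^(p/(p-2)); the growth assumption enters only here.

    The comparison principle is an energy estimate.  With z = u - v (or v - u), the weak formulation
    holds for test functions that do not depend on t, and by the du Bois-Reymond lemma one may use
    z_+(., t)^2, which lies in W^{1,1}.  Averaging over backward time intervals and letting their
    length go to 0 bounds the growth of the integral of z_+^3, since (s |-> |s|^(p-2) s) is
    monotone. *)

(** The test function is the square of the positive part because s |-> s_+^2 is C^1: its chain rule
    along a primitive of an L^1 function follows by approximation, and the matching energy has the
    convex density s_+^3 / 3. As u has no time derivative, convexity stands in for one: the
    increment of z over [t - h, t], tested at the end time t, dominates the increment of the energy.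

    The obstacle is that fluxes at times r in [t - h, t] then meet gradients at time t, and both are
    merely integrable to dual powers. Their product is bounded by D(x, r) + D(x, t) with D
    integrable. The averages in r of this bound depend on h, but they converge almost everywhere and
    keep the same integral, so Fatou's lemma applies once they are added.

    Comparison with the barriers takes place on a window [-h, 1], where the value of u at x = 1 must
    be known. This is why the vanishing of u on x >= 1 is obtained separately, before the barriers
    of the theorem are used. *)

Ltac order_lra :=
  repeat match goal with
  | H : ?P |- _ =>
      lazymatch type of P with Prop =>
        lazymatch P with is_true _ => fail | _ => clear H end
      end
  end; lra.

(** * Primitives of integrable functions *)

Section RealIntegrable.
Context d (T : measurableType d) (R : realType) (mu : {measure set T -> \bar R}).
Variable D : set T.
Hypothesis mD : measurable D.
Implicit Types f g : T -> R.

Lemma integrable_addr f g : mu.-integrable D (EFin \o f) ->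
  mu.-integrable D (EFin \o g) -> mu.-integrable D (EFin \o (fun x => f x + g x)).
Proof. by move=> fi gi; exact: (integrableD mD fi gi). Qed.

Lemma integrable_subr f g : mu.-integrable D (EFin \o f) ->
  mu.-integrable D (EFin \o g) -> mu.-integrable D (EFin \o (fun x => f x - g x)).
Proof. by move=> fi gi; exact: (integrableB mD fi gi). Qed.

Lemma integrable_mulrl (k : R) f : mu.-integrable D (EFin \o f) ->
  mu.-integrable D (EFin \o (fun x => k * f x)).
Proof. by move=> fi; exact: (integrableZl mD k fi). Qed.

Lemma integrable_normr f : mu.-integrable D (EFin \o f) ->
  mu.-integrable D (EFin \o (fun x => `|f x|)).
Proof. exact: integrable_norm. Qed.

Lemma le_integrable_real f g : measurable_fun D f ->
  (forall x, D x -> `|f x| <= g x) -> mu.-integrable D (EFin \o g) ->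
  mu.-integrable D (EFin \o f).
Proof.
move=> mf fg gi; apply: le_integrable gi => //; first exact/measurable_EFinP.
by move=> x Dx; rewrite /= lee_fin (le_trans (fg x Dx))// ler_norm.
Qed.

Lemma EFin_Rintegral f : mu.-integrable D (EFin \o f) ->
  (\int[mu]_(x in D) (f x)%:E)%E = (\int[mu]_(x in D) f x)%:E.
Proof. by move=> fi; rewrite /Rintegral fineK//; exact: integrable_fin_num. Qed.

End RealIntegrable.

Section L1Primitives.
Context {R : realType}.
Local Notation mu := (@lebesgue_measure R).
Implicit Types (f g h k m : R -> R) (a c x y : R).

Lemma integrable_prodM f g :
  mu.-integrable setT (EFin \o f) -> mu.-integrable setT (EFin \o g) ->
  (mu \x mu)%E.-integrable setT (fun z : R * R => (f z.1 * g z.2)%:E).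
Proof.
move=> /integrableP[mf fi] /integrableP[mg gi].
have mf' := (measurable_EFinP _ _).1 mf.
have mg' := (measurable_EFinP _ _).1 mg.
apply/integrable12ltyP.
  apply/measurable_EFinP; apply: measurable_funM => /=.
    by apply: measurableT_comp => //.
  by apply: measurableT_comp => //.
rewrite /=.
under eq_integral => x _.
  under eq_integral => y _ do rewrite normrM EFinM.
  rewrite ge0_integralZl//; last by apply/measurable_EFinP; exact: measurableT_comp.
  over.
rewrite /= ge0_integralZr//.
- by rewrite lte_mul_pinfty//; [exact: integral_ge0 | rewrite ge0_fin_numE//; exact: integral_ge0].
- by apply/measurable_EFinP; exact: measurableT_comp.
- exact: integral_ge0.
Qed.

Lemma integrable_prim a c m : mu.-integrable `[a, c] (EFin \o m) ->
  forall x y, a <= x -> y <= c -> mu.-integrable `[x, y] (EFin \o m).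
Proof.
move=> im x y ax yc; apply: integrableS im => //.
by apply: subset_itv; rewrite bnd_simp.
Qed.

Lemma integrable_restrictT (D : set R) f : measurable D ->
  mu.-integrable D (EFin \o f) -> mu.-integrable setT (EFin \o (f \_ D)).
Proof. by move=> mD fi; rewrite -restrict_EFin -integrable_mkcond. Qed.

(** Integration by parts for two L^1 functions, by Fubini's theorem: both sides integrate
    [h x * m y] over the triangle y <= x. *)
Lemma prim_swap a c h m : mu.-integrable `[a, c] (EFin \o h) ->
  mu.-integrable `[a, c] (EFin \o m) ->
  \int[mu]_(x in `[a, c]) (h x * \int[mu]_(y in `[a, x]) m y) =
  \int[mu]_(y in `[a, c]) (m y * \int[mu]_(x in `[y, c]) h x).
Proof.
move=> ih im.
have ih' : mu.-integrable setT (EFin \o (h \_ `[a, c])).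
  exact: (integrable_restrictT (measurable_itv _) ih).
have im' : mu.-integrable setT (EFin \o (m \_ `[a, c])).
  exact: (integrable_restrictT (measurable_itv _) im).
pose f (z : R * R) := ((h \_ `[a, c]) z.1 * (m \_ `[a, c]) z.2 * (z.2 <= z.1)%R%:R)%:E.
have if_ : (mu \x mu)%E.-integrable setT f.
  apply: (le_integrable _ _ _ (integrable_prodM ih' im')) => //.
    apply/measurable_EFinP; apply: measurable_funM.
      have /measurable_EFinP := (measurable_int _ (integrable_prodM ih' im')).
      exact.
    rewrite [X in measurable_fun _ X](_ : _ =
      (fun z : R * R => if z.2 <= z.1 then 1 else 0)); last first.
      by apply/funext => z /=; case: ifP.
    apply: measurable_fun_ifT => //.
    by apply: measurable_fun_ler.
  move=> z _; rewrite /f !abse_EFin lee_fin !normrM normr_nat.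
  by rewrite ler_piMr// lern1; case: (_ <= _).
have := Fubini if_.
have -> : (fun x => \int[mu]_y f (x, y))%E =
    EFin \o ((fun x => h x * \int[mu]_(y in `[a, x]) m y) \_ `[a, c]).
  apply/funext => x /=; rewrite patchE; case: ifPn => [|xI].
    rewrite inE /= in_itv/= => /andP[ax xc].
    have imx : mu.-integrable `[a, x] (EFin \o m) by exact: integrable_prim im _ _ _ _.
    have -> : (fun y => f (x, y)) =
        ((fun y => (h x)%:E * (m y)%:E)%E \_ `[a, x]).
      apply/funext => y; rewrite /f/= !patchE.
      rewrite (mem_set (_ : `[a, c]%classic x)) /=; last by rewrite in_itv/= ax.
      have [yx|yx] := leP y x; case: ifPn => [yI|yI]; case: ifPn => [yI'|yI'].
      - by rewrite mulr1.
      - by move: yI' yI; rewrite notin_setE inE /= !in_itv/= yx => /negP; rewrite andbT => H /andP[]; rewrite (negbTE H).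
      - by move: yI' yI; rewrite notin_setE inE /= !in_itv/= => /andP[-> _] /negP; rewrite (le_trans yx).
      - by rewrite mulr0 mul0r.
      - by move: yI'; rewrite inE/= in_itv/= [y <= x]leNgt yx andbF.
      - by rewrite mulr0.
      - by move: yI'; rewrite inE/= in_itv/= [y <= x]leNgt yx andbF.
      - by rewrite mulr0.
    rewrite -integral_mkcond integralZl//.
    by rewrite EFin_Rintegral.
  by rewrite /f; under eq_integral => y _ do rewrite /= patchE (negbTE xI) !mul0r; rewrite integral0.
have -> : (fun y => \int[mu]_x f (x, y))%E =
    EFin \o ((fun y => m y * \int[mu]_(x in `[y, c]) h x) \_ `[a, c]).
  apply/funext => x /=; rewrite patchE; case: ifPn => [|xI].
    rewrite inE /= in_itv/= => /andP[ax xc].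
    have imx : mu.-integrable `[x, c] (EFin \o h) by exact: integrable_prim ih _ _ _ _.
    have -> : (fun y => f (y, x)) =
        ((fun y => (m x)%:E * (h y)%:E)%E \_ `[x, c]).
      apply/funext => y; rewrite /f/= !patchE.
      rewrite (mem_set (_ : `[a, c]%classic x)) /=; last by rewrite in_itv/= ax.
      have [yx|yx] := leP x y; case: ifPn => [yI|yI]; case: ifPn => [yI'|yI'].
      - by rewrite mulr1 mulrC.
      - by move: yI' yI; rewrite notin_setE inE /= !in_itv/= yx => /= H /andP[_ /H].
      - by move: yI' yI; rewrite notin_setE inE /= !in_itv/= yx => /= yc; rewrite yc andbT => H; exfalso; apply: H; exact: le_trans yx.
      - by rewrite !mul0r.
      - by move: yI'; rewrite inE/= in_itv/= [x <= y]leNgt yx.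
      - by rewrite mulr0.
      - by move: yI'; rewrite inE/= in_itv/= [x <= y]leNgt yx.
      - by rewrite mulr0.
    rewrite -integral_mkcond integralZl//.
    by rewrite EFin_Rintegral.
  by rewrite /f; under eq_integral => y _ do rewrite /= [(_ \_ _) x]patchE (negbTE xI) mulr0 mul0r; rewrite integral0.
move=> H; rewrite Rintegral_mkcond [RHS]Rintegral_mkcond /Rintegral.
by congr fine; exact: H.
Qed.

End L1Primitives.

(** * The chain rule for the square of the positive part *)

Section SquarePart.
Context {R : realType}.
Local Notation mu := (@lebesgue_measure R).
Implicit Types (f g k m z : R -> R) (a c x y : R).

(** Serves at the points where a function is given by different formulas on the two sides: the kink
    of the squared positive part and the origin of the flat exponential. *)
Lemma is_derive_quad f (w d K : R) :
  (forall h : R, `|f (w + h) - f w - d * h| <= K * h ^+ 2) -> is_derive w 1 f d.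
Proof.
move=> H; have K0 : 0 <= K by have := le_trans (normr_ge0 _) (H 1); rewrite expr1n mulr1.
have cv : h^-1 *: (f (h *: 1 + w) - f w) @[h --> 0^'] --> d.
  apply/cvgrPdist_le => /= e e0.
  near=> h.
  have h0 : h != 0 by near: h; exact: nbhs_dnbhs_neq.
  have -> : d - h^-1 *: (f (h *: 1 + w) - f w) = - (h^-1 * (f (w + h) - f w - d * h)).
    rewrite /GRing.scale/= mulr1 [h + w]addrC; field.
    exact: h0.
  rewrite normrN normrM; apply: (le_trans (ler_wpM2l (normr_ge0 _) (H h))).
  rewrite -[h ^+ 2]real_normK ?num_real// normfV mulrCA expr2 mulKf ?normr_eq0//.
  have : `|h| <= e / (K + 1).
    near: h; apply: dnbhs0_le; rewrite divr_gt0//; lra.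
  move=> he; apply: (le_trans (ler_wpM2l K0 he)).
  rewrite mulrCA ler_piMr//; first exact: ltW.
  by rewrite ler_pdivrMr; lra.
split; first by apply/cvg_ex; exists d.
exact: cvg_lim cv.
Unshelve. all: by end_near. Qed.

Lemma is_derive_sqpos (w : R) :
  is_derive w 1 (fun w : R => (Num.max 0 w) ^+ 2) (2 * Num.max 0 w).
Proof.
apply: (@is_derive_quad _ _ _ 1) => h.
rewrite mul1r ler_norml; apply/andP; split;
  case: (leP 0 w) => hw; case: (leP 0 (w + h)) => hh; rewrite ?(max_l, max_r); nra.
Qed.

(** Lebesgue differentiation: at almost every point [k] is the derivative of its primitive, which is
    constant here. *)
Lemma prim_eq0_ae a c k : mu.-integrable `[a, c] (EFin \o k) ->
  (forall x, a <= x <= c -> \int[mu]_(y in `[a, x]) k y = 0) ->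
  {ae mu, forall x, a < x < c -> k x = 0}.
Proof.
move=> ik H0; pose f := k \_ `[a, c].
have fi : mu.-integrable setT (EFin \o f) by exact: integrable_restrictT.
have := @FTC1 R f (BLeft a); case.
- by move=> y; apply: integrableS fi.
- exact: integrable_locally.
move=> N [mN N0 sub]; exists N; split => // x /= Hx; apply: sub => /= Hx'.
apply: Hx => /andP[ax xc].
have [dF] := Hx' (ax : (a%:E < x%:E)%E).
rewrite derive1E.
rewrite (@near_eq_derive _ _ _ _ (cst 0)); last first.
  near=> y.
  have /andP[ay yc] : a <= y <= c.
    have : y \in `]a, c[ by near: y; apply: near_in_itvoo; rewrite in_itv/= ax.
    by rewrite in_itv/= => /andP[/ltW-> /ltW->].
  rewrite -(H0 y) ?ay//; apply: eq_Rintegral => z; rewrite inE/= in_itv/=.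
  by move=> /andP[az zy]; rewrite /f patchE mem_set//= in_itv/= az (le_trans zy).
rewrite derive_cst => /esym; rewrite /f patchE mem_set//= in_itv/=.
by rewrite !ltW.
Unshelve. all: by end_near. Qed.

Lemma L1_dense_continuous a c m (e : R) : mu.-integrable `[a, c] (EFin \o m) ->
  0 < e -> exists g, [/\ continuous g, mu.-integrable `[a, c] (EFin \o g) &
    \int[mu]_(x in `[a, c]) `|m x - g x| < e].
Proof.
move=> im e0.
have fin : (mu `[a, c]%classic < +oo)%E.
  by rewrite lebesgue_measure_itv/=; case: ifP => _; rewrite ?ltry.
have [//|G [Gc Gi Gl]] := @approximation_continuous_integrable R `[a, c]%classic m _ fin im.
move/fine_cvgP : Gl => [_ /cvgrPdist_lt/(_ _ e0)[n _ /(_ n (leqnn n))]] /=.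
rewrite sub0r normrN => H; exists (G n); split => //.
apply: le_lt_trans (ler_norm _) _.
by apply: le_lt_trans H; rewrite /Rintegral; under eq_integral do rewrite -abse_EFin.
Qed.

End SquarePart.

Section Primitives.
Context {R : realType}.
Local Notation mu := (@lebesgue_measure R).
Implicit Types (f g k m z F : R -> R) (a c x y : R).

Lemma continuous_itv_integrable a c f : {within `[a, c], continuous f} ->
  mu.-integrable `[a, c] (EFin \o f).
Proof. by move=> cf; apply: continuous_compact_integrable => //; exact: segment_compact. Qed.

Lemma continuous_withinT (D : set R) f : continuous f -> {within D, continuous f}.
Proof. by move=> cf; apply: continuous_subspaceT. Qed.

Lemma FTC2_itv a c F f : a <= c -> {within `[a, c], continuous F} ->
  {within `[a, c], continuous f} ->
  (forall x, a < x < c -> is_derive x 1 F (f x)) ->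
  \int[mu]_(x in `[a, c]) f x = F c - F a.
Proof.
rewrite le_eqVlt => /predU1P[-> _ _ _|ac cF cf dF].
  by rewrite set_itv1 Rintegral_set1 subrr.
have [_ cFa cFc] := (continuous_within_itvP _ ac).1 cF.
rewrite /Rintegral (@continuous_FTC2 _ f F)//.
- by split => // x; rewrite in_itv/= => xac; case: (dF x xac).
- by move=> x; rewrite in_itv/= derive1E => xac; case: (dF x xac).
Qed.

Lemma is_derive_prim a x g : continuous g -> a < x ->
  is_derive x 1 (fun y => \int[mu]_(t in `[a, y]) g t) (g x).
Proof.
move=> cg ax.
have xx : x < x + 1 by rewrite ltrDl.
have ig : mu.-integrable `[a, x + 1] (EFin \o g).
  by apply: continuous_itv_integrable; exact: continuous_withinT.
have [//|d e] := @continuous_FTC1_closed R g a x (x + 1) xx ig ax.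
  exact: cg.
by split; [exact: d|rewrite -derive1E; exact: e].
Qed.

Lemma prim_continuous a c m : a <= c -> mu.-integrable `[a, c] (EFin \o m) ->
  {within `[a, c], continuous (fun x => \int[mu]_(t in `[a, x]) m t)}.
Proof. exact: parameterized_integral_continuous. Qed.

Lemma within_comp (D : set R) f g : {within D, continuous f} -> continuous g ->
  {within D, continuous (g \o f)}.
Proof.
move=> /subspace_continuousP cf cg; apply/subspace_continuousP => x Dx.
by apply: (cvg_comp _ _ (cf x Dx)); exact: cg.
Qed.

Lemma continuous_sqpos : continuous (fun w : R => Num.max 0 w ^+ 2).
Proof.
move=> w; have [+ _] := is_derive_sqpos w.
by move=> /derivable1_diffP/differentiable_continuous.
Qed.

Lemma continuous_pos : continuous (fun w : R => Num.max 0 w).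
Proof. by move=> w; apply: continuous_max => //; exact: cvg_cst. Qed.

Lemma chain_sqpos_continuous a x m (z0 : R) : a <= x -> continuous m ->
  Num.max 0 (z0 + \int[mu]_(t in `[a, x]) m t) ^+ 2 = Num.max 0 z0 ^+ 2 +
  \int[mu]_(y in `[a, x]) (2 * Num.max 0 (z0 + \int[mu]_(t in `[a, y]) m t) * m y).
Proof.
move=> ax cm.
have im : mu.-integrable `[a, x] (EFin \o m).
  by apply: continuous_itv_integrable; exact: continuous_withinT.
pose Z y := z0 + \int[mu]_(t in `[a, y]) m t.
have cZ : {within `[a, x], continuous Z}.
  have := prim_continuous ax im => /subspace_continuousP cp.
  by apply/subspace_continuousP => y yD; apply: cvgD; [exact: cvg_cst|exact: cp].
suff -> : \int[mu]_(y in `[a, x]) (2 * Num.max 0 (Z y) * m y) =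
    Num.max 0 (Z x) ^+ 2 - Num.max 0 (Z a) ^+ 2.
  by rewrite {2}/Z set_itv1 Rintegral_set1 addr0 /Z; lra.
apply: (@FTC2_itv a x (fun y => Num.max 0 (Z y) ^+ 2)) => //.
- exact: (within_comp cZ continuous_sqpos).
- apply/subspace_continuousP => y yD; apply: cvgM; last first.
    by move/subspace_continuousP : (@continuous_withinT `[a, x] _ cm); exact.
  apply: cvgM; first exact: cvg_cst.
  by move/subspace_continuousP : (within_comp cZ continuous_pos); exact.
- move=> y /andP[ay yx].
  have dZ : is_derive y 1 Z (m y).
    rewrite -[m y]add0r; apply: is_deriveD; exact: is_derive_prim.
  have dS := is_derive_sqpos (Z y).
  have := is_derive1_comp dS dZ.
  by rewrite /GRing.scale/= mulrC.
Qed.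

End Primitives.

Section ChainRule.
Context {R : realType}.
Local Notation mu := (@lebesgue_measure R).
Implicit Types (f g k m z F : R -> R) (a c x y : R).

Lemma ler_eps_mul (r K : R) : (forall e, 0 < e -> e < 1 -> r <= e * K) -> r <= 0.
Proof.
move=> H; apply/ler_addgt0Pr => e e0; rewrite add0r.
pose d := Num.min (2^-1) (e / (`|K| + 1)).
have d0 : 0 < d by rewrite lt_min invr_gt0 ltr0n divr_gt0// ltr_wpDl.
have d1 : d < 1 by rewrite gt_min invf_lt1// ltr1n.
apply: (le_trans (H d d0 d1)); apply: (le_trans (ler_wpM2l (ltW d0) (ler_norm K))).
have dle : d <= e / (`|K| + 1) by rewrite ge_min lexx orbT.
apply: (le_trans (ler_wpM2r (normr_ge0 K) dle)).
rewrite -mulrA ler_piMr//; first exact: ltW.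
by rewrite ler_pdivrMl ?ltr_wpDl// mulr1 lerDl.
Qed.

Lemma integrable_continuousM a c f m : {within `[a, c], continuous f} ->
  mu.-integrable `[a, c] (EFin \o m) ->
  mu.-integrable `[a, c] (EFin \o (fun x => f x * m x)).
Proof.
move=> cf im.
apply: (@integrableMr _ _ _ mu `[a, c]%classic _ f (EFin \o m)) => //.
- by apply: subspace_continuous_measurable_fun.
- have /compact_bounded[M [_ mrt]] := continuous_compact cf (@segment_compact _ a c).
  by exists M; split; rewrite ?num_real // => ? ? ? ?; exact: mrt.
Qed.

Lemma le_Rintegral_itv_norm a c x y k : mu.-integrable `[a, c] (EFin \o k) ->
  a <= x -> y <= c ->
  `|\int[mu]_(t in `[x, y]) k t| <= \int[mu]_(t in `[a, c]) `|k t|.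
Proof.
move=> ik ax yc.
have ik' : mu.-integrable `[x, y] (EFin \o k) by exact: integrable_prim ik _ _ _ _.
apply: (le_trans (le_normr_Rintegral _ ik')) => //.
have ink : mu.-integrable `[a, c] (EFin \o (fun t => `|k t|)) by exact: integrable_norm.
rewrite /Rintegral fine_le//.
- by apply: integrable_fin_num => //; exact: integrable_prim ink _ _ _ _.
- exact: integrable_fin_num.
- apply: ge0_subset_integral => //; first exact: measurable_int ink.
  by apply: subset_itv; rewrite bnd_simp.
Qed.

Lemma pos_lip (u v : R) : `|Num.max 0 u - Num.max 0 v| <= `|u - v|.
Proof.
rewrite ler_norml; apply/andP; split;
  case: (leP 0 u) => hu; case: (leP 0 v) => hv; rewrite ?(max_l, max_r);
  have := ler_norm (u - v); have := ler_norm (v - u); rewrite (distrC v u); lra.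
Qed.

(** Density argument: both sides are continuous in [m] for the L^1 norm, because primitives then
    converge uniformly, and for continuous [m] the formula is the fundamental theorem of
    calculus. *)
Lemma chain_sqpos a c x m (z0 : R) : mu.-integrable `[a, c] (EFin \o m) ->
  a <= x -> x <= c ->
  Num.max 0 (z0 + \int[mu]_(t in `[a, x]) m t) ^+ 2 = Num.max 0 z0 ^+ 2 +
  \int[mu]_(y in `[a, x]) (2 * Num.max 0 (z0 + \int[mu]_(t in `[a, y]) m t) * m y).
Proof.
move=> imc ax xc.
have im : mu.-integrable `[a, x] (EFin \o m) by exact: integrable_prim imc _ _ _ _.
pose Z k y := z0 + \int[mu]_(t in `[a, y]) k t.
have cpZ k : mu.-integrable `[a, x] (EFin \o k) ->
    {within `[a, x], continuous (fun y => 2 * Num.max 0 (Z k y))}.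
  move=> ik; have cp := prim_continuous ax ik.
  apply: (@within_comp _ _ _ (fun w => 2 * Num.max 0 (z0 + w)) cp) => w.
  apply: cvgM; first exact: cvg_cst.
  apply: (@continuous_comp _ _ _ (fun w => z0 + w) (fun w => Num.max 0 w)); last exact: continuous_pos.
  by apply: cvgD; [exact: cvg_cst|exact: cvg_id].
set L : R := LHS; set S : R := RHS.
suff : `|L - S| <= 0 by rewrite normr_le0 subr_eq0 => /eqP.
pose M := \int[mu]_(t in `[a, x]) `|m t|.
have M0 : 0 <= M by apply: Rintegral_ge0.
pose A : R := `|z0| + M.
(* [A] bounds the inner function and [M] is the L^1 norm of [m]. The end values contribute e (2 A +
   e) and the integrals 2 e M + 2 (A + e) e; as e < 1, the sum is at most e times this constant. *)
apply: (@ler_eps_mul _ (4 * A + 2 * M + 3)) => e e0 e1.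
have [g [cg ig ge]] := L1_dense_continuous im e0.
have imn : mu.-integrable `[a, x] (EFin \o (fun t => `|m t|)) by exact: integrable_norm.
have ig' : mu.-integrable `[a, x] (EFin \o (fun t => m t - g t)).
  exact: integrable_subr.
have ign : mu.-integrable `[a, x] (EFin \o (fun t => `|m t - g t|)) by exact: integrable_norm.
have ZA y : a <= y -> y <= x -> `|Z m y| <= A.
  move=> ay yx; apply: (le_trans (ler_normD _ _)); rewrite lerD2l.
  exact: le_Rintegral_itv_norm im _ _.
have Ze y : a <= y -> y <= x -> `|Z m y - Z g y| <= e.
  move=> ay yx; rewrite /Z opprD addrACA subrr add0r -RintegralB//.
  - apply: (le_trans (le_Rintegral_itv_norm ig' _ _) (ltW ge)) => //.
  - exact: integrable_prim im _ _ _ _.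
  - exact: integrable_prim ig _ _ _ _.
have pA y : a <= y -> y <= x -> 0 <= Num.max 0 (Z m y) <= A.
  move=> ay yx; rewrite le_max lexx/= ge_max (le_trans (ler_norm _) (ZA _ ay yx)) andbT.
  by rewrite addr_ge0.
have pe y : a <= y -> y <= x -> `|Num.max 0 (Z m y) - Num.max 0 (Z g y)| <= e.
  by move=> ay yx; apply: (le_trans (pos_lip _ _)); exact: Ze.
have i1 := integrable_continuousM (cpZ _ im) im.
have i2 := integrable_continuousM (cpZ _ ig) ig.
have := chain_sqpos_continuous z0 ax cg; rewrite -/(Z g x).
have -> : \int[mu]_(y in `[a, x]) (2 * Num.max 0 (z0 + \int[mu]_(t in `[a, y]) g t) * g y)
  = \int[mu]_(y in `[a, x]) (2 * Num.max 0 (Z g y) * g y) by [].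
set I2 := \int[mu]_(y in `[a, x]) (2 * Num.max 0 (Z g y) * g y) => Hg.
pose I1 := \int[mu]_(y in `[a, x]) (2 * Num.max 0 (Z m y) * m y).
have HI : `|I1 - I2| <= e * (2 * M) + (2 * (A + e)) * e.
  rewrite /I1 /I2 -RintegralB//.
  have i3 : mu.-integrable `[a, x] (EFin \o (fun y => 2 * Num.max 0 (Z m y) * m y - 2 * Num.max 0 (Z g y) * g y)).
    exact: integrable_subr.
  apply: (le_trans (le_normr_Rintegral _ i3)) => //.
  have i4 : mu.-integrable `[a, x] (EFin \o (fun y => (e * 2) * `|m y|)).
    exact: integrable_mulrl.
  have i5 : mu.-integrable `[a, x] (EFin \o (fun y => (2 * (A + e)) * `|m y - g y|)).
    exact: integrable_mulrl.
  have i6 : mu.-integrable `[a, x] (EFin \o (fun y => (e * 2) * `|m y| + (2 * (A + e)) * `|m y - g y|)).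
    exact: integrable_addr.
  apply: (le_trans (@le_Rintegral _ _ _ mu `[a, x]%classic _ (fun y => (e * 2) * `|m y| + (2 * (A + e)) * `|m y - g y|) _ _ _ _)) => //.
  - exact: integrable_norm.
  - move=> y /=; rewrite in_itv/= => /andP[ay yx].
    have := pe y ay yx; have := pA y ay yx.
    set p := Num.max 0 (Z m y); set q := Num.max 0 (Z g y) => /andP[p0 pA'] pq.
    have -> : 2 * p * m y - 2 * q * g y = 2 * (p - q) * m y + 2 * q * (m y - g y) by ring.
    apply: (le_trans (ler_normD _ _)); rewrite !normrM; apply: lerD.
      by rewrite (ger0_norm (ler0n _ 2)) ler_wpM2r// mulrC ler_wpM2r//.
    rewrite (ger0_norm (ler0n _ 2)) ler_wpM2r// ler_wpM2l//.
    have : `|q| <= `|p| + `|p - q| by rewrite -{1}(subKr p q) (le_trans (ler_normB _ _)).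
    rewrite (ger0_norm p0); lra.
  - rewrite RintegralD// !RintegralZl//; rewrite -/M.
    apply: lerD; first by rewrite mulrA.
    by rewrite ler_wpM2l//; [rewrite mulr_ge0// !addr_ge0// ltW|exact: ltW].
have pex := pe x ax (lexx _); have /andP[pA0 pA1] := pA x ax (lexx _).
have -> : L - S = (Num.max 0 (Z m x) ^+ 2 - Num.max 0 (Z g x) ^+ 2) - (I1 - I2).
  rewrite Hg /L /S -/(Z m x) /I1 -/(Z _ _); ring.
apply: (le_trans (ler_normB _ _)).
have h1 : `|Num.max 0 (Z m x) ^+ 2 - Num.max 0 (Z g x) ^+ 2| <= e * (2 * A + e).
  rewrite subr_sqr normrM ler_pM//.
  move: pex pA0 pA1; set p := Num.max 0 (Z m x); set q := Num.max 0 (Z g x) => pq p0 pA'.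
  have : `|q| <= `|p| + `|p - q| by rewrite -{1}(subKr p q) (le_trans (ler_normB _ _)).
  have := ler_normD p q; rewrite (ger0_norm p0); lra.
apply: (le_trans (lerD h1 HI)).
have A0 : 0 <= A by rewrite addr_ge0.
nra.
Qed.

End ChainRule.

Section Clamping.
Context {R : realType}.
Local Notation mu := (@lebesgue_measure R).
Implicit Types (f g k m z F : R -> R) (a c x y : R).

Lemma ae_neq (a : R) : {ae mu, forall x, x <> a}.
Proof.
exists [set a]; split => //; first exact: lebesgue_measure_set1.
by move=> x /= /contrapT.
Qed.

Lemma Rintegral_split a c x k : mu.-integrable `[a, c] (EFin \o k) ->
  a <= x -> x <= c ->
  \int[mu]_(t in `[x, c]) k t = \int[mu]_(t in `[a, c]) k t - \int[mu]_(t in `[a, x]) k t.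
Proof.
move=> ik ax xc; rewrite (@Rintegral_itvB _ _ (BLeft a) (BRight c) x)//.
rewrite Rintegral_itv_obnd_cbnd//.
by apply: integrableS ik => //; apply: subset_itv; rewrite bnd_simp.
Qed.

(** The projection onto the segment. Composing with it extends a function continuous on [[a, c]] to
    a continuous function on the line, which removes subspace topologies from the later
    arguments. *)
Definition clamp a c x : R := Num.max a (Num.min c x).

Lemma clamp_id a c x : a <= x -> x <= c -> clamp a c x = x.
Proof. by move=> ax xc; rewrite /clamp min_r// max_r. Qed.

Lemma clamp_itv a c x : a <= c -> a <= clamp a c x /\ clamp a c x <= c.
Proof.
by move=> ac; rewrite /clamp le_max lexx/= ge_max ac ge_min lexx.
Qed.

Lemma continuous_clamp a c : continuous (clamp a c).
Proof.
move=> x; apply: (@continuous_max _ _ (cst a) (cst c \min id)).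
  exact: cvg_cst.
by apply: continuous_min; [exact: cvg_cst|exact: cvg_id].
Qed.

Lemma clamp_continuous a c f : a <= c -> {within `[a, c], continuous f} ->
  continuous (f \o clamp a c).
Proof.
move=> ac /subspace_continuousP cf x.
have [h1 h2] := clamp_itv x ac.
have cD : `[a, c]%classic (clamp a c x) by rewrite /= in_itv/= h1 h2.
apply: (cvg_comp _ _ _ (cf _ cD)) => B HB.
have := @continuous_clamp a c x _ HB; rewrite !nbhs_simpl /=.
apply: filterS => y; apply; rewrite /= in_itv/=.
by have [-> ->] := clamp_itv y ac.
Qed.

Lemma continuous_integral_eq0 a c f : continuous f -> (forall x, 0 <= f x) ->
  \int[mu]_(x in `[a, c]) f x = 0 -> forall x, a < x < c -> f x = 0.
Proof.
move=> cf f0 I0 x /andP[ax xc].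
have i1 y : mu.-integrable `[a, y] (EFin \o f).
  by apply: continuous_itv_integrable; exact: continuous_withinT.
have F0 y : a <= y <= c -> \int[mu]_(t in `[a, y]) f t = 0.
  move=> /andP[ay yc]; apply/le_anti/andP; split; last by apply: Rintegral_ge0.
  rewrite -I0; have := le_Rintegral_itv_norm (i1 c) (lexx a) yc.
  rewrite ger0_norm; last exact: Rintegral_ge0.
  by move=> /le_trans; apply; under eq_Rintegral do rewrite ger0_norm//.
have [_ <-] := is_derive_prim cf ax.
rewrite (@near_eq_derive _ _ _ _ (cst 0)) ?derive_cst//.
near=> y; apply: F0.
have : y \in `]a, c[ by near: y; apply: near_in_itvoo; rewrite in_itv/= ax.
by rewrite in_itv/= => /andP[/ltW-> /ltW->].
Unshelve. all: by end_near. Qed.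

End Clamping.

(** * The du Bois-Reymond lemma *)

Section DuBoisReymond.
Context {R : realType}.
Local Notation mu := (@lebesgue_measure R).
Implicit Types (f g k m z F : R -> R) (a c x y : R).

Lemma eq_ae_Rintegral a c f g : mu.-integrable `[a, c] (EFin \o f) ->
  mu.-integrable `[a, c] (EFin \o g) ->
  {ae mu, forall x, a < x < c -> f x = g x} ->
  \int[mu]_(x in `[a, c]) f x = \int[mu]_(x in `[a, c]) g x.
Proof.
move=> fi gi fg; rewrite /Rintegral; congr fine; apply: ae_eq_integral => //.
- exact: measurable_int fi.
- exact: measurable_int gi.
- have := ae_neq a; have := ae_neq c; move: fg.
  apply: filterS3; first exact: (ae_filter_ringOfSetsType mu).
  move=> x xfg xc xa; rewrite /= in_itv/= => /andP[ax xc'].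
  congr (_%:E); apply: xfg.
  by rewrite !lt_neqAle ax xc'/= !andbT; apply/andP; split; apply/eqP => // /esym.
Qed.

(** By [prim_swap] the hypothesis says that [k = g - H], with [H] the primitive of [h], is
    orthogonal to the derivatives of all C^2 functions vanishing at both ends. This forces [k] to be
    constant almost everywhere, and the conclusion is the orthogonality of a constant to [m], whose
    mean is 0. Since the identity for [k] holds pointwise almost everywhere, [m] may be far rougher
    than the derivative of a test function. *)
Lemma du_bois_reymond a c g (h : R -> R) : a < c ->
  mu.-integrable `[a, c] (EFin \o g) -> mu.-integrable `[a, c] (EFin \o h) ->
  (forall zeta zeta1 zeta2 : R -> R, continuous zeta2 ->
    (forall x, a <= x <= c -> is_derive x 1 zeta (zeta1 x) /\ is_derive x 1 zeta1 (zeta2 x)) ->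
    zeta a = 0 -> zeta c = 0 ->
    \int[mu]_(x in `[a, c]) (g x * zeta1 x) + \int[mu]_(x in `[a, c]) (h x * zeta x) = 0) ->
  forall m, mu.-integrable `[a, c] (EFin \o m) -> \int[mu]_(x in `[a, c]) m x = 0 ->
  mu.-integrable `[a, c] (EFin \o (fun x => g x * m x)) ->
  \int[mu]_(x in `[a, c]) (g x * m x) +
  \int[mu]_(x in `[a, c]) (h x * \int[mu]_(t in `[a, x]) m t) = 0.
Proof.
move=> ac ig ih Hz m im m0 igm.
pose H x := \int[mu]_(t in `[a, x]) h t.
have cH : {within `[a, c], continuous H} by apply: prim_continuous => //; exact: ltW.
have iH : mu.-integrable `[a, c] (EFin \o H) by exact: continuous_itv_integrable.
pose k x := g x - H x.
have ik : mu.-integrable `[a, c] (EFin \o k) by exact: integrable_subr.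
have i1 (r : R) : mu.-integrable `[a, c] (EFin \o cst r).
  by apply: continuous_itv_integrable; apply: continuous_withinT => x; exact: cvg_cst.
pose la := (\int[mu]_(t in `[a, c]) k t) / (c - a).
pose ka x := k x - la.
have ika : mu.-integrable `[a, c] (EFin \o ka) by apply: (integrable_subr _ ik (i1 la)).
pose N x := \int[mu]_(t in `[a, x]) ka t.
have cN : {within `[a, c], continuous N} by apply: prim_continuous => //; exact: ltW.
have Na : N a = 0 by rewrite /N set_itv1 Rintegral_set1.
have Nc : N c = 0.
  have -> : N c = \int[mu]_(x in `[a, c]) k x - \int[mu]_(x in `[a, c]) la.
    exact: RintegralB ik (i1 la).
  rewrite Rintegral_cst//= lebesgue_measure_itv/= lte_fin ac/= /la.
  by rewrite divfK ?subrr// subr_eq0 gt_eqF.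
(* The test function below has second derivative [N], the primitive of [k] minus its mean: tested
   against it, the hypothesis yields the integral of the square of [N]. *)
pose Nt := N \o clamp a c.
have cNt : continuous Nt by apply: clamp_continuous => //; exact: ltW.
(* Primitives that start to the left of [a] have a two-sided derivative at [a]. *)
pose a1 := a - 1.
have cyNt : continuous (fun y : R => y * Nt y).
  by move=> y; apply: cvgM; [exact: cvg_id|exact: cNt].
pose A x := \int[mu]_(y in `[a1, x]) Nt y.
pose B x := \int[mu]_(y in `[a1, x]) (y * Nt y).
(* The double primitive, that is the integral of (x - y) [Nt y]; subtracting the affine
   interpolation of its end values makes it vanish at [a] and [c]. *)
pose ze0 x := x * A x - B x.
pose s := (ze0 c - ze0 a) / (c - a).
pose ze x := ze0 x - (ze0 a + s * (x - a)).
pose ze1 x := A x - s.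
have dA x : a <= x -> is_derive x 1 A (Nt x).
  by move=> ax; apply: is_derive_prim => //; rewrite /a1; order_lra.
have dB x : a <= x -> is_derive x 1 B (x * Nt x).
  by move=> ax; apply: is_derive_prim => //; rewrite /a1; order_lra.
have dze1 x : a <= x -> is_derive x 1 ze1 (Nt x).
  move=> ax; have := dA x ax => dAx.
  by apply: is_derive_eq; rewrite subr0.
have dze x : a <= x -> is_derive x 1 ze (ze1 x).
  move=> ax; have := dA x ax => dAx; have := dB x ax => dBx.
  apply: is_derive_eq; rewrite /ze1 /GRing.scale/=; ring.
have zea : ze a = 0 by rewrite /ze subrr mulr0 addr0 subrr.
have zec : ze c = 0.
  by rewrite /ze /s divfK ?subr_eq0 ?gt_eqF//; ring.
have cze1 : {within `[a, c], continuous ze1}.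
  apply: derivable_within_continuous => x; rewrite in_itv/= => /andP[ax _].
  by case: (dze1 x ax).
have cze : {within `[a, c], continuous ze}.
  apply: derivable_within_continuous => x; rewrite in_itv/= => /andP[ax _].
  by case: (dze x ax).
have ize1 : mu.-integrable `[a, c] (EFin \o ze1) by exact: continuous_itv_integrable.
have zeE x : a <= x <= c -> \int[mu]_(t in `[a, x]) ze1 t = ze x.
  move=> /andP[ax xc]; rewrite -[RHS]subr0 -zea; apply: FTC2_itv => //.
  - by apply: (continuous_subspaceW _ cze); apply: subset_itvl; rewrite bnd_simp.
  - by apply: (continuous_subspaceW _ cze1); apply: subset_itvl; rewrite bnd_simp.
  - by move=> y /andP[ay _]; apply: dze; exact: ltW.
have I1 : \int[mu]_(x in `[a, c]) ze1 x = 0 by rewrite zeE ?lexx ?andbT ?ltW.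
have swapH f : mu.-integrable `[a, c] (EFin \o f) ->
    \int[mu]_(x in `[a, c]) f x = 0 ->
    \int[mu]_(x in `[a, c]) (h x * \int[mu]_(t in `[a, x]) f t) =
    - \int[mu]_(x in `[a, c]) (H x * f x).
  move=> if_ f0; rewrite prim_swap//.
  under eq_Rintegral => y.
    rewrite inE/= in_itv/= => /andP[ay yc].
    rewrite (Rintegral_split ih ay yc) -/(H y) -/(H c) mulrBr [_ * H c]mulrC [_ * H y]mulrC.
    over.
  have iHf := integrable_continuousM cH if_.
  rewrite RintegralB//; last exact: integrable_mulrl.
  by rewrite RintegralZl// f0 mulr0 sub0r.
have := Hz ze ze1 Nt cNt _ zea zec; rewrite (_ : \int[mu]_(x in `[a, c]) (h x * ze x) =
    - \int[mu]_(x in `[a, c]) (H x * ze1 x)); last first.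
  rewrite -swapH//; apply: eq_Rintegral => x; rewrite inE/= in_itv/= => /zeE ->.
  by [].
have igz : mu.-integrable `[a, c] (EFin \o (fun x => g x * ze1 x)).
  have := integrable_continuousM cze1 ig.
  by under [X in _ -> mu.-integrable _ (_ \o X)]eq_fun do rewrite mulrC.
have iHz : mu.-integrable `[a, c] (EFin \o (fun x => H x * ze1 x)).
  exact: integrable_continuousM.
have dz x : a <= x <= c -> is_derive x 1 ze (ze1 x) /\ is_derive x 1 ze1 (Nt x).
  by move=> /andP[ax xc]; split; [exact: dze|exact: dze1].
move=> /(_ dz); rewrite -RintegralB// => E1.
have ikz : mu.-integrable `[a, c] (EFin \o (fun x => ka x * ze1 x)).
  have := integrable_continuousM cze1 ika.
  by under [X in _ -> mu.-integrable _ (_ \o X)]eq_fun do rewrite mulrC.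
have E2 : \int[mu]_(x in `[a, c]) (ka x * ze1 x) = 0.
  transitivity (\int[mu]_(x in `[a, c]) (g x * ze1 x - H x * ze1 x - la * ze1 x)).
    by apply: eq_Rintegral => x _; rewrite /ka /k; ring.
  rewrite RintegralB// ?E1 ?RintegralZl// ?I1; [by rewrite mulr0 subrr| |].
    exact: integrable_subr.
  exact: integrable_mulrl.
have iNt : mu.-integrable `[a, c] (EFin \o Nt).
  by apply: continuous_itv_integrable; exact: continuous_withinT.
(* One factor [N] is written as a primitive of [ka] and moved by [prim_swap]; the result involves
   only the integral of [ka], which is [N c = 0], and [E2]. *)
have E3 : \int[mu]_(x in `[a, c]) (Nt x ^+ 2) = 0.
  transitivity (\int[mu]_(x in `[a, c]) (Nt x * \int[mu]_(t in `[a, x]) ka t)).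
    apply: eq_Rintegral => x; rewrite inE/= in_itv/= => /andP[ax xc].
    by rewrite -/(N x) /Nt/= clamp_id.
  rewrite prim_swap//.
  transitivity (\int[mu]_(x in `[a, c]) (ze1 c * ka x - ka x * ze1 x)).
    apply: eq_Rintegral => x; rewrite inE/= in_itv/= => /andP[ax xc].
    suff -> : \int[mu]_(t in `[x, c]) Nt t = ze1 c - ze1 x by ring.
    apply: FTC2_itv => //.
    - apply: (continuous_subspaceW _ cze1) => y /=; rewrite !in_itv/=.
      by move=> /andP[xy ->]; rewrite (le_trans ax).
    - exact: continuous_withinT.
    - by move=> y /andP[xy _]; apply: dze1; rewrite (le_trans ax)// ltW.
  rewrite RintegralB//; last exact: integrable_mulrl.
  by rewrite RintegralZl// E2 -/(N c) Nc mulr0 subrr.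
have Nx0 x : a <= x <= c -> N x = 0.
  move=> /andP[]; rewrite le_eqVlt => /predU1P[<- //|ax].
  rewrite le_eqVlt => /predU1P[-> //|xc].
  have cN2 : continuous (fun x => Nt x ^+ 2).
    by move=> y; apply: (@cvgM _ _ _ _ Nt Nt); exact: cNt.
  have N20 y : 0 <= Nt y ^+ 2 by exact: sqr_ge0.
  have /eqP := continuous_integral_eq0 cN2 N20 E3 (introT andP (conj ax xc)).
  by rewrite sqrf_eq0 /Nt/= clamp_id ?ltW// => /eqP.
have kae := prim_eq0_ae ika Nx0.
rewrite (swapH m)//.
have iHm := integrable_continuousM cH im.
rewrite (@eq_ae_Rintegral a c _ (fun x => H x * m x + la * m x))//.
- by rewrite RintegralD// ?RintegralZl// ?m0 ?mulr0 ?addr0 ?subrr//; exact: integrable_mulrl.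
- by apply: integrable_addr => //; exact: integrable_mulrl.
- move: kae; apply: filterS; first exact: (ae_filter_ringOfSetsType mu).
  move=> x xk xac.
  by have := xk xac; rewrite /ka /k => /eqP; rewrite subr_eq0 subr_eq => /eqP ->; rewrite mulrDl addrC.
Qed.

End DuBoisReymond.

(** * Test functions and weak derivatives *)

Section FlatExponential.
Context {R : realType}.
Local Notation mu := (@lebesgue_measure R).
Implicit Types (f g F : R -> R) (x : R).

(** For [k = 0] this is the classical flat function; the powers of [x^-1] make the family closed
    under derivation up to linear combinations. *)
Definition bexp (k : nat) (x : R) : R := if 0 < x then x^-1 ^+ k * expR (- x^-1) else 0.

Lemma is_derive_comp_eq f g (x a b c : R) : is_derive (g x) 1 f a ->
  is_derive x 1 g b -> c = a * b -> is_derive x 1 (fun y : R => f (g y)) c.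
Proof. by move=> df dg ->; exact: is_derive1_comp. Qed.

(* A class of functions closed under derivation that contains the flat exponential, so that all
   its elements are infinitely differentiable. *)
Inductive smooth_gen : (R -> R) -> Prop :=
| smooth_bexp k : smooth_gen (bexp k)
| smooth_cst (r : R) : smooth_gen (cst r)
| smooth_add f g : smooth_gen f -> smooth_gen g -> smooth_gen (f + g)
| smooth_mul f g : smooth_gen f -> smooth_gen g -> smooth_gen (f * g)
| smooth_affine f (k l : R) : smooth_gen f -> smooth_gen (fun x => f (k * x + l))
| smooth_prim f F : smooth_gen f -> (forall x : R, is_derive x 1 F (f x)) -> smooth_gen F.

Lemma bexp_ge0 k x : 0 <= bexp k x.
Proof.
rewrite /bexp; case: ifPn => // x0.
by rewrite mulr_ge0// ?expR_ge0// exprn_ge0// invr_ge0 ltW.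
Qed.

(** The term of order k + 2 of the exponential series at [x^-1] gives exactly the quadratic bound
    that [is_derive_quad] asks at the origin. *)
Lemma bexp_le k x : bexp k x <= (k.+2)`!%:R * x ^+ 2.
Proof.
rewrite /bexp; case: ifPn => [x0|_]; last by rewrite mulr_ge0// sqr_ge0.
set y := x^-1; have y0 : 0 < y by rewrite invr_gt0.
have yx : y * x = 1 by rewrite mulVf// gt_eqF.
have Q : y ^+ k.+2 <= (k.+2)`!%:R * expR y.
  rewrite mulrC -ler_pdivrMr ?ltr0n ?fact_gt0//.
  by apply: le_trans (expR_ge1Dxn k.+1 (ltW y0)); rewrite lerDr.
have -> : y ^+ k * expR (- y) = y ^+ k.+2 * expR (- y) * x ^+ 2.
  rewrite -addn2 exprD.
  have -> : y ^+ k * y ^+ 2 * expR (- y) * x ^+ 2 = y ^+ k * expR (- y) * (y * x) ^+ 2 by ring.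
  by rewrite yx expr1n mulr1.
by rewrite ler_wpM2r ?sqr_ge0// expRN ler_pdivrMr ?expR_gt0.
Qed.

Lemma is_derive_bexp k x :
  is_derive x 1 (bexp k) (bexp k.+2 x - k%:R * bexp k.+1 x).
Proof.
have [x0|x0|x0] := ltgtP 0 x.
- have xn : x != 0 by rewrite gt_eqF.
  apply: (@near_eq_is_derive _ _ _ (fun x => x^-1 ^+ k * expR (- x^-1))).
  + near=> y; rewrite /bexp ifT//; near: y; exact: lt_nbhsr.
  have dV : is_derive x 1 (fun x : R => x^-1) (- x ^- 2).
    by have := @is_deriveV _ id x 1 1 xn (is_derive_id _ _); rewrite /GRing.scale/= mulr1.
  have dN : is_derive x 1 (fun x : R => - x^-1) (x ^- 2).
    by have := is_deriveN dV; rewrite opprK.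
  have dE : is_derive x 1 (fun x : R => expR (- x^-1)) (expR (- x^-1) * x ^- 2).
    by apply: (is_derive_comp_eq (is_derive_expR _) dN).
  have dX : is_derive x 1 (fun x : R => x^-1 ^+ k) (k%:R * x^-1 ^+ k.-1 * (- x ^- 2)).
    have := @is_deriveX _ _ (fun x : R => x^-1) k x 1 _ dV.
    by rewrite /GRing.scale/= exprfctE.
  apply: is_derive_eq.
  rewrite /GRing.scale/= /bexp x0 -exprVn.
  case: k {dX} => [|k]; rewrite /= ?mul0r ?mulr0 ?subr0 ?addr0 !exprS ?expr0; ring.
- apply: (@near_eq_is_derive _ _ _ (cst 0)).
  + near=> y; rewrite /bexp ifF//; apply/negbTE; rewrite -leNgt ltW//.
    by near: y; exact: lt_nbhsl.
  rewrite /bexp [0 < x]ltNge (ltW x0)/= mulr0 subr0.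
  exact: is_derive_cst.
- rewrite -x0 /bexp ltxx mulr0 subr0.
  apply: (@is_derive_quad _ _ _ _ (k.+2)`!%:R) => h.
  rewrite add0r ltxx mul0r !subr0 -/(bexp k h).
  by rewrite ger0_norm ?bexp_ge0// bexp_le.
Unshelve. all: by end_near. Qed.

Lemma smooth_gen_derive f : smooth_gen f ->
  exists2 f', smooth_gen f' & forall x : R, is_derive x 1 f (f' x).
Proof.
elim=> {f}.
- move=> k; exists (bexp k.+2 + cst (- k%:R) * bexp k.+1).
    by apply: smooth_add; [|apply: smooth_mul]; constructor.
  move=> x; have := is_derive_bexp k x.
  by rewrite -mulNr.
- by move=> r; exists (cst 0); [exact: smooth_cst|move=> x; exact: is_derive_cst].
- move=> f g _ [f' sf df] _ [g' sg dg]; exists (f' + g'); first exact: smooth_add.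
  by move=> x; have := df x; have := dg x => dgx dfx; exact: is_deriveD.
- move=> f g sf0 [f' sf df] sg0 [g' sg dg]; exists (f * g' + g * f').
    by apply: smooth_add; exact: smooth_mul.
  by move=> x; have := df x; have := dg x => dgx dfx; exact: is_deriveM.
- move=> f k l sf0 [f' sf df]; exists (cst k * (fun x => f' (k * x + l))).
    by apply: smooth_mul; [exact: smooth_cst|exact: smooth_affine].
  move=> x.
  have d1 : is_derive x 1 (fun x : R => k * x + l) k.
    apply: is_derive_eq; by rewrite /GRing.scale/= mulr1 addr0.
  by apply: (is_derive_comp_eq (df _) d1); rewrite /= mulrC.
- by move=> f F sf _ dF; exists f.
Qed.

Lemma smooth_gen_derive1n f n : smooth_gen f -> smooth_gen (derive1n n f).
Proof.
move=> sf; elim: n => [|n IH]; first by [].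
have [f' sf' df'] := smooth_gen_derive IH.
rewrite derive1nS; suff -> : derive1 (derive1n n f) = f' by [].
by apply/funext => x; rewrite derive1E; case: (df' x).
Qed.

Lemma smooth_gen_derivable f n (x : R) : smooth_gen f -> derivable (derive1n n f) x 1.
Proof.
by move=> /(smooth_gen_derive1n n)/smooth_gen_derive[f' _ /(_ x)[]].
Qed.

End FlatExponential.

Section SmoothSteps.
Context {R : realType}.
Local Notation mu := (@lebesgue_measure R).
Implicit Types (f g F : R -> R) (x y a c w : R).

Lemma continuous_smooth_gen f : smooth_gen f -> continuous f.
Proof.
move=> /smooth_gen_derive[f' _ df] x.
by apply/differentiable_continuous/derivable1_diffP; case: (df x).
Qed.

Definition bump : R -> R := bexp 0 * (fun x => bexp 0 (-1 * x + 1)).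

Lemma smooth_bump : smooth_gen bump.
Proof.
apply: smooth_mul; first exact: smooth_bexp.
by apply: smooth_affine; exact: smooth_bexp.
Qed.

Lemma bump_ge0 x : 0 <= bump x.
Proof. by rewrite mulr_ge0// bexp_ge0. Qed.

Lemma bump_out x : x <= 0 \/ 1 <= x -> bump x = 0.
Proof.
rewrite (_ : bump x = bexp 0 x * bexp 0 (-1 * x + 1))// /bexp => -[x0|x1].
  by rewrite ltNge x0/= mul0r.
by rewrite [X in _ * X]ifF ?mulr0//; apply/negbTE; rewrite -leNgt mulN1r addrC subr_le0.
Qed.

Lemma bump_gt0 x : 0 < x < 1 -> 0 < bump x.
Proof.
rewrite (_ : bump x = bexp 0 x * bexp 0 (-1 * x + 1))// /bexp => /andP[x0 x1].
by rewrite x0 ifT ?mulN1r ?(addrC (- x)) ?subr_gt0// mulr_gt0// mulr_gt0 ?expR_gt0// ?exprn_gt0 ?invr_gt0 ?subr_gt0.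
Qed.

(** The lower end -1 lies strictly to the left of the support, so that the derivative at 0 is
    two-sided. *)
Definition ibump x : R := \int[mu]_(t in `[-1, x]) bump t.

Let cb : continuous bump := continuous_smooth_gen smooth_bump.

Let ib a c : mu.-integrable `[a, c] (EFin \o bump).
Proof. by apply: continuous_itv_integrable; exact: continuous_withinT. Qed.

Lemma ibump_le0 x : x <= 0 -> ibump x = 0.
Proof.
move=> x0; rewrite /ibump (@eq_Rintegral _ _ _ mu _ (cst 0)) ?Rintegral_cst ?mul0r//.
move=> t; rewrite inE/= in_itv/= => /andP[_ tx]; apply: bump_out; left.
exact: le_trans x0.
Qed.

Lemma is_derive_ibump x : is_derive x 1 ibump (bump x).
Proof.
have [x0|x0] := leP 0 x.
  by apply: is_derive_prim => //; rewrite (lt_le_trans _ x0)// ltrN10.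
rewrite bump_out; last by left; exact: ltW.
apply: (@near_eq_is_derive _ _ _ (cst 0)).
near=> y; rewrite ibump_le0// ltW//; near: y; exact: lt_nbhsl.
Unshelve. all: by end_near. Qed.

Lemma ibump_ge1 x : 1 <= x -> ibump x = ibump 1.
Proof.
move=> x1; rewrite /ibump; apply/eqP; rewrite -subr_eq0; apply/eqP.
rewrite -(Rintegral_split (ib _ _)) ?ler0N1 ?(le_trans _ x1)//.
rewrite (@eq_Rintegral _ _ _ mu _ (cst 0)) ?Rintegral_cst ?mul0r//.
by move=> t; rewrite inE/= in_itv/= => /andP[t1 _]; apply: bump_out; right.
Qed.

Lemma ibump1_gt0 : 0 < ibump 1.
Proof.
rewrite lt_neqAle Rintegral_ge0 ?andbT; last by move=> t _; exact: bump_ge0.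
apply/eqP => /esym I0.
have h1 : (-1 : R) < 2^-1 by lra.
have h2 : (2^-1 : R) < 1 by lra.
have := continuous_integral_eq0 cb bump_ge0 I0 (introT andP (conj h1 h2)).
by apply/eqP; rewrite gt_eqF// bump_gt0// h2 andbT invr_gt0 ltr0n.
Qed.

Definition sstep x : R := ibump x / ibump 1.

Lemma smooth_sstep : smooth_gen sstep.
Proof.
have -> : sstep = ibump * cst (ibump 1)^-1 by [].
apply: smooth_mul; last exact: smooth_cst.
by apply: (smooth_prim smooth_bump); exact: is_derive_ibump.
Qed.

Lemma is_derive_sstep x : is_derive x 1 sstep (bump x / ibump 1).
Proof.
have -> : sstep = (ibump 1)^-1 *: ibump by apply/funext => y; rewrite /sstep mulrC.
have := is_derive_ibump x => d.
by apply: is_derive_eq; rewrite /GRing.scale/= mulrC.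
Qed.

Lemma sstep_le0 x : x <= 0 -> sstep x = 0.
Proof. by move=> x0; rewrite /sstep ibump_le0// mul0r. Qed.

Lemma sstep_ge1 x : 1 <= x -> sstep x = 1.
Proof. by move=> x0; rewrite /sstep ibump_ge1// divff// gt_eqF// ibump1_gt0. Qed.

Lemma sstep_itv x : 0 <= sstep x <= 1.
Proof.
apply/andP; split.
  by rewrite divr_ge0// Rintegral_ge0// => t _; exact: bump_ge0.
rewrite ler_pdivrMr ?ibump1_gt0// mul1r.
have [x1|x1] := leP 1 x; first by rewrite ibump_ge1.
have [x0|x0] := leP x (-1).
  have x0' : x <= 0 by lra.
  by rewrite ibump_le0// ltW// ibump1_gt0.
have := le_Rintegral_itv_norm (ib (-1) 1) (lexx _) (ltW x1).
rewrite -/(ibump x) => /(le_trans (ler_norm _))/le_trans; apply.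
by under eq_Rintegral do rewrite ger0_norm ?bump_ge0//.
Qed.

(** A mollifier of integral 1 carried by [[y, y + w]]: the derivative of the smooth step that rises
    from 0 to 1 there. *)
Definition kernel w y x : R := bump (w^-1 * x + - (w^-1 * y)) / ibump 1 * w^-1.

Lemma is_derive_step w y x :
  is_derive x 1 (fun x => sstep (w^-1 * x + - (w^-1 * y))) (kernel w y x).
Proof.
have d1 : is_derive x 1 (fun x : R => w^-1 * x + - (w^-1 * y)) w^-1.
  by apply: is_derive_eq; rewrite /GRing.scale/= mulr1 ?subr0 ?addr0.
exact: (is_derive_comp_eq (is_derive_sstep _) d1).
Qed.

Lemma continuous_kernel w y : continuous (kernel w y).
Proof.
have -> : kernel w y = (fun x => bump (w^-1 * x + - (w^-1 * y))) * cst ((ibump 1)^-1 * w^-1).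
  by apply/funext => x; rewrite /kernel -mulrA.
apply: continuous_smooth_gen; apply: smooth_mul; last exact: smooth_cst.
by apply: smooth_affine; exact: smooth_bump.
Qed.

Lemma kernel_ge0 w y x : 0 < w -> 0 <= kernel w y x.
Proof.
move=> w0; apply: mulr_ge0; last by rewrite invr_ge0 ltW.
by rewrite divr_ge0 ?bump_ge0// ltW// ibump1_gt0.
Qed.

Lemma kernel_out w y x : 0 < w -> x < y \/ y + w < x -> kernel w y x = 0.
Proof.
move=> w0 H; rewrite /kernel bump_out ?mul0r// -mulrBr mulrC.
rewrite ler_pdivrMr// mul0r ler_pdivlMr// mul1r.
by case: H => H; [left|right]; lra.
Qed.

Lemma kernel_avg w y a c f x0 (e : R) : 0 < w -> a <= y -> y + w <= c ->
  {within `[a, c], continuous f} ->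
  (forall x, y <= x <= y + w -> `|f x - f x0| <= e) ->
  `|\int[mu]_(x in `[a, c]) (f x * kernel w y x) - f x0| <= e.
Proof.
move=> w0 ay yc cf H.
have ac : a <= c by lra.
have e0 : 0 <= e.
  by apply: le_trans (H y _); [exact: normr_ge0|rewrite lexx lerDl ltW].
have ck := @continuous_kernel w y.
have ik : mu.-integrable `[a, c] (EFin \o kernel w y).
  by apply: continuous_itv_integrable; exact: continuous_withinT.
have ifk := integrable_continuousM cf ik.
have K1 : \int[mu]_(x in `[a, c]) kernel w y x = 1.
  transitivity (sstep (w^-1 * c + - (w^-1 * y)) - sstep (w^-1 * a + - (w^-1 * y))).
    apply: (@FTC2_itv _ a c (fun x => sstep (w^-1 * x + - (w^-1 * y))) (kernel w y)) => //.
    - apply: continuous_withinT; apply: continuous_smooth_gen.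
      by apply: (@smooth_affine _ sstep); exact: smooth_sstep.
    - exact: continuous_withinT.
    - by move=> x _; exact: is_derive_step.
  rewrite -!mulrBr ![w^-1 * _]mulrC sstep_ge1 ?sstep_le0 ?subr0//.
    by rewrite ler_pdivrMr// mul0r; lra.
  by rewrite ler_pdivlMr// mul1r; lra.
have -> : f x0 = \int[mu]_(x in `[a, c]) (f x0 * kernel w y x).
  by rewrite RintegralZl// K1 mulr1.
rewrite -RintegralB//; last exact: integrable_mulrl.
have i3 : mu.-integrable `[a, c] (EFin \o (fun x => f x * kernel w y x - f x0 * kernel w y x)).
  by apply: integrable_subr => //; exact: integrable_mulrl.
apply: (le_trans (le_normr_Rintegral _ i3)) => //.
have ie : mu.-integrable `[a, c] (EFin \o (fun x => e * kernel w y x)) by exact: integrable_mulrl.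
rewrite -[leRHS]mulr1 -K1 -RintegralZl//.
apply: le_Rintegral => //; first exact: integrable_normr.
move=> x _; rewrite -mulrBl normrM (ger0_norm (kernel_ge0 _ _ w0)).
have [xy|xy] := ltP x y; first by rewrite kernel_out ?mulr0//; left.
have [xw|xw] := ltP (y + w) x; first by rewrite kernel_out ?mulr0//; right.
by rewrite ler_wpM2r ?kernel_ge0// H// xy.
Qed.

End SmoothSteps.

Section WeakDerivativePrimitive.
Context {R : realType}.
Local Notation mu := (@lebesgue_measure R).
Implicit Types (f g F : R -> R) (x y a c w e : R).

Lemma continuous_eps f x e : continuous f -> 0 < e ->
  exists2 d, 0 < d & forall y, `|y - x| < d -> `|f y - f x| < e.
Proof.
move=> cf e0; have /cvgrPdist_lt/(_ _ e0)/nbhs_ballP[d /= d0 H] := cf x.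
exists d => // y yx; rewrite distrC; apply: H.
by rewrite /ball/= distrC.
Qed.

Lemma within_eps a c f x e : a <= c -> {within `[a, c], continuous f} ->
  a <= x -> x <= c -> 0 < e -> exists2 d, 0 < d &
  forall y, a <= y -> y <= c -> `|y - x| < d -> `|f y - f x| < e.
Proof.
move=> ac cf ax xc e0.
have [d d0 H] := continuous_eps x (clamp_continuous ac cf) e0.
by exists d => // y ay yc /H; rewrite /= !clamp_id.
Qed.

(** The weak derivative is tested with a smooth trapezoid that rises on [[x1, x1 + w]] and falls on
    [[x2 - w, x2]]. Its derivative is a difference of two mollifiers, which recover [f x1] and
    [f x2] by continuity from inside the segment, while the trapezoid differs from 1 only on the two
    ramps, where [|g|] has small mass. *)
Lemma weak_derivative_prim f g x1 x2 : weak_derivative f g -> x1 < x2 ->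
  {within `[x1, x2], continuous f} ->
  mu.-integrable `[x1, x2] (EFin \o g) /\
  f x2 - f x1 = \int[mu]_(x in `[x1, x2]) g x.
Proof.
move=> [_ [mg _ lg] fg] x12 cf.
have ig : mu.-integrable `[x1, x2] (EFin \o g).
  apply/integrableP; split; first by apply/measurable_EFinP; exact: measurable_funS mg.
  by apply: (lg `[x1, x2]%classic) => //; exact: segment_compact.
split => //; apply/eqP; rewrite -subr_eq0 -normr_le0; apply/eqP; apply/eqP.
(* One [e] for each end value of [f], and one for the mass of [|g|] on each ramp. *)
apply: (@ler_eps_mul _ _ 4) => e e0 _.
have ing : mu.-integrable `[x1, x2] (EFin \o (fun x => `|g x|)) by exact: integrable_normr.
have x12' := ltW x12.
have cG := prim_continuous x12' ing; set G := fun x => _ in cG.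
have [d1 d10 H1] := within_eps x12' cf (lexx _) x12' e0.
have [d2 d20 H2] := within_eps x12' cf x12' (lexx _) e0.
have [d3 d30 H3] := within_eps x12' cG (lexx _) x12' e0.
have [d4 d40 H4] := within_eps x12' cG x12' (lexx _) e0.
(* The halves leave room for the strict inequalities in the moduli of continuity, and the last bound
   keeps the two ramps from overlapping. *)
have [w w0 [w1 w2 w3 w4 w5]] : exists2 w, 0 < w &
    [/\ w <= d1 / 2, w <= d2 / 2, w <= d3 / 2, w <= d4 / 2 & w <= (x2 - x1) / 2].
  exists (Num.min (Num.min (d1 / 2) (d2 / 2)) (Num.min (Num.min (d3 / 2) (d4 / 2)) ((x2 - x1) / 2))).
    by rewrite !lt_min !divr_gt0// subr_gt0.
  by split; rewrite !ge_min lexx ?orbT.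
pose y2 := x2 - w.
pose s1 x := sstep (w^-1 * x + - (w^-1 * x1)); pose s2 x := sstep (w^-1 * x + - (w^-1 * y2)).
have s1_0 x : x <= x1 -> s1 x = 0.
  by move=> h; rewrite /s1 sstep_le0// -mulrBr mulrC ler_pdivrMr// mul0r; order_lra.
have s2_0 x : x <= y2 -> s2 x = 0.
  by move=> h; rewrite /s2 sstep_le0// -mulrBr mulrC ler_pdivrMr// mul0r; order_lra.
have s1_1 x : x1 + w <= x -> s1 x = 1.
  by move=> h; rewrite /s1 sstep_ge1// -mulrBr mulrC ler_pdivlMr// mul1r; order_lra.
have s2_1 x : x2 <= x -> s2 x = 1.
  by move=> h; rewrite /s2 sstep_ge1// -mulrBr mulrC ler_pdivlMr// mul1r /y2; order_lra.
pose phi := s1 - s2.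
have sm1 : smooth_gen s1 by apply: (@smooth_affine _ sstep); exact: smooth_sstep.
have sm2 : smooth_gen s2 by apply: (@smooth_affine _ sstep); exact: smooth_sstep.
have smphi : smooth_gen phi.
  have -> : phi = s1 + cst (-1) * s2.
    apply/funext => x; rewrite (_ : phi x = s1 x - s2 x)//.
    by rewrite (_ : (s1 + cst (-1) * s2) x = s1 x + -1 * s2 x)// mulN1r.
  by apply: smooth_add => //; apply: smooth_mul => //; exact: smooth_cst.
have out x : x < x1 \/ x2 < x -> phi x = 0.
  move=> [h|h].
    have -> : phi x = s1 x - s2 x by [].
    by rewrite s1_0 ?s2_0 ?subrr /y2 ?ltW//; order_lra.
  have -> : phi x = s1 x - s2 x by [].
  by rewrite s1_1 ?s2_1 ?subrr ?ltW//; order_lra.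
have tphi : test_function phi.
  split; first by move=> n x; exact: smooth_gen_derivable.
  exists (`|x1| + `|x2|) => x hx; apply: out.
  have [h|h] := ltP x x1; first by left.
  right; rewrite ltNge; apply/negP => h2; move: hx; rewrite ltNge => /negP; apply.
  rewrite ler_norml; have := ler_norm x2; have := ler_norm (- x1); rewrite normrN.
  have := normr_ge0 x1; have := normr_ge0 x2; order_lra.
have dphi x : derive1 phi x = kernel w x1 x - kernel w y2 x.
  have e1 := is_derive_step w x1 x; have e2 := is_derive_step w y2 x.
  by rewrite derive1E; case: (is_deriveB e1 e2).
have := fg phi tphi.
have ifk y : mu.-integrable `[x1, x2] (EFin \o (fun x => f x * kernel w y x)).
  apply: integrable_continuousM => //; apply: continuous_itv_integrable.
  by apply: continuous_withinT; exact: continuous_kernel.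
have -> : \int[mu]_x (f x * derive1 phi x) = \int[mu]_(x in `[x1, x2]) (f x * kernel w x1 x)
    - \int[mu]_(x in `[x1, x2]) (f x * kernel w y2 x).
  rewrite -RintegralB// [RHS]Rintegral_mkcond; apply: eq_Rintegral => x _.
  rewrite patchE dphi; case: ifPn => [_|]; first by rewrite mulrBr.
  rewrite notin_setE/= in_itv/= => /negP; rewrite negb_and -!ltNge => /orP[h|h].
    rewrite !kernel_out ?subr0 ?mulr0//; left => //.
    by rewrite /y2; order_lra.
  by rewrite !kernel_out ?subr0 ?mulr0//; right => //; rewrite /y2; order_lra.
have cphi : continuous phi by exact: continuous_smooth_gen.
have igp : mu.-integrable `[x1, x2] (EFin \o (fun x => g x * phi x)).
  have := integrable_continuousM (@continuous_withinT _ `[x1, x2] _ cphi) ig.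
  by under [X in _ -> mu.-integrable _ (_ \o X)]eq_fun do rewrite mulrC.
have -> : \int[mu]_x (g x * phi x) = \int[mu]_(x in `[x1, x2]) (g x * phi x).
  rewrite [RHS]Rintegral_mkcond; apply: eq_Rintegral => x _.
  rewrite patchE; case: ifPn => //.
  rewrite notin_setE/= in_itv/= => /negP; rewrite negb_and -!ltNge => /orP[h|h].
    by rewrite out ?mulr0//; left.
  by rewrite out ?mulr0//; right.
set K1 := \int[mu]_(x in _) (f x * kernel w x1 x).
set K2 := \int[mu]_(x in _) (f x * kernel w y2 x).
set J := \int[mu]_(x in _) (g x * phi x) => E.
have B1 : `|K1 - f x1| <= e.
  apply: kernel_avg => //; first by order_lra.
  move=> x /andP[h1 h2]; apply/ltW/H1 => //; first order_lra.
  by rewrite ger0_norm; order_lra.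
have B2 : `|K2 - f x2| <= e.
  apply: kernel_avg => //; rewrite /y2; [order_lra|order_lra|].
  move=> x /andP[h1 h2]; apply/ltW/H2 => //; [order_lra|order_lra|].
  by rewrite distrC ger0_norm; order_lra.
have B3 : `|\int[mu]_(x in `[x1, x2]) g x - J| <= e + e.
  rewrite -RintegralB//.
  have i1 : mu.-integrable `[x1, x2] (EFin \o (fun x => g x - g x * phi x)) by exact: integrable_subr.
  apply: (le_trans (le_normr_Rintegral _ i1)) => //.
  have ir y z : x1 <= y -> z <= x2 -> mu.-integrable `[x1, x2] (EFin \o ((fun x => `|g x|) \_ `[y, z])).
    move=> hy hz; rewrite -restrict_EFin; apply/integrable_restrict => //.
    by rewrite setIidr//; [exact: integrable_prim ing _ _ _ _ | apply: subset_itv; rewrite bnd_simp].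
  have B : \int[mu]_(x in `[x1, x2]) `|g x - g x * phi x| <=
     \int[mu]_(x in `[x1, x1 + w]) `|g x| + \int[mu]_(x in `[y2, x2]) `|g x|.
    have er y z : x1 <= y -> z <= x2 -> \int[mu]_(x in `[y, z]) `|g x| = \int[mu]_(x in `[x1, x2]) ((fun x => `|g x|) \_ `[y, z]) x.
      move=> hy hz; rewrite -Rintegral_mkcondr setIidr//.
      by apply: subset_itv; rewrite bnd_simp.
    have q1 : x1 + w <= x2 by order_lra.
    have q2 : x1 <= y2 by rewrite /y2; order_lra.
    rewrite !er// -RintegralD//; [|exact: ir|exact: ir].
    apply: le_Rintegral => //; [exact: integrable_normr|by apply: integrable_addr => //; exact: ir|].
    move=> x; rewrite /= in_itv/= => /andP[h1 h2].
    rewrite -{1}[g x]mulr1 -mulrBr normrM !patchE.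
    have /andP[t1 t2] := sstep_itv (w^-1 * x + - (w^-1 * x1)).
    have /andP[t3 t4] := sstep_itv (w^-1 * x + - (w^-1 * y2)).
    rewrite (_ : phi x = s1 x - s2 x)//.
    have n0 := normr_ge0 (g x).
    have [h3|h3] := leP x (x1 + w).
      rewrite mem_set; last by rewrite /= in_itv/= h1 h3.
      rewrite s2_0; last by rewrite /y2; order_lra.
      rewrite subr0.
      have : `|1 - s1 x| <= 1 by rewrite ger0_norm; rewrite /s1; order_lra.
      move=> /(ler_wpM2l n0); rewrite mulr1 => /le_trans; apply.
      by rewrite lerDl; case: ifP.
    rewrite s1_1; last exact: ltW.
    rewrite opprB addrCA subrr addr0.
    have [h4|h4] := leP y2 x.
      rewrite (mem_set (_ : [set` `[y2, x2]] x)); last by rewrite /= in_itv/= h4 h2.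
      have : `|s2 x| <= 1 by rewrite ger0_norm; rewrite /s2; order_lra.
      move=> /(ler_wpM2l n0); rewrite mulr1 => /le_trans; apply.
      by rewrite lerDr; case: ifP.
    rewrite s2_0; last exact: ltW.
    rewrite normr0 mulr0.
    by apply: addr_ge0; case: ifP.
  apply: (le_trans B); apply: lerD.
    have := H3 (x1 + w); rewrite /G set_itv1 Rintegral_set1 subr0 => H3'.
    apply: le_trans (ler_norm _) _; apply/ltW/H3'; [order_lra|order_lra|].
    by rewrite ger0_norm; order_lra.
  rewrite (Rintegral_split ing); [|rewrite /y2; order_lra|rewrite /y2; order_lra].
  rewrite -/(G x2) -/(G y2).
  apply: le_trans (ler_norm _) _; rewrite distrC; apply/ltW/H4; rewrite /y2; [order_lra|order_lra|].
  by rewrite distrC ger0_norm; order_lra.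
have -> : f x2 - f x1 - \int[mu]_(x in `[x1, x2]) g x =
  (K1 - f x1) - (K2 - f x2) - (\int[mu]_(x in `[x1, x2]) g x - J) by lra.
apply: (le_trans (ler_normB _ _)).
have := ler_normB (K1 - f x1) (K2 - f x2); order_lra.
Qed.

End WeakDerivativePrimitive.

(** * Backward averages in time *)

Section Plane.
Context {R : realType}.
Local Notation mu := (@lebesgue_measure R).
Implicit Types (x y t a c h : R).

Lemma rat_dist_lt x (r : R) : 0 < r -> exists q : rat, `|ratr q - x| < r.
Proof.
move=> r0; have /rat_in_itvoo[q] : x - r < x + r by lra.
by rewrite in_itv/= => /andP[h1 h2]; exists q; rewrite ltr_norml; apply/andP; split; lra.
Qed.

(** Second countability: an open set is the countable union of the boxes with rational centre and
    radius 1 / (n + 1) that it contains, and boxes belong to the product sigma-algebra. *)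
Lemma open_measurable2 (O : set (R * R)) : open O -> measurable O.
Proof.
move=> oO.
pose box (q : rat * rat * nat) : set (R * R) :=
  ball (ratr q.1.1 : R) (q.2.+1%:R^-1) `*` ball (ratr q.1.2 : R) (q.2.+1%:R^-1).
pose F (q : rat * rat * nat) : set (R * R) := if `[< box q `<=` O >] then box q else set0.
have -> : O = \bigcup_q F q.
  apply/seteqP; split => [[x t] Oxt|z [q _]]; last first.
    by rewrite /F; case: ifPn => // /asboolP; apply.
  have [e /= e0 He] : exists2 e : R, 0 < e & forall y s : R, `|x - y| < e -> `|t - s| < e -> O (y, s).
    move: oO; rewrite openE => /(_ _ Oxt)/nbhs_ballP[e /= e0 He].
    by exists e => // y s xy ts; apply: He; split.
  have [n Hn] : exists n : nat, n.+1%:R^-1 < e / 2.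
    have := @ltr_add_invr R 0 (e / 2); rewrite divr_gt0// => /(_ isT)[n].
    by rewrite add0r; exists n.
  have n0 : 0 < n.+1%:R^-1 :> R by rewrite invr_gt0.
  have [q1 Hq1] := rat_dist_lt x n0; have [q2 Hq2] := rat_dist_lt t n0.
  have tri (u v w r : R) : `|v - u| < r -> `|v - w| < r -> r < e / 2 -> `|u - w| < e.
    move=> h1 h2 h3; rewrite -(subrKA v); apply: le_lt_trans (ler_normD _ _) _.
    by rewrite distrC in h1; lra.
  exists (q1, q2, n) => //; rewrite /F ifT; first by split; rewrite /ball/=.
  by apply/asboolP => -[y s] [/= h1 h2]; apply: He; [exact: tri Hq1 h1 Hn|exact: tri Hq2 h2 Hn].
apply: countable_bigcupT_measurable => [|q]; first exact: countableP.
rewrite /F; case: ifPn => // _; apply: measurableX; exact: measurable_ball.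
Qed.

Lemma continuous_measurable_fun2 (f : R * R -> R) : continuous f -> measurable_fun setT f.
Proof.
move=> /continuousP cf; apply: (measurability _ (RGenOpens.measurableE R)).
move=> _ [_ [a [b ->] <-]]; rewrite setTI; apply: open_measurable2.
exact/cf/interval_open.
Qed.

(** The integral is by definition the difference of those of the positive and negative parts; each
    is measurable in the parameter by Tonelli's theorem, and [fine] is measurable. *)
Lemma measurable_Rintegral_param d (T : measurableType d) (g : T * R -> R) :
  measurable_fun setT g ->
  measurable_fun setT (fun z => \int[mu]_r g (z, r)).
Proof.
move=> mg; rewrite /Rintegral.
apply: (@measurableT_comp _ _ _ _ _ _ (@fine R)) => //.
rewrite (_ : (fun z => _) = (fun z => \int[mu]_r ((EFin \o g)^\+ (z, r)) - \int[mu]_r ((EFin \o g)^\- (z, r)))%E); last first.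
  apply/funext => z; rewrite integralE.
  by congr (_ - _)%E; apply: eq_integral => r _; rewrite ?funeposE ?funenegE.
have mg' : measurable_fun setT (EFin \o g) by exact/measurable_EFinP.
apply: emeasurable_funB.
- apply: (@measurable_fun_fubini_tonelli_F _ _ _ _ _ mu ((EFin \o g)^\+)%E) => //.
  exact: measurable_funepos.
- apply: (@measurable_fun_fubini_tonelli_F _ _ _ _ _ mu ((EFin \o g)^\-)%E) => //.
  exact: measurable_funeneg.
Qed.

(** Almost every t is a point where the primitive of [f] has derivative [f t], and the backward
    average is its difference quotient with increment [- h n]. *)
Lemma cvg_backward_average (f : R -> R) (h : R^nat) :
  mu.-integrable setT (EFin \o f) -> (forall n, 0 < h n) -> h @ \oo --> (0 : R) ->
  {ae mu, forall t, (h n)^-1 * \int[mu]_(r in `[t - h n, t]) f r @[n --> \oo] --> f t}.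
Proof.
move=> fi h0 hc.
have := @FTC1Ny R f; case.
- by move=> y; apply: integrableS fi.
- have := integrable_locally measurableT fi.
  by rewrite patch_setT.
move=> N [mN N0 sub]; exists N; split => // t /= Ht; apply: sub => /= -[dF EF].
apply: Ht; set F := (fun x : R => _) in dF EF.
rewrite derive1E in EF.
have cF : k^-1 *: (F (k *: 1 + t) - F t) @[k --> 0^'] --> f t.
  by rewrite -EF; exact: dF.
have hN : (forall n, - h n != 0) /\ (- h n @[n --> \oo] --> 0).
  split; last by rewrite -oppr0; exact: cvgN.
  by move=> n; rewrite oppr_eq0 gt_eqF.
have := (cvgr_dnbhsP _ _ _).1 cF (fun n => - h n) hN.
suff -> : (fun n => (h n)^-1 * \int[mu]_(r in `[t - h n, t]) f r) =
  (fun n => (- h n)^-1 *: (F (- h n *: 1 + t) - F t)) by [].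
apply/funext => n; rewrite /GRing.scale/= mulr1 invrN mulNr -mulrN opprB; congr (_ * _).
rewrite /F (@Rintegral_itvB _ _ -oo%O (BRight t) (- h n + t))//.
- rewrite Rintegral_itv_obnd_cbnd; first by rewrite [- _ + t]addrC.
  by apply: integrableS fi.
- by apply: integrableS fi.
- by rewrite bnd_simp gerDr oppr_le0 ltW.
Qed.

End Plane.

Section BackwardAverage.
Context {R : realType}.
Local Notation mu := (@lebesgue_measure R).
Implicit Types (x t a c : R) (f P Q W Psi D : R * R -> R).

(** The backward Steklov average in time. *)
Definition bavg (h : R) f (z : R * R) : R :=
  h^-1 * \int[mu]_(r in `[z.2 - h, z.2]) f (z.1, r).

Lemma measurable_bavg h f : measurable_fun setT f -> measurable_fun setT (bavg h f).
Proof.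
move=> mf; apply: measurable_funM => //.
pose g (w : R * R * R) := if (w.1.2 - h <= w.2) && (w.2 <= w.1.2) then f (w.1.1, w.2) else 0.
have mg : measurable_fun setT g.
  apply: measurable_fun_ifT => //.
    apply: measurable_and; apply: measurable_fun_ler => //.
    - by apply: measurable_funB => //; apply: measurableT_comp => //.
    - by apply: measurableT_comp => //.
  apply: (measurableT_comp mf); apply: measurable_fun_pair => //.
  by apply: measurableT_comp => //.
rewrite (_ : (fun z : R * R => _) = (fun z => \int[mu]_r g (z, r))).
  exact: measurable_Rintegral_param.
apply/funext => z; rewrite Rintegral_mkcond; apply: eq_Rintegral => r _.
rewrite patchE /g /=; case: ifPn => [|/negP H].
  by rewrite inE/= in_itv/= => ->.
by case: ifP => // K; exfalso; apply: H; rewrite inE/= in_itv.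
Qed.

(** Tonelli's theorem: each r belongs to [[t - h, t]] for a set of times t of length h, so that
    averaging preserves the mass. *)
Lemma integral_bavg1 (h : R) (d : R -> R) : 0 < h -> measurable_fun setT d ->
  (forall r, 0 <= d r) ->
  (\int[mu]_t ((h^-1)%R%:E * \int[mu]_(r in `[(t - h)%R, t]) (d r)%:E) = \int[mu]_r (d r)%:E)%E.
Proof.
move=> h0 md d0.
have hV0 : 0 <= h^-1 by rewrite invr_ge0 ltW.
pose g (w : R * R) : \bar R :=
  ((h^-1) * (if (w.1 - h <= w.2) && (w.2 <= w.1) then d w.2 else 0))%:E.
have g0 w : (0 <= g w)%E.
  by rewrite lee_fin mulr_ge0//; case: ifP.
have mg : measurable_fun setT g.
  apply/measurable_EFinP; apply: measurable_funM => //.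
  apply: measurable_fun_ifT => //.
    apply: measurable_and; apply: measurable_fun_ler => //.
    by apply: measurable_funB => //.
  by apply: (measurableT_comp md).
have E1 t : (\int[mu]_r g (t, r) = (h^-1)%:E * \int[mu]_(r in `[(t - h)%R, t]) (d r)%:E)%E.
  rewrite /g /=.
  transitivity (\int[mu]_x ((h^-1)%R%:E * ((fun r => (d r)%:E) \_ `[(t - h)%R, t]) x))%E.
    apply: eq_integral => x _; rewrite patchE EFinM; congr (_ * _)%E.
    case: ifPn => [H|/negP H]; first by rewrite mem_set//= in_itv.
    by rewrite memNset//= in_itv.
  rewrite ge0_integralZl//.
  - by rewrite -integral_mkcond.
  - apply/(measurable_restrictT _ _).1 => //; apply/measurable_EFinP.
    exact: measurable_funS md.
  - by move=> x _; rewrite erestrict_ge0// => y _; rewrite lee_fin.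
have E2 r : (\int[mu]_t g (t, r) = (d r)%:E)%E.
  rewrite /g /=.
  transitivity (\int[mu]_x (((h^-1 * d r)%R%:E * (\1_(`[r, (r + h)%R]%classic) x)%:E)))%E.
    apply: eq_integral => x _; rewrite indicE -EFinM; congr (_%:E).
    rewrite -mulrA; congr (_ * _).
    case: ifPn => [/andP[h1 h2]|H].
      by rewrite mem_set ?mulr1//= in_itv/= h2/= -lerBlDr.
    rewrite memNset ?mulr0//= in_itv/= => /andP[h1 h2]; move/negP: H; apply.
    by rewrite h1 lerBlDr h2.
  rewrite ge0_integralZl//; last 2 first.
  - by apply/measurable_EFinP; exact: measurable_indic.
  - by rewrite lee_fin mulr_ge0.
  rewrite integral_indic// setIT/= lebesgue_measure_itv/= lte_fin ltrDl h0 -EFinD -EFinM.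
  by rewrite addrAC subrr add0r mulrAC mulVf ?gt_eqF// mul1r.
under eq_integral do rewrite -E1.
apply: (etrans (fubini_tonelli (m1 := mu) (m2 := mu) g mg g0)); apply: eq_integral => r _; exact: E2.
Qed.

End BackwardAverage.

Section AveragingLimit.
Context {R : realType}.
Local Notation mu := (@lebesgue_measure R).
Local Notation mu2 := (mu \x mu)%E.
Implicit Types (x t a c : R) (f P Q W Psi D : R * R -> R).

(** Integrability of the time sections for every [x] ensures that the real-valued average is the
    true one, and not the value 0 that [fine] gives to an infinite integral. *)
Lemma integral2_bavg h D : 0 < h -> measurable_fun setT D -> (forall z, 0 <= D z) ->
  (forall x, mu.-integrable setT (fun t => (D (x, t))%:E)) ->
  (\int[mu2]_z (bavg h D z)%:E = \int[mu2]_z (D z)%:E)%E.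
Proof.
move=> h0 mD D0 iD.
have hV0 : 0 <= h^-1 by rewrite invr_ge0 ltW.
rewrite (fubini_tonelli1 (m1 := mu) (m2 := mu) (fun z => (bavg h D z)%:E)); last 2 first.
- by apply/measurable_EFinP; exact: measurable_bavg.
- by move=> z; rewrite lee_fin mulr_ge0// Rintegral_ge0.
rewrite (fubini_tonelli1 (m1 := mu) (m2 := mu) (fun z => (D z)%:E)); last 2 first.
- exact/measurable_EFinP.
- by move=> z; rewrite lee_fin.
apply: eq_integral => x _; rewrite /fubini_F /=.
rewrite -(@integral_bavg1 R h (fun t => D (x, t)))//; last first.
  by apply: (measurableT_comp mD).
apply: eq_integral => t _; rewrite /bavg /= EFinM; congr (_ * _)%E.
by rewrite -EFin_Rintegral//; apply: integrableS (iD x).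
Qed.

Lemma integrable_bavg h D : 0 < h -> measurable_fun setT D -> (forall z, 0 <= D z) ->
  mu2.-integrable setT (EFin \o D) ->
  (forall x, mu.-integrable setT (fun t => (D (x, t))%:E)) ->
  mu2.-integrable setT (EFin \o bavg h D).
Proof.
move=> h0 mD D0 iD iDx; apply/integrableP; split.
  by apply/measurable_EFinP; exact: measurable_bavg.
have bD0 z : 0 <= bavg h D z.
  by apply: mulr_ge0; [rewrite invr_ge0 ltW|exact: Rintegral_ge0].
under eq_integral do rewrite gee0_abs ?lee_fin//.
rewrite integral2_bavg//.
move/integrableP : iD => [_]; under eq_integral do rewrite gee0_abs ?lee_fin//.
by [].
Qed.

Lemma bavg_dominated h P Q W Psi D x t : 0 < h ->
  (forall y, mu.-integrable setT (fun t => (D (y, t))%:E)) ->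
  measurable_fun setT P -> measurable_fun setT Q ->
  (forall z, `|P z| <= D z) -> (forall z, `|Q z| <= D z) ->
  (forall r, `|P (x, r) * W (x, t) + Q (x, r) * Psi (x, t)| <= D (x, r) + D (x, t)) ->
  `|bavg h P (x, t) * W (x, t) + bavg h Q (x, t) * Psi (x, t)| <= bavg h D (x, t) + D (x, t).
Proof.
move=> h0 iD mP mQ PD QD H; rewrite /bavg /=.
have hV0 : 0 <= h^-1 by rewrite invr_ge0 ltW.
have iDh : mu.-integrable `[t - h, t] (EFin \o (fun r => D (x, r))).
  by apply: integrableS (iD x).
have mPx : measurable_fun `[t - h, t] (fun r => P (x, r)).
  by apply: (@measurable_funS _ _ _ _ setT) => //; apply: (measurableT_comp mP).
have mQx : measurable_fun `[t - h, t] (fun r => Q (x, r)).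
  by apply: (@measurable_funS _ _ _ _ setT) => //; apply: (measurableT_comp mQ).
have iP : mu.-integrable `[t - h, t] (EFin \o (fun r => P (x, r))).
  by apply: le_integrable_real iDh => // r _.
have iQ : mu.-integrable `[t - h, t] (EFin \o (fun r => Q (x, r))).
  by apply: le_integrable_real iDh => // r _.
have iW : mu.-integrable `[t - h, t] (EFin \o (fun r => W (x, t) * P (x, r))) by exact: integrable_mulrl.
have iPsi : mu.-integrable `[t - h, t] (EFin \o (fun r => Psi (x, t) * Q (x, r))) by exact: integrable_mulrl.
have fh : fine (mu `[t - h, t]%classic) = h.
  by rewrite /= lebesgue_measure_itv/= lte_fin ltrBlDr ltrDl h0/= opprB addrC subrK.
have E : h^-1 * \int[mu]_(r in `[t - h, t]) P (x, r) * W (x, t) +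
   h^-1 * \int[mu]_(r in `[t - h, t]) Q (x, r) * Psi (x, t) =
   h^-1 * \int[mu]_(r in `[t - h, t]) (W (x, t) * P (x, r) + Psi (x, t) * Q (x, r)).
  rewrite RintegralD// !RintegralZl//; ring.
have ic : mu.-integrable `[t - h, t] (EFin \o cst (D (x, t))).
  by apply: continuous_itv_integrable; apply: continuous_withinT => y; exact: cvg_cst.
have E2 : h^-1 * \int[mu]_(r in `[t - h, t]) D (x, r) + D (x, t) =
   h^-1 * \int[mu]_(r in `[t - h, t]) (D (x, r) + cst (D (x, t)) r).
  rewrite RintegralD// mulrDr; congr (_ + _).
  by rewrite Rintegral_cst// fh mulrCA mulVf ?mulr1// gt_eqF.
rewrite E E2 normrM (ger0_norm hV0); apply: ler_wpM2l => //.
have iS : mu.-integrable `[t - h, t] (EFin \o (fun r => W (x, t) * P (x, r) + Psi (x, t) * Q (x, r))).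
  exact: integrable_addr.
apply: (le_trans (le_normr_Rintegral _ iS)) => //.
apply: le_Rintegral => //; [exact: integrable_normr|exact: integrable_addr|].
by move=> r _; rewrite [W _ * _]mulrC [Psi _ * _]mulrC; exact: H.
Qed.

(* [P * W] and [Q * Psi] are only dominated through pairs of times, as [D (x, r) + D (x, t)]; this
   is what survives the passage from averages to the limit. *)
Lemma averaging_limit P Q W Psi D t0 t1 (B : R) (h Bn : R^nat) : t0 < t1 ->
  measurable_fun setT P -> measurable_fun setT Q -> measurable_fun setT W ->
  measurable_fun setT Psi -> measurable_fun setT D ->
  (forall z, 0 <= D z) -> mu2.-integrable setT (EFin \o D) ->
  (forall x, mu.-integrable setT (fun t => (D (x, t))%:E)) ->
  (forall z, `|P z| <= D z) -> (forall z, `|Q z| <= D z) ->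
  (forall x r t, `|P (x, r) * W (x, t) + Q (x, r) * Psi (x, t)| <= D (x, r) + D (x, t)) ->
  (forall x t, ~ (t0 <= t <= t1) -> W (x, t) = 0 /\ Psi (x, t) = 0) ->
  (forall n, 0 < h n) -> h @ \oo --> (0 : R) -> Bn @ \oo --> B ->
  (forall n, \int[mu2]_z (if (t0 + h n <= z.2) && (z.2 <= t1) then
      bavg (h n) P z * W z + bavg (h n) Q z * Psi z else 0) <= Bn n) ->
  \int[mu2]_z (P z * W z + Q z * Psi z) <= B.
Proof.
move=> t01 mP mQ mW mPsi mD D0 iD iDx PD QD dom WP0 h0 hc Bc HB.
pose Y n z := if (t0 + h n <= z.2) && (z.2 <= t1) then
      bavg (h n) P z * W z + bavg (h n) Q z * Psi z else 0.
(* Adding the bound makes the functions nonnegative, as Fatou's lemma requires. Averaging preserves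
   the integral of [D], so the added mass is the same for all n and for the limit, and cancels at
   the end. *)
pose N n z := bavg (h n) D z + D z + Y n z.
pose Z z := P z * W z + Q z * Psi z.
have mB n f : measurable_fun setT f -> measurable_fun setT (bavg (h n) f) by exact: measurable_bavg.
have mY n : measurable_fun setT (Y n).
  apply: measurable_fun_ifT => //.
    by apply: measurable_and; apply: measurable_fun_ler.
  by apply: measurable_funD; apply: measurable_funM => //; exact: mB.
have mN n : measurable_fun setT (N n).
  by apply: measurable_funD => //; apply: measurable_funD => //; exact: mB.
have mZ : measurable_fun setT Z.
  by apply: measurable_funD; apply: measurable_funM.
have bD0 n z : 0 <= bavg (h n) D z.
  by apply: mulr_ge0; [rewrite invr_ge0 ltW|exact: Rintegral_ge0].
have YN n z : `|Y n z| <= bavg (h n) D z + D z.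
  rewrite /Y; case: ifP => _; last by rewrite normr0 addr_ge0.
  by case: z => x t; apply: bavg_dominated.
have N0 n z : 0 <= N n z.
  by have := YN n z; rewrite ler_norml /N => /andP[]; order_lra.
have ZD z : `|Z z| <= D z + D z by case: z => x t; exact: dom.
have iZ : mu2.-integrable setT (EFin \o Z).
  by apply: le_integrable_real (integrable_addr measurableT iD iD).
have ibD n : mu2.-integrable setT (EFin \o bavg (h n) D) by exact: integrable_bavg.
have iY n : mu2.-integrable setT (EFin \o Y n).
  by apply: le_integrable_real (integrable_addr measurableT (ibD n) iD) => //; exact: mY.
pose ID := \int[mu2]_z D z.
have iN n : mu2.-integrable setT (EFin \o N n).
  by apply: integrable_addr => //; apply: integrable_addr.
have IN n : (\int[mu2]_z (N n z)%:E <= (ID + ID + Bn n)%:E)%E.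
  rewrite EFin_Rintegral// lee_fin RintegralD//; last exact: integrable_addr.
  rewrite RintegralD//; apply: lerD; last exact: HB.
  by rewrite /ID /Rintegral integral2_bavg.
pose L z := limn_einf (fun n => (N n z)%:E).
have mL : measurable_fun setT L.
  apply: (emeasurable_fun_cvg (fun n z => einfs (fun n => (N n z)%:E) n)).
    by move=> m; apply: measurable_fun_einfs => n; exact/measurable_EFinP.
  by move=> z _; rewrite /L limn_einf_lim; exact: is_cvg_einfs.
pose TT z := D z + D z + Z z.
have TT0 z : 0 <= TT z by have := ZD z; rewrite ler_norml /TT => /andP[]; order_lra.
have mTT : measurable_fun setT TT by apply: measurable_funD => //; apply: measurable_funD.
have L0 z : (0 <= L z)%E.
  rewrite /L limn_einf_lim; apply: lime_ge; first exact: is_cvg_einfs.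
  by apply: nearW => n; apply: le_ereal_inf_tmp => _ [m _ <-]; rewrite lee_fin.
have LT x : {ae mu, forall t, L (x, t) = (TT (x, t))%:E}.
  have iPx : mu.-integrable setT (EFin \o (fun t => P (x, t))).
    apply: le_integrable_real (iDx x) => //.
    by apply: (measurableT_comp mP).
  have iQx : mu.-integrable setT (EFin \o (fun t => Q (x, t))).
    apply: le_integrable_real (iDx x) => //.
    by apply: (measurableT_comp mQ).
  have c1 := cvg_backward_average iPx h0 hc.
  have c2 := cvg_backward_average iQx h0 hc.
  have c3 := cvg_backward_average (iDx x) h0 hc.
  (* The cutoff [t0 + h n <= t] holds for large n as soon as t0 < t, hence only the time [t0] itself
     has to be discarded. *)
  have c4 := ae_neq t0.
  have FF := ae_filter_ringOfSetsType mu.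
  near=> t.
  have e1 : bavg (h n) P (x, t) @[n --> \oo] --> P (x, t) by near: t; exact: c1.
  have e2 : bavg (h n) Q (x, t) @[n --> \oo] --> Q (x, t) by near: t; exact: c2.
  have e3 : bavg (h n) D (x, t) @[n --> \oo] --> D (x, t) by near: t; exact: c3.
  have e4 : t <> t0 by near: t; exact: c4.
  have eY : Y n (x, t) @[n --> \oo] --> Z (x, t).
    have [tt|tt] := pselect (t0 <= t <= t1); last first.
      have [W0 Psi0] := WP0 x t tt.
      rewrite /Z W0 Psi0 !mulr0 addr0.
      rewrite (_ : (fun n => _) = cst 0); first exact: cvg_cst.
      by apply/funext => n; rewrite /Y W0 Psi0 !mulr0 addr0; case: ifP.
    have /andP[tt0 tt1] := tt.
    have t0t : 0 < t - t0.
      by rewrite subr_gt0 lt_neqAle tt0 andbT; apply/eqP => /esym.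
    have : bavg (h n) P (x, t) * W (x, t) + bavg (h n) Q (x, t) * Psi (x, t) @[n --> \oo] --> Z (x, t).
      by apply: cvgD; apply: cvgMl.
    apply: cvg_trans; apply: near_eq_cvg.
    have /cvgrPdist_le/(_ _ t0t) := hc.
    apply: filterS => n; rewrite sub0r normrN gtr0_norm// => hn.
    by rewrite /Y /= tt1 andbT ifT//; order_lra.
  have cN : (N n (x, t))%:E @[n --> \oo] --> (TT (x, t))%:E.
    apply: cvg_EFin; first exact: nearW.
    by apply: cvgD => //; apply: cvgD => //; exact: cvg_cst.
  by rewrite /L is_cvg_limn_einfE; [exact/cvg_lim|apply/cvg_ex; eexists; exact: cN].
have mTT' : measurable_fun setT (EFin \o TT) by exact/measurable_EFinP.
have TT0' z : (0 <= (EFin \o TT) z)%E by rewrite lee_fin.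
have IL : (\int[mu2]_z L z = \int[mu2]_z (TT z)%:E)%E.
  rewrite (fubini_tonelli1 (m1 := mu) (m2 := mu) L)//.
  rewrite (fubini_tonelli1 (m1 := mu) (m2 := mu) (EFin \o TT) mTT' TT0').
  apply: eq_integral => x _; rewrite /fubini_F.
  apply: ge0_ae_eq_integral => //.
  - by apply: (measurableT_comp mL).
  - by apply/measurable_EFinP; apply: (measurableT_comp mTT).
  - have [N1 [mN1 N10 sN]] := LT x; exists N1; split => // t /= H.
    by apply: sN => /= K; apply: H.
have iTT : mu2.-integrable setT (EFin \o TT).
  by apply: integrable_addr => //; exact: integrable_addr.
have : (\int[mu2]_z (TT z)%:E <= (ID + ID + B)%:E)%E.
  rewrite -IL.
  apply: (le_trans (@fatou _ _ _ mu2 setT measurableT (fun n z => (N n z)%:E) _ _)).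
  - by move=> n; apply/measurable_EFinP; exact: mN.
  - by move=> n z _; rewrite lee_fin.
  have cB : (ID + ID + Bn n)%:E @[n --> \oo] --> (ID + ID + B)%:E.
    by apply: cvg_EFin; [exact: nearW|apply: cvgD => //; exact: cvg_cst].
  rewrite limn_einf_lim -(cvg_lim _ cB)//; apply: lee_lim.
  - exact: is_cvg_einfs.
  - by apply/cvg_ex; eexists; exact: cB.
  - apply: nearW => n; apply: le_trans (IN n).
    by apply: ereal_inf_lbound; exists n => /=.
rewrite EFin_Rintegral// lee_fin RintegralD//; last exact: integrable_addr.
rewrite RintegralD// -/ID => H; rewrite -/(Z _) in H *.
have -> : \int[mu2]_z (P z * W z + Q z * Psi z) = \int[mu2]_z Z z by [].
order_lra.
Unshelve. all: by end_near. Qed.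

End AveragingLimit.

(** * Continuous functions on rectangles *)

Section BoxContinuous.
Context {R : realType}.
Local Notation mu := (@lebesgue_measure R).
Implicit Types (a c b d x t : R) (F : R * R -> R).

Lemma continuous_sect1 F x : continuous F -> continuous (fun t => F (x, t)).
Proof.
move=> cF t.
have cp : (x, s) @[s --> t] --> (x, t).
  by apply: (@cvg_pair _ _ _ (nbhs t) (nbhs x) (nbhs t)); [exact: cvg_cst|exact: cvg_id].
exact: (cvg_comp _ _ cp (cF (x, t))).
Qed.

Lemma continuous_sect2 F t : continuous F -> continuous (fun x => F (x, t)).
Proof.
move=> cF x.
have cp : (s, t) @[s --> x] --> (x, t).
  by apply: (@cvg_pair _ _ _ (nbhs x) (nbhs x) (nbhs t)); [exact: cvg_id|exact: cvg_cst].
exact: (cvg_comp _ _ cp (cF (x, t))).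
Qed.

Lemma box_bounded F a c b d : continuous F -> exists2 M, 0 <= M &
  forall x t, a <= x <= c -> b <= t <= d -> `|F (x, t)| <= M.
Proof.
move=> cF.
have cK : compact (`[a, c]%classic `*` `[b, d]%classic : set (R * R)).
  by apply: compact_setX; exact: segment_compact.
have cF' : {within (`[a, c]%classic `*` `[b, d]%classic : set (R * R)), continuous F}.
  exact: continuous_subspaceT.
have /compact_bounded[M [_ mrt]] := continuous_compact cF' cK.
exists (`|M| + 1); first by rewrite addr_ge0.
move=> x t xac tbd; apply: (mrt (`|M| + 1)).
  by rewrite (le_lt_trans (ler_norm _))// ltrDl.
by exists (x, t) => //; split; rewrite /= in_itv.
Qed.

Lemma continuous_int_param F a c : continuous F ->
  continuous (fun t => \int[mu]_(x in `[a, c]) F (x, t)).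
Proof.
move=> cF t.
have [M M0 HM] := box_bounded a c (t - 1) (t + 1) cF.
have tI : t \in `]t - 1, t + 1[%classic by rewrite inE/= in_itv/=; apply/andP; split; lra.
apply: (@continuity_under_integral _ _ _ mu (fun t x => F (x, t)) `[a, c]%classic _
  (t - 1) (t + 1) _ _ (cst M)) => //.
- move=> s _; apply: continuous_itv_integrable; apply: continuous_withinT.
  exact: continuous_sect2.
- by apply: aeW => x _ s _; exact: continuous_sect1.
- by apply: continuous_itv_integrable; apply: continuous_withinT => y; exact: cvg_cst.
- move=> s; rewrite /= in_itv/= => /andP[s1 s2]; apply: aeW => x; rewrite /= in_itv/= => xac.
  by apply: HM => //; rewrite !ltW.
Qed.

(** The tangent inequality at [A] for the convex function s_+^3 / 3, whose derivative is s_+^2. *)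
Lemma cube_convex (A B : R) : (Num.max 0 A ^+ 3 - Num.max 0 B ^+ 3) / 3 <= (A - B) * Num.max 0 A ^+ 2.
Proof.
rewrite ler_pdivrMr//.
case: (leP 0 A) => hA; case: (leP 0 B) => hB; rewrite ?(max_l, max_r)//; try nra.
have -> : A ^+ 3 - B ^+ 3 = (A - B) * (A ^+ 2 + A * B + B ^+ 2) by ring.
have : 0 <= (A - B) ^+ 2 * (2 * A + B) by rewrite mulr_ge0 ?sqr_ge0//; lra.
by have -> : (A - B) ^+ 2 * (2 * A + B) = (A - B) * A ^+ 2 * 3 - (A - B) * (A ^+ 2 + A * B + B ^+ 2); [ring|lra].
Qed.

End BoxContinuous.

(** * The energy inequality *)

Section SliceInequality.
Context {R : realType}.
Local Notation mu := (@lebesgue_measure R).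
Local Notation mu2 := (mu \x mu)%E.
Local Notation pos w := (Num.max 0 w).
Implicit Types (a c x t : R).

Lemma slice_aux (A d Q X : R) : A + (d + Q) = 0 -> X <= d -> A + Q <= - X.
Proof. lra. Qed.

(* The time slice at t tested with the square of the positive part of [z1 = z(., t)]; convexity of
   the cube bounds the increment of the energy. *)
Lemma slice_inequality a c (g q z0 z1 zx : R -> R) : a < c ->
  mu.-integrable `[a, c] (EFin \o g) -> mu.-integrable `[a, c] (EFin \o q) ->
  continuous z0 -> continuous z1 ->
  mu.-integrable `[a, c] (EFin \o zx) ->
  (forall x, a <= x <= c -> z1 x = z1 a + \int[mu]_(y in `[a, x]) zx y) ->
  z1 a <= 0 -> z1 c <= 0 ->
  mu.-integrable `[a, c] (EFin \o (fun x => g x * (2 * pos (z1 x) * zx x))) ->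
  (forall zeta zeta1 zeta2 : R -> R, continuous zeta2 ->
    (forall x, a <= x <= c -> is_derive x 1 zeta (zeta1 x) /\ is_derive x 1 zeta1 (zeta2 x)) ->
    zeta a = 0 -> zeta c = 0 ->
    \int[mu]_(x in `[a, c]) ((z1 x - z0 x) * zeta x) +
    (\int[mu]_(x in `[a, c]) (g x * zeta1 x) + \int[mu]_(x in `[a, c]) (q x * zeta x)) = 0) ->
  \int[mu]_(x in `[a, c]) (g x * (2 * pos (z1 x) * zx x)) +
  \int[mu]_(x in `[a, c]) (q x * pos (z1 x) ^+ 2) <=
  - (\int[mu]_(x in `[a, c]) (pos (z1 x) ^+ 3 / 3) - \int[mu]_(x in `[a, c]) (pos (z0 x) ^+ 3 / 3)).
Proof.
move=> ac ig iq cz0 cz1 izx zE za zc igm Hz.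
(* The increment in time and the lower order term together are the function [h] of
   [du_bois_reymond]. *)
pose h x := (z1 x - z0 x) + q x.
have ci f : continuous f -> mu.-integrable `[a, c] (EFin \o f).
  by move=> cf; apply: continuous_itv_integrable; exact: continuous_withinT.
have cd : continuous (fun x => z1 x - z0 x).
  by move=> x; apply: cvgB; [exact: cz1|exact: cz0].
have ih : mu.-integrable `[a, c] (EFin \o h) by apply: integrable_addr => //; exact: ci.
have cp1 : continuous (fun x => pos (z1 x)).
  by move=> x; apply: (@continuous_comp _ _ _ z1 (fun w => pos w)); [exact: cz1|exact: continuous_pos].
have cp0 : continuous (fun x => pos (z0 x)).
  by move=> x; apply: (@continuous_comp _ _ _ z0 (fun w => pos w)); [exact: cz0|exact: continuous_pos].
have c2p : continuous (fun x => 2 * pos (z1 x)).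
  by move=> x; apply: cvgM; [exact: cvg_cst|exact: cp1].
have cp2 : continuous (fun x => pos (z1 x) ^+ 2).
  by move=> x; apply: (@cvgM _ _ _ _ (fun x => pos (z1 x)) (fun x => pos (z1 x))); exact: cp1.
(* The derivative of the squared positive part, by [chain_sqpos]. That square vanishes at both ends
   because [z1] is nonpositive there, so [m] has mean 0. *)
pose m x := 2 * pos (z1 x) * zx x.
have im : mu.-integrable `[a, c] (EFin \o m).
  by apply: integrable_continuousM => //; exact: continuous_withinT.
have mE x : a <= x <= c -> \int[mu]_(t in `[a, x]) m t = pos (z1 x) ^+ 2.
  move=> /andP[ax xc]; rewrite (zE x) ?ax// (@chain_sqpos _ a c)//.
  rewrite [pos (z1 a)]max_l// expr0n/= add0r; apply: eq_Rintegral => y.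
  by rewrite inE/= in_itv/= => /andP[ay yx]; rewrite -zE// ay (le_trans yx).
have m0 : \int[mu]_(t in `[a, c]) m t = 0.
  by rewrite mE ?lexx ?andbT ?ltW// [pos (z1 c)]max_l// expr0n.
have iqM zeta : continuous zeta -> mu.-integrable `[a, c] (EFin \o (fun x => q x * zeta x)).
  move=> czeta; have := integrable_continuousM (@continuous_withinT _ `[a, c] _ czeta) iq.
  by under [X in _ -> mu.-integrable _ (_ \o X)]eq_fun do rewrite mulrC.
have idM zeta : continuous zeta -> mu.-integrable `[a, c] (EFin \o (fun x => (z1 x - z0 x) * zeta x)).
  by move=> czeta; apply: ci => x; apply: cvgM; [exact: cd|exact: czeta].
have hE zeta : continuous zeta -> \int[mu]_(x in `[a, c]) (h x * zeta x) =
  \int[mu]_(x in `[a, c]) ((z1 x - z0 x) * zeta x) + \int[mu]_(x in `[a, c]) (q x * zeta x).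
  move=> czeta; rewrite -RintegralD//; [|exact: idM|exact: iqM].
  by apply: eq_Rintegral => x _; rewrite /h mulrDl.
have DB := du_bois_reymond ac ig ih _ im m0 igm.
have : \int[mu]_(x in `[a, c]) (g x * m x) + \int[mu]_(x in `[a, c]) (h x * pos (z1 x) ^+ 2) = 0.
  rewrite -[RHS]DB.
    congr (_ + _); apply: eq_Rintegral => x; rewrite inE/= in_itv/= => xac.
    by rewrite mE.
  move=> zeta zeta1 zeta2 cz2 dz ze0 ze1.
  pose zt := zeta \o clamp a c.
  have czeta : {within `[a, c], continuous zeta}.
    by apply: derivable_within_continuous => x; rewrite in_itv/= => /dz[[]].
  have czt : continuous zt by apply: clamp_continuous => //; exact: ltW.
  have -> : \int[mu]_(x in `[a, c]) (h x * zeta x) = \int[mu]_(x in `[a, c]) (h x * zt x).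
    apply: eq_Rintegral => x; rewrite inE/= in_itv/= => /andP[ax xc].
    by rewrite /zt/= clamp_id.
  rewrite hE//; rewrite -[RHS](Hz zeta zeta1 zeta2)//.
  have -> : \int[mu]_(x in `[a, c]) ((z1 x - z0 x) * zt x) = \int[mu]_(x in `[a, c]) ((z1 x - z0 x) * zeta x).
    apply: eq_Rintegral => x; rewrite inE/= in_itv/= => /andP[ax xc].
    by rewrite /zt/= clamp_id.
  have -> : \int[mu]_(x in `[a, c]) (q x * zt x) = \int[mu]_(x in `[a, c]) (q x * zeta x).
    apply: eq_Rintegral => x; rewrite inE/= in_itv/= => /andP[ax xc].
    by rewrite /zt/= clamp_id.
  by rewrite addrCA.
rewrite hE// -/m => E.
have c3 (f : R -> R) : continuous f -> continuous (fun x => f x ^+ 3 / 3).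
  move=> cf x; apply: cvgM; last exact: cvg_cst.
  rewrite (_ : (fun x => f x ^+ 3) = (fun x => f x * (f x * f x))).
    by rewrite exprS expr2; apply: cvgM; [exact: cf|apply: cvgM; exact: cf].
  by apply/funext => y; rewrite exprS expr2.
have K : \int[mu]_(x in `[a, c]) (pos (z1 x) ^+ 3 / 3) - \int[mu]_(x in `[a, c]) (pos (z0 x) ^+ 3 / 3)
  <= \int[mu]_(x in `[a, c]) ((z1 x - z0 x) * pos (z1 x) ^+ 2).
  rewrite -RintegralB//; [|exact/ci/c3|exact/ci/c3].
  apply: le_Rintegral => //; [by apply: integrable_subr => //; exact/ci/c3|exact: idM|].
  by move=> x _; rewrite -mulrBl; exact: cube_convex.
exact: slice_aux E K.
Qed.

End SliceInequality.

Section EnergyTools.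
Context {R : realType}.
Local Notation mu := (@lebesgue_measure R).
Local Notation mu2 := (mu \x mu)%E.
Implicit Types (a c x t : R) (f : R * R -> R).

Lemma ae_integrable_section f : mu2.-integrable setT (EFin \o f) ->
  {ae mu, forall t, mu.-integrable setT (EFin \o (fun x => f (x, t)))}.
Proof. exact: ae_integrable2. Qed.

Lemma Rintegral_fubini21 f : mu2.-integrable setT (EFin \o f) ->
  mu.-integrable setT (EFin \o (fun t => \int[mu]_x f (x, t))) /\
  \int[mu2]_z f z = \int[mu]_t \int[mu]_x f (x, t).
Proof.
move=> fi.
have mf : measurable_fun setT f by apply/measurable_EFinP; exact: measurable_int fi.
pose G t := (\int[mu]_x (f (x, t))%:E)%E.
have iG : mu.-integrable setT G.
  have [H1 H2] := (@integrable21ltyP _ _ _ _ R mu mu (EFin \o f) (measurable_int _ fi)).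
  apply/integrableP; split; first exact: (measurable_fubini_G fi).
  apply: le_lt_trans (H1 fi).
  apply: ge0_le_integral => //.
  - by apply: measurableT_comp => //; exact: (measurable_fubini_G fi).
  - apply: (@measurable_fun_fubini_tonelli_G _ _ _ _ _ mu (abse \o (EFin \o f))) => [|z].
      by apply: measurableT_comp => //; exact: measurable_int fi.
    exact: abse_ge0.
  - move=> t _; apply: le_abse_integral => //.
    by apply/measurable_EFinP; apply: (measurableT_comp mf).
have mR : measurable_fun setT (fun t => \int[mu]_x f (x, t)).
  apply: (@measurableT_comp _ _ _ _ _ _ (@fine R) _ G) => //.
  exact: measurable_int iG.
have GE : ae_eq mu setT G (EFin \o (fun t => \int[mu]_x f (x, t))).
  have [N [mN N0 sN]] := ae_integrable_section fi.
  exists N; split => // t /= H; apply: sN => /= K; apply: H => _.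
  by rewrite /G EFin_Rintegral.
have EI : (\int[mu]_t G t = \int[mu]_t (\int[mu]_x f (x, t))%:E)%E.
  apply: ae_eq_integral => //; first exact: measurable_int iG.
  exact/measurable_EFinP.
split.
  apply/integrableP; split; first exact/measurable_EFinP.
  have /integrableP[_] := iG; apply: le_lt_trans.
  rewrite le_eqVlt; apply/orP; left; apply/eqP.
  apply: ae_eq_integral => //.
  - by apply: measurableT_comp => //; exact/measurable_EFinP.
  - by apply: measurableT_comp => //; exact: measurable_int iG.
  - have [N [mN N0 sN]] := GE.
    exists N; split => // t /= H; apply: sN => /= K; apply: H => _.
    by rewrite K.
rewrite [RHS]/Rintegral -EI /Rintegral; congr fine.
exact/esym/(integral21_prod_meas1 fi).
Qed.

(** The minimum of the two functions equals [f] almost everywhere and is below [g] everywhere. *)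
Lemma ae_le_Rintegral (f g : R -> R) : mu.-integrable setT (EFin \o f) ->
  mu.-integrable setT (EFin \o g) -> {ae mu, forall t, f t <= g t} ->
  \int[mu]_t f t <= \int[mu]_t g t.
Proof.
move=> fi gi fg.
have mf : measurable_fun setT f by apply/measurable_EFinP; exact: measurable_int fi.
have mg : measurable_fun setT g by apply/measurable_EFinP; exact: measurable_int gi.
have mm : measurable_fun setT (fun t => Num.min (f t) (g t)) by exact: measurable_minr.
have im : mu.-integrable setT (EFin \o (fun t => Num.min (f t) (g t))).
  apply: le_integrable_real (integrable_addr measurableT (integrable_normr fi) (integrable_normr gi)) => //.
  by move=> t _; rewrite minElt; case: ifP => _; rewrite ?lerDl ?lerDr.
have -> : \int[mu]_t f t = \int[mu]_t Num.min (f t) (g t).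
  congr fine; apply: ae_eq_integral => //; [exact/measurable_EFinP|exact/measurable_EFinP|].
  have [N [mN N0 sN]] := fg.
  exists N; split => // t /= H; apply: sN => /= K; apply: H => _.
  by rewrite min_l.
by apply: le_Rintegral => // t _; rewrite ge_min lexx orbT.
Qed.

Lemma is_derive_cvg_seq (F : R -> R) (x d : R) (u : R^nat) : is_derive x 1 F d ->
  (forall n, u n != 0) -> u @ \oo --> (0 : R) ->
  (u n)^-1 * (F (x + u n) - F x) @[n --> \oo] --> d.
Proof.
move=> [dF <-] u0 uc.
have cF : k^-1 *: (F (k *: 1 + x) - F x) @[k --> 0^'] --> 'D_1 F x by exact: dF.
have hN : (forall n, u n != 0) /\ (u n @[n --> \oo] --> 0) by [].
have := (cvgr_dnbhsP _ _ _).1 cF u hN.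
suff -> : (fun n => (u n)^-1 *: (F (u n *: 1 + x) - F x)) =
   (fun n => (u n)^-1 * (F (x + u n) - F x)) by [].
by apply/funext => n; rewrite /GRing.scale/= mulr1 [_ + x]addrC.
Qed.

Lemma integrable_box_indic a c t0 t1 (M : R) f : measurable_fun setT f ->
  (forall x t, `|f (x, t)| <= M) ->
  (forall x t, ~ (a <= x <= c /\ t0 <= t <= t1) -> f (x, t) = 0) ->
  mu2.-integrable setT (EFin \o f).
Proof.
move=> mf fM f0.
have i1 (p q : R) : mu.-integrable setT (EFin \o \1_(`[p, q]%classic)).
  exact: integrable_indic_itv.
have := integrable_mulrl measurableT M (integrable_prodM (i1 a c) (i1 t0 t1)).
apply: le_integrable_real => // -[x t] _ /=.
have M0 : 0 <= M by apply: le_trans (fM x t).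
have [[h1 h2]|h] := pselect (a <= x <= c /\ t0 <= t <= t1).
  by rewrite !indicE !mem_set ?mulr1//= in_itv.
by rewrite f0// normr0 mulr_ge0// mulr_ge0// indicE.
Qed.

End EnergyTools.

Section EnergyCore.
Context {R : realType}.
Local Notation mu := (@lebesgue_measure R).
Local Notation mu2 := (mu \x mu)%E.
Local Notation pos w := (Num.max 0 w).
(** [z] stands for the signed difference of solution and barrier, [zx] for its gradient, and [P] and
    [Q] for the differences of fluxes and of lower order terms, cut off outside the rectangle.
    Hypothesis [sign] combines the monotonicity of the flux with the differential inequality of the
    barrier. *)
Variables (a c t0 t1 L S : R) (z zx P Q D : R * R -> R).
Hypotheses (ac : a < c) (t01 : t0 < t1) (L0 : 0 <= L).
Hypotheses (cz : continuous z) (mzx : measurable_fun setT zx)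
  (mP : measurable_fun setT P) (mQ : measurable_fun setT Q) (mD : measurable_fun setT D).
Hypotheses (D0 : forall w, 0 <= D w) (iD : mu2.-integrable setT (EFin \o D))
  (iDx : forall x, mu.-integrable setT (fun t => (D (x, t))%:E)).
Hypotheses (PD : forall w, `|P w| <= D w) (QD : forall w, `|Q w| <= D w).
Hypothesis out0 : forall x t, ~ (a <= x <= c /\ t0 <= t <= t1) -> P (x, t) = 0 /\ Q (x, t) = 0.
Hypothesis domP : forall x r t, a <= x <= c -> t0 <= r <= t1 -> t0 <= t <= t1 ->
  `|P (x, r) * (2 * pos (z (x, t)) * zx (x, t))| <= D (x, r) + D (x, t).
Hypothesis domQ : forall x r t, a <= x <= c -> t0 <= r <= t1 -> t0 <= t <= t1 ->
  `|Q (x, r) * pos (z (x, t)) ^+ 2| <= D (x, r) + D (x, t).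
Hypothesis prim : {ae mu, forall t, t0 <= t <= t1 ->
  mu.-integrable `[a, c] (EFin \o (fun x => zx (x, t))) /\
  forall x, a <= x <= c -> z (x, t) = z (a, t) + \int[mu]_(y in `[a, x]) zx (y, t)}.
Hypothesis lateral : forall t, t0 <= t <= t1 -> z (a, t) <= 0 /\ z (c, t) <= 0.
Hypothesis weak : forall r1 r2, t0 <= r1 -> r1 < r2 -> r2 <= t1 ->
  forall zeta zeta1 zeta2 : R -> R, continuous zeta2 ->
    (forall x, a <= x <= c -> is_derive x 1 zeta (zeta1 x) /\ is_derive x 1 zeta1 (zeta2 x)) ->
    zeta a = 0 -> zeta c = 0 ->
    \int[mu]_(x in `[a, c]) ((z (x, r2) - z (x, r1)) * zeta x) +
    (\int[mu]_(x in `[a, c]) ((\int[mu]_(r in `[r1, r2]) P (x, r)) * zeta1 x) +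
     \int[mu]_(x in `[a, c]) ((\int[mu]_(r in `[r1, r2]) Q (x, r)) * zeta x)) = 0.
Hypothesis sign : forall x t, a <= x <= c -> t0 <= t <= t1 -> 0 < z (x, t) ->
  0 <= P (x, t) * zx (x, t) /\ - L * z (x, t) <= Q (x, t).

Definition cube_energy t : R := \int[mu]_(x in `[a, c]) (pos (z (x, t)) ^+ 3 / 3).

Let m := cube_energy.
Let bx (w : R * R) := ((a <= w.1) && (w.1 <= c)) && ((t0 <= w.2) && (w.2 <= t1)).
Let W w := if bx w then 2 * pos (z w) * zx w else 0.
Let Psi w := if bx w then pos (z w) ^+ 2 else 0.

Let cpz : continuous (fun w => pos (z w)).
Proof. by move=> w; apply: (@continuous_comp _ _ _ z (fun v => pos v)); [exact: cz|exact: continuous_pos]. Qed.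

Let cpz2 : continuous (fun w => pos (z w) ^+ 2).
Proof. by move=> w; apply: (@cvgM _ _ _ _ (fun w => pos (z w)) (fun w => pos (z w))); exact: cpz. Qed.

Let cpz3 : continuous (fun w => pos (z w) ^+ 3).
Proof. 
move=> w; rewrite (_ : (fun w => pos (z w) ^+ 3) = (fun w => pos (z w) * pos (z w) ^+ 2)); last first.
  by apply/funext => v; rewrite exprS.
by apply: (@cvgM _ _ _ _ (fun w => pos (z w)) (fun w => pos (z w) ^+ 2)); [exact: cpz|exact: cpz2].
Qed.

Let cm : continuous m.
Proof.
apply: (@continuous_int_param _ (fun w => pos (z w) ^+ 3 / 3)) => w.
by apply: (@cvgM _ _ _ _ (fun w => pos (z w) ^+ 3)); [exact: cpz3|exact: cvg_cst].
Qed.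

Let mbx : measurable_fun setT bx.
Proof.
by apply: measurable_and; apply: measurable_and; apply: measurable_fun_ler => //;
  apply: measurable_cst.
Qed.

Let mW : measurable_fun setT W.
Proof.
apply: measurable_fun_ifT => //; apply: measurable_funM => //.
by apply: measurable_funM => //; exact: continuous_measurable_fun2.
Qed.

Let mPsi : measurable_fun setT Psi.
Proof. by apply: measurable_fun_ifT => //; exact: continuous_measurable_fun2. Qed.

(** [slice_inequality] on the slab [[t - h, t]], divided by h. The integrability of the sections at
    time t, which holds for almost every t, makes the averaged flux times the gradient at t
    integrable. *)
Lemma energy_slice h t : 0 < h -> t0 + h <= t -> t <= t1 ->
  mu.-integrable `[a, c] (EFin \o (fun x => zx (x, t))) ->
  (forall x, a <= x <= c -> z (x, t) = z (a, t) + \int[mu]_(y in `[a, x]) zx (y, t)) ->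
  mu.-integrable setT (EFin \o (fun x => bavg h D (x, t))) ->
  mu.-integrable setT (EFin \o (fun x => D (x, t))) ->
  \int[mu]_x (bavg h P (x, t) * W (x, t) + bavg h Q (x, t) * Psi (x, t)) <=
  - (h^-1 * (m t - m (t - h))).
Proof.
move=> h0 tt0 tt1 izx zE ibD iDt.
have hV0 : 0 <= h^-1 by rewrite invr_ge0 ltW.
pose g x := \int[mu]_(r in `[t - h, t]) P (x, r).
pose q x := \int[mu]_(r in `[t - h, t]) Q (x, r).
have gE x : g x = h * bavg h P (x, t) by rewrite /bavg/= mulVKf// gt_eqF.
have qE x : q x = h * bavg h Q (x, t) by rewrite /bavg/= mulVKf// gt_eqF.
have bE x : bavg h P (x, t) = h^-1 * g x by [].
have bE' x : bavg h Q (x, t) = h^-1 * q x by [].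
have iS (f : R -> R) : mu.-integrable setT (EFin \o f) -> mu.-integrable `[a, c] (EFin \o f).
  by move=> fi; apply: integrableS fi.
have ib (f : R * R -> R) : measurable_fun setT f -> (forall w, `|f w| <= D w) ->
    mu.-integrable setT (EFin \o (fun x => bavg h f (x, t))).
  move=> mf fD; apply: le_integrable_real (integrable_addr measurableT ibD iDt) => //.
    by apply: (measurableT_comp (measurable_bavg h mf)).
  move=> x _; have := @bavg_dominated R h f (cst 0) (cst 1) (cst 0) D x t h0 iDx mf.
  rewrite /= !mulr0 !addr0 mulr1; apply => //.
    by move=> w; rewrite normr0.
  by move=> r; rewrite mulr1 addr0 (le_trans (fD _))// lerDl.
have ig : mu.-integrable `[a, c] (EFin \o g).
  rewrite (_ : g = fun x => h * bavg h P (x, t)); last exact/funext.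
  by apply: integrable_mulrl => //; apply: iS; exact: ib.
have iq : mu.-integrable `[a, c] (EFin \o q).
  rewrite (_ : q = fun x => h * bavg h Q (x, t)); last exact/funext.
  by apply: integrable_mulrl => //; apply: iS; exact: ib.
have tt : t0 <= t <= t1 by rewrite tt1 andbT; lra.
have iPW : mu.-integrable setT (EFin \o (fun x => bavg h P (x, t) * W (x, t))).
  apply: le_integrable_real (integrable_addr measurableT ibD iDt) => //.
    apply: measurable_funM.
      by apply: (measurableT_comp (measurable_bavg h mP)).
    by apply: (measurableT_comp mW).
  move=> x _; have := @bavg_dominated R h P (cst 0) W (cst 0) D x t h0 iDx mP.
  rewrite /= !mulr0 !addr0; apply => //.
    by move=> w; rewrite normr0.
  move=> r; rewrite addr0 /W /bx/= tt andbT.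
  case: ifPn => xac; last by rewrite mulr0 normr0 addr_ge0.
  have [rr|rr] := pselect (t0 <= r <= t1); first exact: domP.
  have [-> _] : P (x, r) = 0 /\ Q (x, r) = 0 by apply: out0 => -[].
  by rewrite mul0r normr0 addr_ge0.
have WE x : a <= x <= c -> W (x, t) = 2 * pos (z (x, t)) * zx (x, t).
  by move=> xac; rewrite /W /bx/= xac tt.
have PsiE x : a <= x <= c -> Psi (x, t) = pos (z (x, t)) ^+ 2.
  by move=> xac; rewrite /Psi /bx/= xac tt.
have igm : mu.-integrable `[a, c] (EFin \o (fun x => g x * (2 * pos (z (x, t)) * zx (x, t)))).
  have H : mu.-integrable `[a, c] (EFin \o (fun x => h * (bavg h P (x, t) * W (x, t)))).
    by apply: integrable_mulrl => //; exact: iS.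
  apply: eq_integrable H => // x; rewrite inE/= in_itv/= => xac.
  by rewrite WE// gE mulrA.
have [za zc'] := lateral tt.
have ltt : t - h < t by rewrite ltrBlDr ltrDl.
have tth : t0 <= t - h by rewrite lerBrDr.
have SL := @slice_inequality R a c g q (fun x => z (x, t - h)) (fun x => z (x, t)) (fun x => zx (x, t))
  ac ig iq (@continuous_sect2 R z (t - h) cz) (@continuous_sect2 R z t cz) izx zE za zc' igm
  (weak tth ltt tt1).
have -> : \int[mu]_x (bavg h P (x, t) * W (x, t) + bavg h Q (x, t) * Psi (x, t)) =
  \int[mu]_(x in `[a, c]) (h^-1 * (g x * (2 * pos (z (x, t)) * zx (x, t)) + q x * pos (z (x, t)) ^+ 2)).
  rewrite [RHS]Rintegral_mkcond; apply: eq_Rintegral => x _; rewrite patchE.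
  case: ifPn => [|/negP H].
    by rewrite inE/= in_itv/= => xac; rewrite WE// PsiE// bE bE' mulrDr !mulrA.
  have bxF : bx (x, t) = false.
    by apply/negP => /andP[/= xac _]; apply: H; rewrite inE/= in_itv.
  by rewrite /W /Psi bxF !mulr0 addr0.
have iqp : mu.-integrable `[a, c] (EFin \o (fun x => q x * pos (z (x, t)) ^+ 2)).
  have := integrable_continuousM (@continuous_withinT _ `[a, c] _ (@continuous_sect2 R (fun w => pos (z w) ^+ 2) t cpz2)) iq.
  by under [X in _ -> mu.-integrable _ (_ \o X)]eq_fun do rewrite mulrC.
rewrite RintegralZl//; last exact: integrable_addr.
rewrite RintegralD// -mulrN; apply: ler_wpM2l => //.
Qed.

(** The flux product and the reaction product are each bounded by D(x, r) + D(x, t); the doubled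
    function bounds their sum. *)
Let DD w := D w + D w.

Let PDD w : `|P w| <= DD w.
Proof. by rewrite (le_trans (PD w))// lerDl. Qed.

Let QDD w : `|Q w| <= DD w.
Proof. by rewrite (le_trans (QD w))// lerDl. Qed.

Let iDDx x : mu.-integrable setT (fun t => (DD (x, t))%:E).
Proof. exact: (integrable_addr measurableT (iDx x) (iDx x)). Qed.

Let DD0 w : 0 <= DD w.
Proof. by rewrite addr_ge0. Qed.

Let domPQ x r t : `|P (x, r) * W (x, t) + Q (x, r) * Psi (x, t)| <= DD (x, r) + DD (x, t).
Proof.
apply: (le_trans (ler_normD _ _)); rewrite /DD addrACA.
apply: lerD; rewrite /W /Psi /bx /=.
  case: ifPn => [/andP[xx tt]|_]; last by rewrite mulr0 normr0 addr_ge0.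
  have [rr|rr] := pselect (t0 <= r <= t1); first exact: domP.
  have [-> _] : P (x, r) = 0 /\ Q (x, r) = 0 by apply: out0 => -[].
  by rewrite mul0r normr0 addr_ge0.
case: ifPn => [/andP[xx tt]|_]; last by rewrite mulr0 normr0 addr_ge0.
have [rr|rr] := pselect (t0 <= r <= t1); first exact: domQ.
have [_ ->] : P (x, r) = 0 /\ Q (x, r) = 0 by apply: out0 => -[].
by rewrite mul0r normr0 addr_ge0.
Qed.

Let YD h w : 0 < h ->
  `|if (t0 + h <= w.2) && (w.2 <= t1) then bavg h P w * W w + bavg h Q w * Psi w else 0|
   <= bavg h DD w + DD w.
Proof.
move=> h0; have b0 : 0 <= bavg h DD w.
  by apply: mulr_ge0; [rewrite invr_ge0 ltW|exact: Rintegral_ge0].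
case: ifP => _; last by rewrite normr0 addr_ge0.
by case: w b0 => x t _; apply: bavg_dominated.
Qed.

Hypothesis m_le : forall t, t0 <= t <= t1 -> m t <= S.

(** Integrating [energy_slice] over [[t0 + h, t1]] telescopes: the right side becomes minus the
    difference of the mean energies on [[t1 - h, t1]] and [[t0, t0 + h]], which tends to
    [- (m t1 - m t0)]. The limit of the left side is at least - L times the integral of z_+^3, by
    [sign], and that integral is at most 3 S (t1 - t0). *)
Lemma energy_core : m t1 <= m t0 + 3 * L * S * (t1 - t0).
Proof.
have t01' : t0 < t1 by [].
pose h (n : nat) : R := (t1 - t0) / 2 / n.+1%:R.
have h0 n : 0 < h n by rewrite !divr_gt0 ?subr_gt0.
have hle n : h n <= (t1 - t0) / 2.
  by rewrite ler_pdivrMr// ler_peMr ?ler1n// divr_ge0// subr_ge0 ltW.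
have hc : h @ \oo --> (0 : R).
  rewrite -(mulr0 ((t1 - t0) / 2)); apply: cvgM; first exact: cvg_cst.
  exact: cvg_harmonic.
have mDD : measurable_fun setT DD by exact: measurable_funD.
have iDD : mu2.-integrable setT (EFin \o DD) by exact: integrable_addr.
pose Y n w := if (t0 + h n <= w.2) && (w.2 <= t1) then
   bavg (h n) P w * W w + bavg (h n) Q w * Psi w else 0.
have mY n : measurable_fun setT (Y n).
  apply: measurable_fun_ifT => //.
    by apply: measurable_and; apply: measurable_fun_ler.
  by apply: measurable_funD; apply: measurable_funM => //; exact: measurable_bavg.
have ibDD n : mu2.-integrable setT (EFin \o bavg (h n) DD) by exact: integrable_bavg.
have iY n : mu2.-integrable setT (EFin \o Y n).
  apply: le_integrable_real (integrable_addr measurableT (ibDD n) iDD) => //; first exact: mY.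
  by move=> w _; exact: YD.
(* A primitive of the energy that starts strictly before [t0], hence differentiable at [t0]; its
   difference quotients are the mean energies at both ends. *)
pose Mm t := \int[mu]_(s in `[t0 - (t1 - t0) - 1, t]) m s.
have dMm t : t0 - (t1 - t0) - 1 < t -> is_derive t 1 Mm (m t).
  by move=> tt; apply: is_derive_prim.
pose Bn n := - ((h n)^-1 * ((Mm t1 - Mm (t1 - h n)) - (Mm (t0 + h n) - Mm t0))).
have cBn : Bn @ \oo --> - (m t1 - m t0).
  have c1 : (h n)^-1 * (Mm t1 - Mm (t1 - h n)) @[n --> \oo] --> m t1.
    have e1 : t0 - (t1 - t0) - 1 < t1 by lra.
    have hN : (fun n => - h n) @ \oo --> (0 : R) by rewrite -oppr0; exact: cvgN.
    have hN0 n : - h n != 0 by rewrite oppr_eq0 gt_eqF.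
    have := is_derive_cvg_seq (dMm t1 e1) hN0 hN.
    suff -> : (fun n => (- h n)^-1 * (Mm (t1 + - h n) - Mm t1)) =
      (fun n => (h n)^-1 * (Mm t1 - Mm (t1 - h n))) by [].
    by apply/funext => n; rewrite invrN mulNr -mulrN opprB.
  have c2 : (h n)^-1 * (Mm (t0 + h n) - Mm t0) @[n --> \oo] --> m t0.
    have e1 : t0 - (t1 - t0) - 1 < t0 by lra.
    have hN0 n : h n != 0 by rewrite gt_eqF.
    exact: is_derive_cvg_seq (dMm t0 e1) hN0 hc.
  have -> : Bn = fun n => - ((h n)^-1 * (Mm t1 - Mm (t1 - h n)) - (h n)^-1 * (Mm (t0 + h n) - Mm t0)).
    by apply/funext => n; rewrite /Bn mulrBr.
  by apply: cvgN; apply: cvgB.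
have HB n : \int[mu2]_w Y n w <= Bn n.
  have [iG ->] := Rintegral_fubini21 (iY n).
  pose rho t : R := if (t0 + h n <= t) && (t <= t1) then - ((h n)^-1 * (m t - m (t - h n))) else 0.
  have crho : continuous (fun t => - ((h n)^-1 * (m t - m (t - h n)))).
    move=> t; apply: cvgN; apply: cvgM; first exact: cvg_cst.
    apply: cvgB; first exact: cm.
    apply: (@continuous_comp _ _ _ (fun t => t - h n) m); last exact: cm.
    by apply: cvgB; [exact: cvg_id|exact: cvg_cst].
  have rhoE : rho = (fun t => - ((h n)^-1 * (m t - m (t - h n)))) \_ `[t0 + h n, t1].
    apply/funext => t; rewrite patchE /rho; case: ifPn => [H|/negP H].
      by rewrite mem_set//= in_itv.
    by rewrite memNset//= in_itv.
  have irho : mu.-integrable setT (EFin \o rho).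
    rewrite rhoE; apply: integrable_restrictT => //.
    by apply: continuous_itv_integrable; exact: continuous_withinT.
  have -> : Bn n = \int[mu]_t rho t.
    rewrite rhoE -Rintegral_mkcond.
    have hh := hle n; have hh0 := h0 n.
    have le01 : t0 + h n <= t1 by lra.
    have dF t : t0 + h n <= t -> is_derive t 1 (fun t => - ((h n)^-1 * (Mm t - Mm (t - h n)))) (- ((h n)^-1 * (m t - m (t - h n)))).
      move=> tt.
      have d1 : is_derive t 1 Mm (m t) by apply: dMm; lra.
      have d3 : is_derive t 1 (fun t => t - h n) 1 by apply: is_derive_eq; rewrite subr0.
      have d2' : is_derive (t - h n) 1 Mm (m (t - h n)) by apply: dMm; lra.
      have d2 : is_derive t 1 (fun t => Mm (t - h n)) (m (t - h n)).
        have := @is_derive1_comp _ Mm (fun t => t - h n) t _ _ d2' d3.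
        by rewrite mulr1.
      by apply: is_derive_eq; rewrite /GRing.scale/=.
    rewrite (_ : \int[mu]_(t in _) _ = (- ((h n)^-1 * (Mm t1 - Mm (t1 - h n)))) - (- ((h n)^-1 * (Mm (t0 + h n) - Mm (t0 + h n - h n))))).
      by rewrite /Bn addrK; ring.
    apply: (@FTC2_itv _ _ _ (fun t => - ((h n)^-1 * (Mm t - Mm (t - h n))))) => //.
    - apply: derivable_within_continuous => t; rewrite in_itv/= => /andP[tt _].
      by case: (dF t tt).
    - exact: continuous_withinT.
    - by move=> t /andP[tt _]; apply: dF; exact: ltW.
  apply: ae_le_Rintegral => //.
  have ib := ae_integrable_section (ibDD n); have ib2 := ae_integrable_section iDD.
  have FF := ae_filter_ringOfSetsType mu.
  near=> t.
  have [pr ib_t iD_t] : [/\ t0 <= t <= t1 ->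
      mu.-integrable `[a, c] (EFin \o (fun x => zx (x, t))) /\
      forall x, a <= x <= c -> z (x, t) = z (a, t) + \int[mu]_(y in `[a, x]) zx (y, t),
      mu.-integrable setT (EFin \o (fun x => bavg (h n) DD (x, t))) &
      mu.-integrable setT (EFin \o (fun x => DD (x, t)))].
    split; [near: t; exact: prim|near: t; exact: ib|near: t; exact: ib2].
  rewrite /rho /Y /=; case: ifPn => [/andP[tt0 tt1]|_]; last first.
    by rewrite Rintegral_cst// mul0r.
  have hh0 := h0 n.
  have tt : t0 <= t <= t1 by rewrite tt1 andbT; lra.
  have [izx zE] := pr tt.
  have half f : mu.-integrable setT (EFin \o (fun x => f x + f x)) -> mu.-integrable setT (EFin \o f).
    move=> /(integrable_mulrl measurableT 2^-1); apply: eq_integrable => // x _ /=.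
    by congr (_%:E); lra.
  apply: energy_slice => //; last exact: half.
  apply: half; move: ib_t; apply: eq_integrable => // x _ /=.
  congr (_%:E); rewrite /bavg /= -mulrDr -RintegralD//; apply: integrableS (iDx x) => //.
have WP0 x t : ~ (t0 <= t <= t1) -> W (x, t) = 0 /\ Psi (x, t) = 0.
  by move=> tt; rewrite /W /Psi /bx/=; case: (t0 <= t <= t1) tt => // _; rewrite andbF.
have AL := @averaging_limit R P Q W Psi DD t0 t1 (- (m t1 - m t0)) h Bn t01
  mP mQ mW mPsi mDD DD0 iDD iDDx PDD QDD domPQ WP0 h0 hc cBn HB.
pose C w := if bx w then pos (z w) ^+ 3 else 0.
have mC : measurable_fun setT C by apply: measurable_fun_ifT => //; exact: continuous_measurable_fun2.
have [K K0 HK] := box_bounded a c t0 t1 cpz3.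
have iC : mu2.-integrable setT (EFin \o C).
  apply: (@integrable_box_indic R a c t0 t1 K) => //.
    move=> x t; rewrite /C /bx/=; case: ifPn => [/andP[xx tt]|_]; first exact: HK.
    by rewrite normr0.
  move=> x t H; rewrite /C /bx/= ifF//; apply/negP => /andP[xx tt]; exact: H.
have iPQ : mu2.-integrable setT (EFin \o (fun w => P w * W w + Q w * Psi w)).
  apply: le_integrable_real (integrable_addr measurableT iDD iDD) => //.
    by apply: measurable_funD; apply: measurable_funM.
  by move=> [x t] _; exact: domPQ.
have low : - L * \int[mu2]_w C w <= \int[mu2]_w (P w * W w + Q w * Psi w).
  rewrite -RintegralZl//; apply: le_Rintegral => //; first exact: integrable_mulrl.
  move=> [x t] _; rewrite /C /W /Psi; case: ifPn => [/andP[/= xx tt]|_]; last by rewrite !mulr0 addr0.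
  have [zp|zn] := ltP 0 (z (x, t)); last by rewrite !expr0n/= !(mulr0, mul0r) addr0.
  have [s1 s2] := sign xx tt zp.
  have q1 : 0 <= P (x, t) * (2 * z (x, t) * zx (x, t)).
    have -> : P (x, t) * (2 * z (x, t) * zx (x, t)) = 2 * z (x, t) * (P (x, t) * zx (x, t)) by ring.
    by rewrite mulr_ge0// mulr_ge0// ltW.
  have q2 : - L * z (x, t) ^+ 3 <= Q (x, t) * z (x, t) ^+ 2.
    by rewrite exprS mulrA ler_wpM2r// sqr_ge0.
  by rewrite -[leLHS]add0r lerD.
have upC : \int[mu2]_w C w <= 3 * S * (t1 - t0).
  have [iG ->] := Rintegral_fubini21 iC.
  have E t : \int[mu]_x C (x, t) = ((fun t => 3 * m t) \_ `[t0, t1]) t.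
    rewrite patchE; case: ifPn => [|/negP H].
      rewrite inE/= in_itv/= => tt.
      rewrite /m /cube_energy -RintegralZl//; last first.
        apply: continuous_itv_integrable; apply: continuous_withinT.
        apply: (@continuous_sect2 R (fun w => pos (z w) ^+ 3 / 3)) => w.
        by apply: (@cvgM _ _ _ _ (fun w => pos (z w) ^+ 3)); [exact: cpz3|exact: cvg_cst].
      rewrite [RHS]Rintegral_mkcond; apply: eq_Rintegral => x _; rewrite patchE /C /bx/= tt andbT.
      case: ifPn => [xx|/negP H]; first by rewrite mem_set/= ?in_itv// mulrC divfK.
      by rewrite memNset//= in_itv.
    rewrite (@eq_Rintegral _ _ _ mu _ (cst 0)) ?Rintegral_cst ?mul0r//.
    move=> x _; rewrite /C /bx/= ifF//; apply/negP => /andP[_ tt]; apply: H.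
    by rewrite inE/= in_itv.
  rewrite (@eq_Rintegral _ _ _ mu _ ((fun t => 3 * m t) \_ `[t0, t1])); last by move=> t _; exact: E.
  rewrite -Rintegral_mkcond.
  have i3 (f : R -> R) : continuous f -> mu.-integrable `[t0, t1] (EFin \o f).
    by move=> cf; apply: continuous_itv_integrable; exact: continuous_withinT.
  have -> : 3 * S * (t1 - t0) = \int[mu]_(t in `[t0, t1]) (3 * S).
    by rewrite Rintegral_cst//= lebesgue_measure_itv/= lte_fin t01.
  apply: le_Rintegral => //.
  - by apply: i3 => t; apply: cvgM; [exact: cvg_cst|exact: cm].
  - by apply: i3 => t; exact: cvg_cst.
  - by move=> t; rewrite /= in_itv/= => tt; rewrite ler_wpM2l// m_le.
have := le_trans low AL; have := ler_wpM2l L0 upC.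
move: (\int[mu2]_w C w) => I h1 h2; lra.
Unshelve. all: by end_near. Qed.

End EnergyCore.

(** * Weak formulation on a rectangle *)

Section Flux.
Context {R : realType}.
Local Notation mu := (@lebesgue_measure R).
Local Notation mu2 := (mu \x mu)%E.
Implicit Types (a b c d x t : R) (f : R * R -> R).

Lemma Rintegral_swap f : mu2.-integrable setT (EFin \o f) ->
  \int[mu]_x \int[mu]_t f (x, t) = \int[mu]_t \int[mu]_x f (x, t).
Proof.
move=> fi; have [_ <-] := Rintegral_fubini21 fi.
have mf : measurable_fun setT f by apply/measurable_EFinP; exact: measurable_int fi.
pose F x := (\int[mu]_t (f (x, t))%:E)%E.
have mF : measurable_fun setT F by exact: (measurable_fubini_F fi).
have mR : measurable_fun setT (fun x => \int[mu]_t f (x, t)).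
  by apply: (@measurableT_comp _ _ _ _ _ _ (@fine R) _ F) => //.
rewrite [RHS]/Rintegral -(integral12_prod_meas1 fi) /Rintegral; congr fine.
apply: ae_eq_integral => //; first exact/measurable_EFinP.
have [N [mN N0 sN]] := ae_integrable1 fi.
exists N; split => // x /= H; apply: sN => /= K; apply: H => _.
by rewrite /fubini_F -EFin_Rintegral.
Qed.

Definition clamp2 a c b d (w : R * R) : R * R := (clamp a c w.1, clamp b d w.2).

Lemma clamp2_continuous a c b d f : a <= c -> b <= d ->
  {within [set w | a <= w.1 <= c /\ b <= w.2 <= d], continuous f} ->
  continuous (f \o clamp2 a c b d).
Proof.
move=> ac bd /subspace_continuousP cf w.
have [h1 h2] := clamp_itv w.1 ac; have [h3 h4] := clamp_itv w.2 bd.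
have cD : [set w | a <= w.1 <= c /\ b <= w.2 <= d] (clamp2 a c b d w).
  by rewrite /= h1 h2 h3 h4.
have cc : clamp2 a c b d x @[x --> w] --> clamp2 a c b d w.
  apply: (@cvg_pair _ _ _ (nbhs w) (nbhs (clamp a c w.1)) (nbhs (clamp b d w.2))).
    by apply: (cvg_comp _ _ cvg_fst); exact: continuous_clamp.
  by apply: (cvg_comp _ _ cvg_snd); exact: continuous_clamp.
apply: (cvg_comp _ _ _ (cf _ cD)) => B HB.
have := cc _ HB; rewrite !nbhs_simpl /=.
apply: filterS => y; apply => /=.
have [-> ->] := clamp_itv y.1 ac; by have [-> ->] := clamp_itv y.2 bd.
Qed.

Lemma clamp2_id a c b d x t : a <= x <= c -> b <= t <= d ->
  clamp2 a c b d (x, t) = (x, t).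
Proof. by move=> /andP[? ?] /andP[? ?]; rewrite /clamp2 /= !clamp_id. Qed.

(** [powR] has a default value at negative bases; truncating the base by 0 gives a power that is
    continuous on the whole line and agrees with the true one where it matters. *)
Lemma continuous_pos_powR (r : R) : 0 < r -> continuous (fun s : R => (Num.max 0 s) `^ r).
Proof.
move=> r0 s; have [s0|s0|<-] := ltgtP 0 s.
- have ds : derivable (fun s : R => s `^ r) s 1.
    by apply: derivable_powR; rewrite in_itv/= andbT.
  have := differentiable_continuous ((derivable1_diffP _ _).1 ds).
  rewrite /continuous_at max_r ?ltW//.
  apply: cvg_trans; apply: near_eq_cvg; near=> y.
  by rewrite max_r// ltW//; near: y; exact: lt_nbhsr.
- rewrite /continuous_at max_l ?ltW//.
  apply: cvg_near_cst; near=> y.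
  by rewrite max_l// ltW//; near: y; exact: lt_nbhsl.
- rewrite /continuous_at maxxx powR0 ?gt_eqF//.
  apply/cvgrPdist_lt => e e0.
  pose d := e `^ r^-1; have d0 : 0 < d by exact: powR_gt0.
  near=> y; rewrite sub0r normrN ger0_norm ?powR_ge0//.
  have : `|y| < d by near: y; apply/nbhs_ballP; exists d => //= y; rewrite /ball/= sub0r normrN.
  rewrite ltr_norml => /andP[_ yd].
  have [y0|y0] := leP 0 y.
    rewrite -[ltRHS](powRr1 (ltW e0)) -(@mulVf _ r) ?gt_eqF// powRrM.
    by apply: gt0_ltr_powR => //; rewrite nnegrE ?powR_ge0.
  by rewrite powR0 ?gt_eqF.
Unshelve. all: by end_near. Qed.

Definition flux (p s : R) : R := `|s| `^ (p - 2) * s.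

Lemma continuous_flux p : 2 < p -> continuous (flux p).
Proof.
move=> p2 s; apply: cvgM; last exact: cvg_id.
rewrite (_ : (fun s : R => `|s| `^ (p - 2)) = (fun s => Num.max 0 `|s| `^ (p - 2))); last first.
  by apply/funext => y; rewrite max_r.
have p0 : 0 < p - 2 by rewrite subr_gt0.
have c1 : continuous (fun s : R => Num.max 0 `|s| `^ (p - 2)).
  move=> y; apply: (@continuous_comp _ _ _ (fun s : R => `|s|) (fun s => Num.max 0 s `^ (p - 2))).
    exact: norm_continuous.
  exact: continuous_pos_powR.
by have := c1 s; rewrite /continuous_at max_r.
Qed.

Lemma norm_flux p s : 2 < p -> `|flux p s| = `|s| `^ (p - 1).
Proof.
move=> p2; rewrite normrM (ger0_norm (powR_ge0 _ _)) mulrC.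
have -> : p - 2 = (p - 1) - 1 by ring.
by rewrite mulr_powRB1//; lra.
Qed.

(** With A = |s|^(p - 2) and B = |r|^(p - 2), the product is half of (A - B)(s^2 - r^2) + (A + B)(s
    - r)^2, and A - B has the sign of |s| - |r|. *)
Lemma flux_mono p s r : 2 < p -> 0 <= (flux p s - flux p r) * (s - r).
Proof.
move=> p2.
have p0 : 0 <= p - 2 by lra.
pose A := `|s| `^ (p - 2); pose B := `|r| `^ (p - 2).
have AB : 0 <= (A - B) * (`|s| - `|r|).
  have [sr|sr] := leP `|s| `|r|.
    have : A <= B by apply: ge0_ler_powR => //; rewrite nnegrE.
    by rewrite -[A <= B]subr_le0 => h; rewrite mulr_le0// subr_le0.
  have : B <= A by apply: ge0_ler_powR => //; rewrite ?nnegrE// ltW.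
  by rewrite -[B <= A]subr_ge0 => h; rewrite mulr_ge0// subr_ge0 ltW.
have A0 : 0 <= A by exact: powR_ge0.
have B0 : 0 <= B by exact: powR_ge0.
rewrite /flux -/A -/B.
have -> : (A * s - B * r) * (s - r) = (A - B) * (s ^+ 2 - r ^+ 2) / 2 + (A + B) * (s - r) ^+ 2 / 2 by field.
apply: addr_ge0; apply: divr_ge0 => //; last first.
  by rewrite mulr_ge0 ?sqr_ge0// addr_ge0.
rewrite -[s ^+ 2]real_normK ?num_real// -[r ^+ 2]real_normK ?num_real//.
by rewrite subr_sqr mulrA mulr_ge0// addr_ge0.
Qed.

End Flux.

Section LpBound.
Context {R : realType}.
Local Notation mu := (@lebesgue_measure R).
Local Notation mu2 := (mu \x mu)%E.
Implicit Types (a c x t p q : R) (u ux : R -> R -> R).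

(** The integral of a nonnegative function is a supremum over the simple functions below it, hence
    monotone for arbitrary functions. It is applied to the sum of norms in [Lp_loc_W1p_loc_Lq_loc],
    whose measurability in time is not established beforehand. *)
Lemma ge0_le_integral_nomeas (E : set R) (f g : R -> \bar R) :
  (forall x, E x -> 0 <= f x)%E -> (forall x, E x -> f x <= g x)%E ->
  (\int[mu]_(x in E) f x <= \int[mu]_(x in E) g x)%E.
Proof.
move=> f0 fg; rewrite integral_mkcond [leRHS]integral_mkcond.
rewrite ge0_integralTE; last first.
  by move=> x; rewrite patchE; case: ifPn => // /set_mem; exact: f0.
rewrite ge0_integralTE; last first.
  move=> x; rewrite patchE; case: ifPn => // /set_mem Ex.
  exact: le_trans (f0 _ Ex) (fg _ Ex).
apply: ereal_sup_le => _ [h hf <-]; exists h => // x.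
apply: (le_trans (hf x)); rewrite !patchE; case: ifPn => // /set_mem; exact: fg.
Qed.

Definition in_box a c (t0 t1 : R) (w : R * R) : bool :=
  ((a <= w.1) && (w.1 <= c)) && ((t0 <= w.2) && (w.2 <= t1)).

Lemma measurable_in_box a c t0 t1 : measurable_fun setT (in_box a c t0 t1).
Proof.
by apply: measurable_and; apply: measurable_and; apply: measurable_fun_ler => //;
  apply: measurable_cst.
Qed.

Lemma measurable_box a c t0 t1 : measurable [set w : R * R | in_box a c t0 t1 w].
Proof.
have -> : [set w : R * R | in_box a c t0 t1 w] = `[a, c]%classic `*` `[t0, t1]%classic.
  by apply/seteqP; split => -[x t]; rewrite /in_box /= !in_itv/=; [move=> /andP[]|case=> -> ->].
exact: measurableX.
Qed.

Lemma measurable_open_strip (T : \bar R) : measurable (@open_strip R T).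
Proof.
have -> : @open_strip R T = setT `*` [set t : R | 0 < t /\ (t%:E < T)%E].
  by apply/seteqP; split => -[x t] /=; [split|case].
apply: measurableX => //; case: T => [r| |].
- rewrite (_ : [set t | _] = `]0, r[%classic)//.
  by apply/seteqP; split => t /=; rewrite in_itv/= lte_fin; [case=> -> ->|move=> /andP[]].
- rewrite (_ : [set t | _] = `]0, +oo[%classic)//.
  by apply/seteqP; split => t /=; rewrite in_itv/= andbT; [case|move=> t0; rewrite ltry].
- rewrite (_ : [set t | _] = set0)//.
  by apply/seteqP; split => t //= -[].
Qed.

Lemma measurable_on_box (T : \bar R) a c t0 t1 (F : R * R -> R) :
  measurable_fun (open_strip T) F -> 0 < t0 -> (t1%:E < T)%E ->
  measurable_fun setT (fun w => if in_box a c t0 t1 w then F w else 0).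
Proof.
move=> mF t00 t1T.
rewrite (_ : (fun w => _) = F \_ [set w | in_box a c t0 t1 w]); last first.
  apply/funext => w; rewrite patchE; case: ifPn => H; first by rewrite mem_set.
  by rewrite memNset//=; apply/negP.
apply/(measurable_restrictT _ _).1; first exact: measurable_box.
apply: measurable_funS mF; first exact: measurable_open_strip.
move=> [x t] /andP[_ /andP[/= h1 h2]]; split => /=; first exact: lt_le_trans h1.
by apply: le_lt_trans t1T; rewrite lee_fin.
Qed.

Lemma powR_Lnorm_on q a c (f : R -> R) : 0 < q ->
  (Lnorm_on q `[a, c] f `^ q)%E = (\int[mu]_(x in `[a, c]) (`|f x| `^ q)%:E)%E.
Proof.
move=> q0; rewrite /Lnorm_on powR_Lnorm; last by rewrite gt_eqF.
rewrite [RHS]integral_mkcond; apply: eq_integral => x _ /=.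
rewrite !patchE; case: ifPn => _; first by [].
by rewrite /= normr0 powR0 ?gt_eqF.
Qed.

Lemma Lp_box_finite p q (T : \bar R) u ux a c t0 t1 : 0 < p ->
  Lp_loc_W1p_loc_Lq_loc p q T u ux -> a < c -> 0 < t0 -> t0 < t1 -> (t1%:E < T)%E ->
  mu2.-integrable setT (fun w => (if in_box a c t0 t1 w then `|ux w.1 w.2| `^ p else 0)%:E).
Proof.
move=> p0 [_ mux _ H] ac t00 t01 t1T.
have mF : measurable_fun setT (fun w : R * R => if in_box a c t0 t1 w then `|ux w.1 w.2| `^ p else 0).
  apply: (@measurable_on_box T _ _ _ _ (fun w => `|ux w.1 w.2| `^ p)) => //.
  apply: (@measurableT_comp _ _ _ _ _ _ (fun s : R => s `^ p)); first exact: measurable_powR.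
  exact: measurableT_comp.
apply/integrableP; split; first exact/measurable_EFinP.
have F0 w : (0 <= (if in_box a c t0 t1 w then `|ux w.1 w.2| `^ p else 0)%:E :> \bar R)%E.
  by rewrite lee_fin; case: ifP => // _; exact: powR_ge0.
under eq_integral do rewrite gee0_abs//.
rewrite (fubini_tonelli2 (m1 := mu) (m2 := mu) (fun w => (if in_box a c t0 t1 w then `|ux w.1 w.2| `^ p else 0)%:E))//; last exact/measurable_EFinP.
apply: le_lt_trans (H a c t0 t1 ac t00 t01 t1T).
rewrite [leRHS]integral_mkcond; apply: ge0_le_integral_nomeas.
  by move=> t _; apply: integral_ge0.
move=> t _; rewrite /fubini_G patchE; case: ifPn => [|/negP Ht].
  rewrite inE/= in_itv/= => tt.
  apply: (@le_trans _ _ (Lnorm_on p `[a, c] (ux ^~ t) `^ p)%E).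
    rewrite powR_Lnorm_on// [leRHS]integral_mkcond; apply: ge0_le_integral_nomeas => // x _.
    rewrite patchE /in_box/= tt andbT; case: ifPn => [xx|/negP xx].
      by rewrite mem_set/= ?in_itv//.
    by rewrite memNset//= in_itv.
  by rewrite -addeA addeCA leeDl// adde_ge0// poweR_ge0.
rewrite integral0_eq// => x _; rewrite /in_box /= ifF//.
by apply/negP => /andP[_ tt]; apply: Ht; rewrite inE/= in_itv.
Qed.

End LpBound.

Section IteratedSwap.
Context {R : realType}.
Local Notation mu := (@lebesgue_measure R).
Local Notation mu2 := (mu \x mu)%E.

Lemma integrable_slab (r s : R) (f : R * R -> R) : mu2.-integrable setT (EFin \o f) ->
  (forall x, mu.-integrable setT (fun t => (f (x, t))%:E)) ->
  mu.-integrable setT (EFin \o (fun x => \int[mu]_(t in `[r, s]) f (x, t))).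
Proof.
move=> fi fx; have mf : measurable_fun setT f by apply/measurable_EFinP; exact: measurable_int fi.
pose g w := if (r <= w.2) && (w.2 <= s) then f w else 0.
have mg : measurable_fun setT g.
  by apply: measurable_fun_ifT => //; apply: measurable_and; apply: measurable_fun_ler => //; exact: measurable_cst.
have ig : mu2.-integrable setT (EFin \o g).
  apply: le_integrable_real (integrable_normr fi) => //.
  by move=> w _; rewrite /g; case: ifP => // _; rewrite normr0.
have := integrable_fubini_F ig; apply: eq_integrable => // x _ /=.
have gx : (fun t => g (x, t)) = (fun t => f (x, t)) \_ `[r, s].
  apply/funext => t; rewrite patchE /g/=; case: ifPn => [H|/negP H].
    by rewrite mem_set//= in_itv.
  by rewrite memNset//= in_itv.
rewrite /fubini_F -/(EFin \o g) /=.
have igx : mu.-integrable setT (EFin \o (fun t => g (x, t))).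
  by rewrite gx; apply: integrable_restrictT => //; apply: integrableS (fx x).
by rewrite (EFin_Rintegral measurableT igx)// gx -Rintegral_mkcond.
Qed.

Variables (a c r s : R) (P Q : R * R -> R) (zeta zeta1 : R -> R).
Hypotheses (ac : a < c) (rs : r < s).
Hypotheses (iP : mu2.-integrable setT (EFin \o P)) (iQ : mu2.-integrable setT (EFin \o Q)).
Hypotheses (iPx : forall x, mu.-integrable setT (fun t => (P (x, t))%:E))
  (iQx : forall x, mu.-integrable setT (fun t => (Q (x, t))%:E)).
Hypotheses (cz : {within `[a, c], continuous zeta}) (cz1 : {within `[a, c], continuous zeta1}).

Lemma iterated_swap :
  [/\ mu.-integrable `[a, c] (EFin \o (fun x => (\int[mu]_(t in `[r, s]) P (x, t)) * zeta1 x)),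
      mu.-integrable `[a, c] (EFin \o (fun x => (\int[mu]_(t in `[r, s]) Q (x, t)) * zeta x)) &
      \int[mu]_(x in `[a, c]) ((\int[mu]_(t in `[r, s]) P (x, t)) * zeta1 x) +
      \int[mu]_(x in `[a, c]) ((\int[mu]_(t in `[r, s]) Q (x, t)) * zeta x) =
      \int[mu]_(t in `[r, s]) \int[mu]_(x in `[a, c]) (P (x, t) * zeta1 x + Q (x, t) * zeta x)].
Proof.
have i1 (f : R * R -> R) (k : R -> R) : {within `[a, c], continuous k} -> mu2.-integrable setT (EFin \o f) ->
  (forall x, mu.-integrable setT (fun t => (f (x, t))%:E)) ->
  mu.-integrable `[a, c] (EFin \o (fun x => (\int[mu]_(t in `[r, s]) f (x, t)) * k x)).
  move=> ck fi fx.
  have := integrable_continuousM ck (integrableS measurableT _ _ (integrable_slab r s fi fx)).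
  under [X in _ -> mu.-integrable _ (_ \o X)]eq_fun do rewrite mulrC.
  by apply.
have i1P := i1 _ _ cz1 iP iPx; have i1Q := i1 _ _ cz iQ iQx.
split => //; rewrite -RintegralD//.
have mP : measurable_fun setT P by apply/measurable_EFinP; exact: measurable_int iP.
have mQ : measurable_fun setT Q by apply/measurable_EFinP; exact: measurable_int iQ.
have cZ := clamp_continuous (ltW ac) cz; have cZ1 := clamp_continuous (ltW ac) cz1.
have bnd (k : R -> R) : continuous k -> exists2 M, 0 <= M & forall x, a <= x <= c -> `|k x| <= M.
  move=> ck; have ck2 : continuous (fun w : R * R => k w.1).
    by move=> w; apply: (@continuous_comp _ _ _ fst k); [exact: cvg_fst|exact: ck].
  have [M M0 HM] := box_bounded a c r s ck2; exists M => // x xac.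
  by apply: (HM x r) => //; rewrite lexx ltW.
have [M M0 HM] := bnd _ cZ; have [N N0 HN] := bnd _ cZ1.
pose E w := if in_box a c r s w then P w * (zeta1 \o clamp a c) w.1 + Q w * (zeta \o clamp a c) w.1 else 0.
have mc (k : R -> R) : continuous k -> measurable_fun setT (fun w : R * R => k w.1).
  move=> ck; apply: (@measurableT_comp _ _ _ _ _ _ k) => //.
  exact: continuous_measurable_fun.
have mE : measurable_fun setT E.
  apply: measurable_fun_ifT => //; first exact: measurable_in_box.
  by apply: measurable_funD; apply: measurable_funM => //; apply: mc.
have iE : mu2.-integrable setT (EFin \o E).
  apply: le_integrable_real (integrable_addr measurableT
    (integrable_mulrl measurableT N (integrable_normr iP))
    (integrable_mulrl measurableT M (integrable_normr iQ))) => //.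
  move=> w _; rewrite /E; case: ifPn => [/andP[wac _]|_]; last first.
    by rewrite normr0 addr_ge0// mulr_ge0.
  rewrite (le_trans (ler_normD _ _))// !normrM; apply: lerD; rewrite mulrC ler_wpM2r//.
    exact: HN.
  exact: HM.
transitivity (\int[mu]_x \int[mu]_t E (x, t)).
  rewrite Rintegral_mkcond; apply: eq_Rintegral => x _; rewrite patchE.
  case: ifPn => [|/negP H].
    rewrite inE/= in_itv/= => /[dup] xac /andP[x1 x2].
    have ii (f : R * R -> R) k : mu.-integrable setT (fun t => (f (x, t))%:E) ->
      mu.-integrable `[r, s] (EFin \o (fun t => k * f (x, t))).
      by move=> fi; apply: integrable_mulrl => //; apply: integrableS fi.
    have ii' (f : R * R -> R) : mu.-integrable setT (fun t => (f (x, t))%:E) ->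
      mu.-integrable `[r, s] (EFin \o (fun t => f (x, t))) by move=> fi; apply: integrableS fi.
    rewrite (mulrC _ (zeta1 x)) (mulrC _ (zeta x)) -!RintegralZl//; [|exact: ii'|exact: ii'].
    rewrite -RintegralD//; [|exact: ii|exact: ii].
    rewrite Rintegral_mkcond; apply: eq_Rintegral => t _; rewrite patchE /E /in_box/= xac/= clamp_id//.
    case: ifPn => [|/negP H]; first by rewrite inE/= in_itv/= => ->; rewrite !(mulrC (zeta _)) !(mulrC (zeta1 _)).
    by rewrite ifF//; apply/negP => K; apply: H; rewrite inE/= in_itv.
  rewrite (@eq_Rintegral _ _ _ mu _ (cst 0)) ?Rintegral_cst ?mul0r//.
  by move=> t _; rewrite /E /in_box /= ifF//; apply/negP => /andP[K _]; apply: H; rewrite inE/= in_itv.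
rewrite (Rintegral_swap iE) [RHS]Rintegral_mkcond; apply: eq_Rintegral => t _; rewrite patchE.
case: ifPn => [|/negP H].
  rewrite inE/= in_itv/= => tt.
  rewrite [RHS]Rintegral_mkcond; apply: eq_Rintegral => x _; rewrite patchE /E /in_box/= tt andbT.
  case: ifPn => [/[dup] xac /andP[x1 x2]|/negP H].
    by rewrite mem_set/= ?in_itv//= clamp_id.
  by rewrite memNset//= in_itv.
rewrite (@eq_Rintegral _ _ _ mu _ (cst 0)) ?Rintegral_cst ?mul0r//.
by move=> x _; rewrite /E /in_box /= ifF//; apply/negP => /andP[_ K]; apply: H; rewrite inE/= in_itv.
Qed.

End IteratedSwap.

Section RegularGradient.
Context {R : realType}.
Local Notation mu := (@lebesgue_measure R).
Local Notation mu2 := (mu \x mu)%E.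

(* The weak gradient is set to 0 over a null set of [x], which makes its [p]-th power integrable in
   time for every [x]. *)
Lemma regular_gradient (p q : R) T (u ux : R -> R -> R) a c t0 t1 : 0 < p ->
  Lp_loc_W1p_loc_Lq_loc p q T u ux -> a < c -> 0 < t0 -> t0 < t1 -> (t1%:E < T)%E ->
  exists (g : R * R -> R) (N : set R),
  [/\ measurable_fun setT g, measurable N /\ mu N = 0,
      forall x t, g (x, t) = if in_box a c t0 t1 (x, t) && (x \notin N) then ux x t else 0,
      mu2.-integrable setT (fun w => (`|g w| `^ p)%:E) &
      forall x, mu.-integrable setT (fun t => (`|g (x, t)| `^ p)%:E)].
Proof.
move=> p0 HLp ac t00 t01 t1T.
have iF := Lp_box_finite p0 HLp ac t00 t01 t1T.
have [N [mN N0 sN]] := ae_integrable1 iF.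
pose b (w : R * R) := if in_box a c t0 t1 w then ux w.1 w.2 else 0.
have mb : measurable_fun setT b by case: HLp => _ mux _ _; exact: measurable_on_box mux t00 t1T.
pose g (w : R * R) := if w.1 \in N then 0 else b w.
have mg : measurable_fun setT g.
  apply: measurable_fun_ifT => //.
  rewrite (_ : (fun w : R * R => w.1 \in N) = (fun x => x \in N) \o fst)//.
  apply: measurableT_comp => //.
  apply: (@measurable_fun_bool _ _ _ _ true).
  rewrite (_ : _ @^-1` _ = N) ?setTI//.
  by apply/seteqP; split => x /=; [move/set_mem|move=> Nx; rewrite mem_set].
have mgp : measurable_fun setT (fun w => `|g w| `^ p).
  by apply: (@measurableT_comp _ _ _ _ _ _ (fun s : R => s `^ p)) => //; exact: measurableT_comp.
have gb w : `|g w| `^ p <= if in_box a c t0 t1 w then `|ux w.1 w.2| `^ p else 0.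
  rewrite /g /b; case: ifPn => _; last by case: ifPn => // _; rewrite normr0 powR0 ?gt_eqF.
  by case: ifPn => _; rewrite normr0 powR0 ?gt_eqF// powR_ge0.
exists g, N; split => //.
- move=> x t; rewrite /g /b /=.
  by case: (x \in N); case: in_box.
- apply: (@le_integrable_real _ _ _ mu2 setT measurableT _ _ mgp _ iF) => w _.
  by rewrite ger0_norm ?powR_ge0.
- move=> x; have [xN|xN] := boolP (x \in N).
    rewrite (_ : (fun t => _) = fun=> 0%E); first exact: integrable0.
    by apply/funext => t; rewrite /g /= xN normr0 powR0 ?gt_eqF.
  have ix : mu.-integrable setT (fun t => (if in_box a c t0 t1 (x, t) then `|ux x t| `^ p else 0)%:E).
    by apply: contrapT => H; move/negP: xN; apply; apply/mem_set; exact: sN.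
  apply: (@le_integrable_real _ _ _ mu setT measurableT _ _ _ _ ix).
    by apply: (measurableT_comp mgp).
  by move=> t _; rewrite ger0_norm ?powR_ge0//; exact: gb (x, t).
Qed.

Lemma powRB1_le (p s : R) : 1 < p -> 0 <= s -> s `^ (p - 1) <= 1 + s `^ p.
Proof.
move=> p1 s0; have [s1|s1] := leP s 1.
  rewrite (le_trans (@ge0_ler_powR _ (p - 1) _ _ _ _ _ s1)) ?nnegrE//; first by lra.
  by rewrite powR1 lerDl powR_ge0.
rewrite (le_trans (@ler_powR _ s (ltW s1) (p - 1) p _)) ?lerDr//; lra.
Qed.

(** In use [e] is the indicator of a rectangle outside which [g] vanishes; it makes the 1 in |g|^(p
    - 1) <= 1 + |g|^p integrable. *)
Lemma integrable_flux (p : R) d (T : measurableType d) (m : {measure set T -> \bar R}) (g e : T -> R) : 2 < p ->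
  measurable_fun setT g -> m.-integrable setT (EFin \o e) ->
  (forall w, g w != 0 -> e w = 1) -> (forall w, 0 <= e w) ->
  m.-integrable setT (fun w => (`|g w| `^ p)%:E) ->
  m.-integrable setT (fun w => (flux p (g w))%:E).
Proof.
move=> p2 mg ie e1 e0 ig.
apply: (@le_integrable_real _ _ _ m setT measurableT _ _ _ _ (integrable_addr measurableT ie ig)).
  by apply: (@measurableT_comp _ _ _ _ _ _ (flux p)) => //; apply: continuous_measurable_fun; exact: continuous_flux.
move=> w _; rewrite norm_flux//.
have [g0|g0] := eqVneq (g w) 0.
  rewrite g0 normr0 !powR0 ?addr0 ?gt_eqF//; lra.
by rewrite e1// powRB1_le//; lra.
Qed.

End RegularGradient.

Section WeakFormBox.
Context {R : realType}.
Local Notation mu := (@lebesgue_measure R).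
Local Notation mu2 := (mu \x mu)%E.

Lemma integrable_box_continuous a c t0 t1 (f : R * R -> R) : continuous f ->
  mu2.-integrable setT (EFin \o (fun w => if in_box a c t0 t1 w then f w else 0)) /\
  forall x, mu.-integrable setT (fun t => (if in_box a c t0 t1 (x, t) then f (x, t) else 0)%:E).
Proof.
move=> cf; have [M M0 HM] := box_bounded a c t0 t1 cf.
have mE : measurable_fun setT (fun w => if in_box a c t0 t1 w then f w else 0).
  by apply: measurable_fun_ifT => //; [exact: measurable_in_box|exact: continuous_measurable_fun2].
split.
  apply: (@integrable_box_indic R a c t0 t1 M) => // x t; rewrite /in_box/=.
    by case: ifPn => [/andP[xx tt]|_]; [exact: HM|rewrite normr0].
  by move=> H; rewrite ifF//; apply/negP => /andP[xx tt]; exact: H.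
move=> x; have [xx|xx] := boolP (a <= x <= c); last first.
  rewrite (_ : (fun t => _) = fun=> 0%E); first exact: integrable0.
  by apply/funext => t; rewrite /in_box/= (negbTE xx).
have := integrable_restrictT (measurable_itv _)
  (continuous_itv_integrable (@continuous_withinT R `[t0, t1] _ (@continuous_sect1 R f x cf))).
congr (mu.-integrable _ _); apply/funext => t /=; rewrite patchE /in_box/= xx/=.
case: ifPn => [|/negP H]; first by rewrite inE/= in_itv/= => ->.
by rewrite ifF//; apply/negP => K; apply: H; rewrite inE/= in_itv.
Qed.

(** The lateral curves are constant and the test function does not depend on t, so its time
    derivative drops out. Fubini's theorem then gathers the time integrals of flux and reaction in
    front of [zeta1] and [zeta], which is the form that [du_bois_reymond] takes. *)
Lemma weak_form_box (p b beta : R) T (u ux : R -> R -> R) a c t0 t1 (g U : R * R -> R) (N : set R) :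
  2 < p -> 0 < beta -> a < c -> 0 < t0 -> t0 < t1 -> (t1%:E < T)%E ->
  measurable_fun (open_strip T) (fun w : R * R => ux w.1 w.2) ->
  (forall (t0 t1 : R) (mu1 mu2 : R -> R),
          0 < t0 -> t0 < t1 -> (t1%:E <= T)%E ->
          C1_on t0 t1 mu1 -> C1_on t0 t1 mu2 ->
          (forall t, t0 <= t <= t1 -> mu1 t < mu2 t) ->
          forall phi phi_x phi_xx phi_t : R -> R -> R,
          C21_closure (curved_domain t0 t1 mu1 mu2) phi phi_x phi_xx phi_t ->
          (forall t, t0 <= t <= t1 ->
             phi (mu1 t) t = 0 /\ phi (mu2 t) t = 0) ->
          \int[mu]_(x in `[mu1 t1, mu2 t1]) (u x t1 * phi x t1)
          - \int[mu]_(x in `[mu1 t0, mu2 t0]) (u x t0 * phi x t0)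
          + \int[mu]_(t in `[t0, t1]) (\int[mu]_(x in `[mu1 t, mu2 t])
              (- (u x t * phi_t x t)
               + `|ux x t| `^ (p - 2) * ux x t * phi_x x t
               + b * u x t `^ beta * phi x t)) = 0) ->
  measurable_fun setT g -> measurable N -> mu N = 0 ->
  (forall x t, g (x, t) = if in_box a c t0 t1 (x, t) && (x \notin N) then ux x t else 0) ->
  mu2.-integrable setT (fun w => (`|g w| `^ p)%:E) ->
  (forall x, mu.-integrable setT (fun t => (`|g (x, t)| `^ p)%:E)) ->
  continuous U ->
  (forall x t, a <= x <= c -> t0 <= t <= t1 -> U (x, t) = u x t /\ 0 <= u x t) ->
  forall r s, t0 <= r -> r < s -> s <= t1 ->
  forall zeta zeta1 zeta2 : R -> R, continuous zeta2 ->
    (forall x, a <= x <= c -> is_derive x 1 zeta (zeta1 x) /\ is_derive x 1 zeta1 (zeta2 x)) ->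
    zeta a = 0 -> zeta c = 0 ->
  let P w := flux p (g w) in
  let Q w := if in_box a c t0 t1 w then b * Num.max 0 (U w) `^ beta else 0 in
  \int[mu]_(x in `[a, c]) ((U (x, s) - U (x, r)) * zeta x) +
  (\int[mu]_(x in `[a, c]) ((\int[mu]_(t in `[r, s]) P (x, t)) * zeta1 x) +
   \int[mu]_(x in `[a, c]) ((\int[mu]_(t in `[r, s]) Q (x, t)) * zeta x)) = 0.
Proof.
move=> p2 be0 ac t00 t01 t1T mux weak mg mN N0 gE ig igx cU UE r s t0r rs st1 zeta zeta1 zeta2 cz2 dz za zc P Q.
have wc (k k' : R -> R) : (forall x, a <= x <= c -> is_derive x 1 k (k' x)) -> {within `[a, c], continuous k}.
  move=> dk; apply: derivable_within_continuous => x; rewrite in_itv/= => xac.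
  by case: (dk x xac).
have cz : {within `[a, c], continuous zeta} by apply: (wc _ zeta1) => x /dz[].
have cz1 : {within `[a, c], continuous zeta1} by apply: (wc _ zeta2) => x /dz[].
have cQ : continuous (fun w => b * Num.max 0 (U w) `^ beta).
  move=> w; apply: cvgM; first exact: cvg_cst.
  apply: (@continuous_comp _ _ _ U (fun v => Num.max 0 v `^ beta)); first exact: cU.
  exact: continuous_pos_powR.
have [iQ iQx] := integrable_box_continuous a c t0 t1 cQ.
have [i1 i1x] := integrable_box_continuous a c t0 t1 (fun w => cvg_cst (1 : R)).
have e0 (w : R * R) : 0 <= (if in_box a c t0 t1 w then 1 else 0) :> R by case: ifP.
have iP : mu2.-integrable setT (EFin \o P).
  have := (@integrable_flux R p _ _ mu2 g (fun w => if in_box a c t0 t1 w then 1 else 0) p2 mg i1 _ e0 ig).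
  apply => -[x t]; by rewrite gE; case: in_box => //=; rewrite eqxx.
have iPx x : mu.-integrable setT (fun t => (P (x, t))%:E).
  apply: (@integrable_flux _ _ _ _ _ _ _ p2 _ (i1x x)) => //.
    by apply: (measurableT_comp mg).
  by move=> t; rewrite gE; case: in_box => //=; rewrite eqxx.
have [_ _ ->] := iterated_swap ac rs iP iQ iPx iQx cz cz1.
have r0 : 0 < r by exact: lt_le_trans t0r.
have sT : (s%:E < T)%E by apply: le_lt_trans t1T; rewrite lee_fin.
have C1c k : C1_on r s (cst k : R -> R).
  split; first by apply: continuous_withinT => x; exact: cvg_cst.
  exists (cst 0); split; first by apply: continuous_withinT => x; exact: cvg_cst.
  by move=> t _; exact: is_derive_cst.
have cD : closure (curved_domain r s (cst a) (cst c)) `<=` [set w : R * R | a <= w.1 <= c].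
  have cl : closed [set w : R * R | a <= w.1 <= c].
    have -> : [set w : R * R | a <= w.1 <= c] = fst @^-1` `[a, c]%classic.
      by apply/seteqP; split => w /=; rewrite in_itv.
    apply: preimage_closed; last exact: itv_closed.
    by move=> w _; exact: cvg_fst.
  move/closure_id: cl => ->; apply: closure_subset.
  by move=> w [_ /andP[/= h1 h2]]; rewrite !ltW.
have cphi (k : R -> R) : (forall x, a <= x <= c -> {for x, continuous k}) ->
    {within closure (curved_domain r s (cst a) (cst c)), continuous (fun z : R * R => k z.1)}.
  move=> ck; apply/subspace_continuousP => w /cD /= wac.
  apply: cvg_within_filter.
  by apply: (@continuous_comp _ _ _ fst k); [exact: cvg_fst|exact: ck].
have dc (k k' : R -> R) (x : R) : is_derive x 1 k (k' x) -> {for x, continuous k}.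
  by case=> dk _; apply: differentiable_continuous; exact/derivable1_diffP.
have C21 : C21_closure (curved_domain r s (cst a) (cst c)) (fun x _ => zeta x)
    (fun x _ => zeta1 x) (fun x _ => zeta2 x) (fun _ _ => 0).
  split.
  - by apply: cphi => x /dz[+ _]; exact: dc.
  - by apply: cphi => x /dz[_]; exact: dc.
  - by apply: (cphi zeta2) => x _; exact: cz2.
  - by apply: (cphi (cst 0)) => x _; exact: cvg_cst.
  - move=> x t [_ /= /andP[h1 h2]]; have [d1 d2] : is_derive x 1 zeta (zeta1 x) /\ is_derive x 1 zeta1 (zeta2 x).
      by apply: dz; rewrite !ltW.
    by split => //; exact: is_derive_cst.
have W := weak r s (cst a) (cst c) r0 rs (ltW sT) (C1c a) (C1c c) (fun _ _ => ac) _ _ _ _ C21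
  (fun _ _ => conj za zc).
rewrite -[RHS]W /=; congr (_ + _).
  have iU t : mu.-integrable `[a, c] (EFin \o (fun x => U (x, t) * zeta x)).
    have := integrable_continuousM cz (continuous_itv_integrable (@continuous_withinT R `[a, c] _ (@continuous_sect2 R U t cU))).
    by under [X in _ -> mu.-integrable _ (_ \o X)]eq_fun do rewrite mulrC.
  under eq_Rintegral do rewrite mulrBl.
  rewrite RintegralB//; congr (_ - _); apply: eq_Rintegral => x; rewrite inE/= in_itv/= => xac.
    by have [->] := UE x s xac ltac:(rewrite st1 andbT; order_lra).
  by have [->] := UE x r xac ltac:(rewrite t0r; order_lra).
apply: eq_Rintegral => t; rewrite inE/= in_itv/= => tt.
have tt' : t0 <= t <= t1 by order_lra.
pose B (w : R * R) := if in_box a c t0 t1 w then ux w.1 w.2 else 0.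
have mB : measurable_fun setT B by exact: measurable_on_box mux t00 t1T.
have mQ : measurable_fun setT Q by apply/measurable_EFinP; exact: measurable_int iQ.
have mfl : measurable_fun setT (flux p) by apply: continuous_measurable_fun; exact: continuous_flux.
have msec (f : R * R -> R) : measurable_fun setT f -> measurable_fun `[a, c] (fun x => f (x, t)).
  by move=> mf; apply: measurable_funTS; apply: (measurableT_comp mf).
have mz (k : R -> R) : {within `[a, c], continuous k} -> measurable_fun `[a, c] k.
  by move=> ck; apply: subspace_continuous_measurable_fun.
(* At a fixed time [g] and the given gradient differ only for x in the null set [N]. *)
transitivity (\int[mu]_(x in `[a, c]) (flux p (B (x, t)) * zeta1 x + Q (x, t) * zeta x)).
  rewrite /Rintegral; congr fine; apply: ae_eq_integral => //.
  - apply/measurable_EFinP; apply: measurable_funD; apply: measurable_funM; [|exact: mz|exact: (msec Q mQ)|exact: mz].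
    by apply: (msec P); exact: (measurableT_comp mfl mg).
  - apply/measurable_EFinP; apply: measurable_funD; apply: measurable_funM; [|exact: mz|exact: (msec Q mQ)|exact: mz].
    by apply: (msec (fun w => flux p (B w))); exact: (measurableT_comp mfl mB).
  - exists N; split => // x /= H; apply: contrapT => xN; apply: H => _.
    by rewrite /P gE /B memNset//= andbT.
apply: eq_Rintegral => x; rewrite inE/= in_itv/= => xac.
have ib : in_box a c t0 t1 (x, t) by rewrite /in_box/= xac tt'.
have [Ux u0] := UE x t xac tt'.
by rewrite /B /Q ib /= Ux max_r// mulr0 oppr0 add0r /flux.
Qed.

End WeakFormBox.

Section ClassicalWeakForm.
Context {R : realType}.
Local Notation mu := (@lebesgue_measure R).
Local Notation mu2 := (mu \x mu)%E.

Definition weak_lhs (a c r s : R) (z P Q : R * R -> R) (zeta zeta1 : R -> R) : R :=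
  \int[mu]_(x in `[a, c]) ((z (x, s) - z (x, r)) * zeta x) +
  (\int[mu]_(x in `[a, c]) ((\int[mu]_(t in `[r, s]) P (x, t)) * zeta1 x) +
   \int[mu]_(x in `[a, c]) ((\int[mu]_(t in `[r, s]) Q (x, t)) * zeta x)).

(** In the place of the reaction stands F_x - V_t, which is what b u^beta equals for a solution. The
    part in V_t cancels the increment in time, and the rest is the integral of the derivative of
    [f (VX) * zeta], which vanishes at both ends. *)
Lemma classical_weak_form (a c t0 t1 : R) (f : R -> R) (V VX VT FX : R * R -> R) : a < c -> t0 < t1 ->
  continuous f -> continuous V -> continuous VX -> continuous VT -> continuous FX ->
  (forall x t, a < x < c -> t0 <= t <= t1 ->
     is_derive x 1 (fun x => f (VX (x, t))) (FX (x, t))) ->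
  (forall x t, a < x < c -> t0 < t < t1 -> is_derive t 1 (fun t => V (x, t)) (VT (x, t))) ->
  forall r s, t0 <= r -> r < s -> s <= t1 ->
  forall zeta zeta1 zeta2 : R -> R, continuous zeta2 ->
    (forall x, a <= x <= c -> is_derive x 1 zeta (zeta1 x) /\ is_derive x 1 zeta1 (zeta2 x)) ->
    zeta a = 0 -> zeta c = 0 ->
  weak_lhs a c r s V (fun w => if in_box a c t0 t1 w then f (VX w) else 0)
    (fun w => if in_box a c t0 t1 w then FX w - VT w else 0) zeta zeta1 = 0.
Proof.
move=> ac t01 cf cV cVX cVT cFX dF dV r s t0r rs st1 zeta zeta1 zeta2 cz2 dz za zc.
have wc (k k' : R -> R) : (forall x, a <= x <= c -> is_derive x 1 k (k' x)) -> {within `[a, c], continuous k}.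
  move=> dk; apply: derivable_within_continuous => x; rewrite in_itv/= => xac.
  by case: (dk x xac).
have cz : {within `[a, c], continuous zeta} by apply: (wc _ zeta1) => x /dz[].
have cz1 : {within `[a, c], continuous zeta1} by apply: (wc _ zeta2) => x /dz[].
have cP : continuous (fun w => f (VX w)).
  by move=> w; apply: (@continuous_comp _ _ _ VX f); [exact: cVX|exact: cf].
have [iP iPx] := integrable_box_continuous a c t0 t1 cP.
have [iQ iQx] := integrable_box_continuous a c t0 t1 cFX.
have ci (k : R * R -> R) x : continuous k -> mu.-integrable `[r, s] (EFin \o (fun t => k (x, t))).
  by move=> ck; apply: continuous_itv_integrable; apply: continuous_withinT; exact: continuous_sect1.
have inb x t : a <= x <= c -> r <= t <= s -> in_box a c t0 t1 (x, t).
  by move=> xac tt; rewrite /in_box/= xac/=; order_lra.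
have [i1 i2 E] := iterated_swap ac rs iP iQ iPx iQx cz cz1.
have iV t : mu.-integrable `[a, c] (EFin \o (fun x => V (x, t) * zeta x)).
  have := integrable_continuousM cz (continuous_itv_integrable (@continuous_withinT R `[a, c] _ (@continuous_sect2 R V t cV))).
  by under [X in _ -> mu.-integrable _ (_ \o X)]eq_fun do rewrite mulrC.
have iVV : mu.-integrable `[a, c] (EFin \o (fun x => (V (x, s) - V (x, r)) * zeta x)).
  under [X in mu.-integrable _ (_ \o X)]eq_fun do rewrite mulrBl.
  exact: integrable_subr.
have QE : \int[mu]_(x in `[a, c]) ((\int[mu]_(t in `[r, s]) (if in_box a c t0 t1 (x, t) then FX (x, t) - VT (x, t) else 0)) * zeta x) =
  \int[mu]_(x in `[a, c]) ((\int[mu]_(t in `[r, s]) (if in_box a c t0 t1 (x, t) then FX (x, t) else 0)) * zeta x -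
    (V (x, s) - V (x, r)) * zeta x).
  apply: eq_Rintegral => x; rewrite inE/= in_itv/= => xac.
  rewrite -mulrBl.
  have [->|xa] := eqVneq x a; first by rewrite za !mulr0.
  have [->|xc] := eqVneq x c; first by rewrite zc !mulr0.
  have xac' : a < x < c.
    by case/andP: xac => h1 h2; rewrite !lt_neqAle eq_sym xa h1 xc h2.
  congr (_ * _).
  have <- : \int[mu]_(t in `[r, s]) VT (x, t) = V (x, s) - V (x, r).
    apply: (@FTC2_itv _ _ _ (fun t => V (x, t))); first exact: ltW.
    - by apply: continuous_withinT; exact: continuous_sect1.
    - by apply: continuous_withinT; exact: continuous_sect1.
    - by move=> t tt; apply: dV => //; order_lra.
  transitivity (\int[mu]_(t in `[r, s]) (FX (x, t) - VT (x, t))).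
    by apply: eq_Rintegral => t; rewrite inE/= in_itv/= => tt; rewrite inb.
  rewrite RintegralB//; [congr (_ - _)|exact: ci|exact: ci].
  by apply: eq_Rintegral => t; rewrite inE/= in_itv/= => tt; rewrite inb.
rewrite /weak_lhs QE RintegralB// addrA addrC addrA subrK addrC E.
rewrite (@eq_Rintegral _ _ _ mu _ (cst 0)) ?Rintegral_cst ?mul0r// => t.
rewrite inE/= in_itv/= => tt.
rewrite (@eq_Rintegral _ _ _ mu _ (fun x => f (VX (x, t)) * zeta1 x + FX (x, t) * zeta x)); last first.
  by move=> x; rewrite inE/= in_itv/= => xac; rewrite inb.
have cw (k : R * R -> R) : continuous k -> {within `[a, c], continuous (fun x => k (x, t))}.
  by move=> ck; apply: continuous_withinT; exact: continuous_sect2.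
have cM (k k' : R -> R) : {within `[a, c], continuous k} -> {within `[a, c], continuous k'} ->
    {within `[a, c], continuous (fun x => k x * k' x)}.
  by move=> ck ck' x; apply: cvgM; [exact: ck|exact: ck'].
transitivity (f (VX (c, t)) * zeta c - f (VX (a, t)) * zeta a); last first.
  by rewrite za zc !mulr0 subr0.
apply: (@FTC2_itv _ _ _ (fun x => f (VX (x, t)) * zeta x)); first exact: ltW.
- exact: (cM _ _ (cw _ cP) cz).
- move=> x; apply: cvgD; [exact: (cM _ _ (cw _ cP) cz1)|exact: (cM _ _ (cw _ cFX) cz)].
- move=> x xac; have d1 : is_derive x 1 (fun x => f (VX (x, t))) (FX (x, t)) by apply: dF => //; order_lra.
  have [d2 _] : is_derive x 1 zeta (zeta1 x) /\ is_derive x 1 zeta1 (zeta2 x) by apply: dz; order_lra.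
  by apply: is_derive_eq; rewrite /GRing.scale/= [in RHS]mulrC [X in _ = _ + X]mulrC; ring.
Qed.

Lemma weak_lhs_comb (a c r s k : R) (U V P P' Q Q' : R * R -> R) (zeta zeta1 : R -> R) : a < c -> r < s ->
  continuous U -> continuous V ->
  mu2.-integrable setT (EFin \o P) -> (forall x, mu.-integrable setT (fun t => (P (x, t))%:E)) ->
  mu2.-integrable setT (EFin \o Q) -> (forall x, mu.-integrable setT (fun t => (Q (x, t))%:E)) ->
  mu2.-integrable setT (EFin \o P') -> (forall x, mu.-integrable setT (fun t => (P' (x, t))%:E)) ->
  mu2.-integrable setT (EFin \o Q') -> (forall x, mu.-integrable setT (fun t => (Q' (x, t))%:E)) ->
  {within `[a, c], continuous zeta} -> {within `[a, c], continuous zeta1} ->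
  weak_lhs a c r s (fun w => k * (U w - V w)) (fun w => k * (P w - P' w)) (fun w => k * (Q w - Q' w)) zeta zeta1 =
  k * (weak_lhs a c r s U P Q zeta zeta1 - weak_lhs a c r s V P' Q' zeta zeta1).
Proof.
move=> ac rs cU cV iP iPx iQ iQx iP' iP'x iQ' iQ'x cz cz1.
have lin (f g h : R -> R) : mu.-integrable `[a, c] (EFin \o f) -> mu.-integrable `[a, c] (EFin \o g) ->
  (forall x, a <= x <= c -> h x = k * (f x - g x)) ->
  \int[mu]_(x in `[a, c]) h x = k * (\int[mu]_(x in `[a, c]) f x - \int[mu]_(x in `[a, c]) g x).
  move=> fi gi E; rewrite -RintegralB// -RintegralZl//; last exact: integrable_subr.
  by apply: eq_Rintegral => x; rewrite inE/= in_itv/=; exact: E.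
have iV (W : R * R -> R) : continuous W -> mu.-integrable `[a, c] (EFin \o (fun x => (W (x, s) - W (x, r)) * zeta x)).
  move=> cW; under [X in mu.-integrable _ (_ \o X)]eq_fun do rewrite mulrC.
  apply: (integrable_continuousM cz); apply: continuous_itv_integrable; apply: continuous_withinT => x.
  by apply: cvgB; exact: continuous_sect2.
have sl (f : R * R -> R) (z : R -> R) : {within `[a, c], continuous z} -> mu2.-integrable setT (EFin \o f) ->
  (forall x, mu.-integrable setT (fun t => (f (x, t))%:E)) ->
  mu.-integrable `[a, c] (EFin \o (fun x => (\int[mu]_(t in `[r, s]) f (x, t)) * z x)).
  move=> ck fi fx; under [X in mu.-integrable _ (_ \o X)]eq_fun do rewrite mulrC.
  by apply: (integrable_continuousM ck); apply: integrableS (integrable_slab r s fi fx).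
have slE (f g : R * R -> R) x : (forall x, mu.-integrable setT (fun t => (f (x, t))%:E)) ->
  (forall x, mu.-integrable setT (fun t => (g (x, t))%:E)) ->
  \int[mu]_(t in `[r, s]) (k * (f (x, t) - g (x, t))) = k * (\int[mu]_(t in `[r, s]) f (x, t) - \int[mu]_(t in `[r, s]) g (x, t)).
  move=> fi gi.
  have fi' : mu.-integrable `[r, s] (EFin \o (fun t => f (x, t))) by apply: integrableS (fi x).
  have gi' : mu.-integrable `[r, s] (EFin \o (fun t => g (x, t))) by apply: integrableS (gi x).
  by rewrite RintegralZl ?RintegralB//; exact: integrable_subr.
rewrite /weak_lhs.
have e1 := lin _ _ (fun x => (k * (U (x, s) - V (x, s)) - k * (U (x, r) - V (x, r))) * zeta x) (iV _ cU) (iV _ cV).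
have e2 := lin _ _ (fun x => (\int[mu]_(t in `[r, s]) (k * (P (x, t) - P' (x, t)))) * zeta1 x)
  (sl _ _ cz1 iP iPx) (sl _ _ cz1 iP' iP'x).
have e3 := lin _ _ (fun x => (\int[mu]_(t in `[r, s]) (k * (Q (x, t) - Q' (x, t)))) * zeta x)
  (sl _ _ cz iQ iQx) (sl _ _ cz iQ' iQ'x).
rewrite e1; last by move=> x _; ring.
rewrite e2; last by move=> x _; rewrite (slE P P' x)//; ring.
rewrite e3; last by move=> x _; rewrite (slE Q Q' x)//; ring.
by rewrite -!mulrDr; congr (_ * _); rewrite !opprD [RHS]addrACA; congr (_ + _); rewrite [RHS]addrACA.
Qed.

End ClassicalWeakForm.

(** * Weak comparison principle *)

Section ComparisonEnergy.
Context {R : realType}.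
Local Notation mu := (@lebesgue_measure R).
Local Notation mu2 := (mu \x mu)%E.

(** A rough form of Young's inequality, by comparing both factors with the larger of [s] and [r]. It
    decouples a flux at one time from a gradient at another. *)
Lemma powR_mulB1_le (p s r : R) : 1 < p -> 0 <= s -> 0 <= r ->
  s `^ (p - 1) * r <= s `^ p + r `^ p.
Proof.
move=> p1 s0 r0; have [sr|rs] := leP s r.
  apply: (@le_trans _ _ (r `^ p)); last by rewrite lerDr powR_ge0.
  rewrite -(@mulr_powRB1 _ r p)//; last by lra.
  rewrite mulrC ler_wpM2l//; apply: ge0_ler_powR; rewrite ?nnegrE//; lra.
apply: (@le_trans _ _ (s `^ p)); last by rewrite lerDl powR_ge0.
rewrite -(@mulr_powRB1 _ s p)//; last by lra.
by rewrite mulrC ler_wpM2r ?powR_ge0// ltW.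
Qed.

(** [A] is |u_x|^(p - 1) at a time r, [B] is |u_x| at a time t, and [X], [Y] are the p-th powers of
    |u_x| at these times, while [M] bounds the barrier terms and the difference. The right side is a
    sum of a function of r and a function of t, as the averaging argument demands. *)
Lemma product_bound (M A B X Y P G z : R) : 1 <= M -> 0 <= X -> 0 <= Y -> 0 <= A -> 0 <= B ->
  A * B <= X + Y -> A <= 1 + X -> B <= 1 + Y ->
  `|P| <= A + M -> `|G| <= B + M -> `|z| <= M ->
  `|P * (2 * z * G)| <= 4 * M * (1 + M) ^+ 2 * (1 + X) + 4 * M * (1 + M) ^+ 2 * (1 + Y).
Proof.
move=> M1 X0 Y0 A0 B0 AB AX BY PA GB zM.
have M0 : 0 <= M by lra.
have -> : P * (2 * z * G) = 2 * (z * (P * G)) by ring.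
rewrite normrM (@ger0_norm _ 2)// 2!normrM.
have h1 : `|P| * `|G| <= (A + M) * (B + M) by apply: ler_pM.
have h2 : (A + M) * (B + M) <= (1 + M) ^+ 2 * (2 + X + Y).
  have : M * A <= M * (1 + X) by rewrite ler_wpM2l.
  have : M * B <= M * (1 + Y) by rewrite ler_wpM2l.
  have : 0 <= M ^+ 2 * (X + Y) by rewrite mulr_ge0 ?sqr_ge0// addr_ge0.
  have : 0 <= M * (X + Y) by rewrite mulr_ge0// addr_ge0.
  have : 0 <= M ^+ 2 by exact: sqr_ge0.
  move: (M * (X + Y)) => ? *; nra.
have h3 : `|z| * (`|P| * `|G|) <= M * ((1 + M) ^+ 2 * (2 + X + Y)).
  by apply: ler_pM => //; rewrite ?mulr_ge0// (le_trans h1).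
have h4 : 0 <= M * ((1 + M) ^+ 2 * (2 + X + Y)).
  by rewrite !mulr_ge0 ?sqr_ge0// !addr_ge0.
lra.
Qed.

Lemma cube_bound (M : R) : 1 <= M -> 1 + M + M ^+ 3 <= 4 * M * (1 + M) ^+ 2.
Proof.
move=> M1; have : 0 <= M ^+ 2 by exact: sqr_ge0.
have : 0 <= M ^+ 3 by apply: exprn_ge0; lra.
have -> : 4 * M * (1 + M) ^+ 2 = 4 * M ^+ 3 + 8 * M ^+ 2 + 4 * M by ring.
by move: (M ^+ 3) (M ^+ 2) => ? ?; lra.
Qed.

Lemma norm_pos_le (z : R) : `|Num.max 0 z| <= `|z|.
Proof. by case: (leP 0 z) => // _; rewrite normr0. Qed.

Lemma section_prim (u ux : R -> R -> R) (g U : R * R -> R) (N : set R) (a c t0 t1 t : R) :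
  a < c -> measurable N -> mu N = 0 -> measurable_fun setT g ->
  (forall x t, g (x, t) = if in_box a c t0 t1 (x, t) && (x \notin N) then ux x t else 0) ->
  continuous U -> (forall x, a <= x <= c -> U (x, t) = u x t) ->
  t0 <= t <= t1 -> weak_derivative (u ^~ t) (ux ^~ t) ->
  forall x, a <= x <= c -> mu.-integrable `[a, x] (EFin \o (fun y => g (y, t))) /\
      u x t - u a t = \int[mu]_(y in `[a, x]) g (y, t).
Proof.
move=> ac mN N0 mg gE cU UE tt wd.
have main x : a < x <= c -> mu.-integrable `[a, x] (EFin \o (fun y => g (y, t))) /\
      u x t - u a t = \int[mu]_(y in `[a, x]) g (y, t).
  move=> /andP[ax xc].
  have cu : {within `[a, x], continuous (u ^~ t)}.
    apply: (@subspace_eq_continuous _ _ _ (fun y => U (y, t))).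
      by move=> y; rewrite inE/= in_itv/= => /andP[ay yx]; apply: UE; rewrite ay (le_trans yx xc).
    by apply: continuous_withinT; exact: continuous_sect2.
  have [iu uE] := weak_derivative_prim wd ax cu.
  have gt y : a <= y <= x -> y \notin N -> g (y, t) = ux y t.
    by move=> /andP[ay yx] yN; rewrite gE /in_box/= ay (le_trans yx xc) tt yN.
  have mgt : measurable_fun `[a, x] (fun y => g (y, t)).
    by apply: measurable_funTS; apply: (measurableT_comp mg).
  split.
    apply: (@le_integrable_real _ _ _ mu _ _ _ _ mgt _ (integrable_normr iu)) => //.
    move=> y _; rewrite gE; case: ifP => _ //; by rewrite normr0.
  rewrite uE /Rintegral; congr fine; apply: ae_eq_integral => //.
  - exact: measurable_int iu.
  - exact/measurable_EFinP.
  - exists N; split => // y /= H; apply: contrapT => yN; apply: H.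
    by rewrite in_itv/= => ayx; rewrite gt// memNset.
move=> x /andP[ax xc].
split.
  have [ic _] : mu.-integrable `[a, c] (EFin \o (fun y => g (y, t))) /\
      u c t - u a t = \int[mu]_(y in `[a, c]) g (y, t) by apply: main; rewrite ac lexx.
  by apply: (integrable_prim ic).
move: ax; rewrite le_eqVlt => /predU1P[<-|ax]; last by apply: (main x _).2; rewrite ax.
by rewrite subrr set_itv1 Rintegral_set1.
Qed.

(** [sg = 1] serves an upper barrier and [sg = -1] a lower one. The differential inequality is asked
    only where the signed difference is positive, since the test function vanishes elsewhere. *)
Lemma comparison_energy (p b beta : R) T (u : R -> R -> R) (a c d sg L S t0 t1 : R)
    (U V VX VT FX : R * R -> R) :
  2 < p -> 0 < beta -> weak_solution p b beta T u -> a < c -> (d%:E < T)%E -> 0 <= L -> `|sg| = 1 ->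
  continuous U -> continuous V -> continuous VX -> continuous VT -> continuous FX ->
  (forall x t, a <= x <= c -> 0 < t <= d -> U (x, t) = u x t) ->
  (forall x t : R, a < x < c -> 0 < t <= d -> is_derive x 1 (fun x => V (x, t)) (VX (x, t))) ->
  (forall x t : R, a < x < c -> 0 < t <= d -> is_derive x 1 (fun x => flux p (VX (x, t))) (FX (x, t))) ->
  (forall x t : R, a < x < c -> 0 < t < d -> is_derive t 1 (fun t => V (x, t)) (VT (x, t))) ->
  (forall x t, a <= x <= c -> 0 < t <= d -> 0 < sg * (U (x, t) - V (x, t)) ->
    sg * (- (b * u x t `^ beta) - (VT (x, t) - FX (x, t))) <= L * (sg * (U (x, t) - V (x, t)))) ->
  (forall t, 0 < t <= d -> sg * (U (a, t) - V (a, t)) <= 0 /\ sg * (U (c, t) - V (c, t)) <= 0) ->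
  0 < t0 -> t0 < t1 -> t1 <= d ->
  (forall t, t0 <= t <= t1 -> cube_energy a c (fun w => sg * (U w - V w)) t <= S) ->
  cube_energy a c (fun w => sg * (U w - V w)) t1 <=
  cube_energy a c (fun w => sg * (U w - V w)) t0 + 3 * L * S * (t1 - t0).
Proof.
move=> p2 be0 [_ u0 _ [ux [HLp weak]]] ac dT L0 sg1 cU cV cVX cVT cFX UE dV dF dVt sub lat t00 t01 t1d mS.
have t1T : (t1%:E < T)%E by apply: le_lt_trans dT; rewrite lee_fin.
have p0 : 0 < p by order_lra.
have [g [N [mg [mN N0] gE ig igx]]] := regular_gradient p0 HLp ac t00 t01 t1T.
have mux : measurable_fun (open_strip T) (fun w : R * R => ux w.1 w.2) by case: HLp.
have tin t : t0 <= t <= t1 -> 0 < t <= d by move=> tt; order_lra.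
have UE' x t : a <= x <= c -> t0 <= t <= t1 -> U (x, t) = u x t /\ 0 <= u x t.
  move=> xac tt; have tt' := tin t tt; split; first exact: UE.
  apply: u0; first by order_lra.
  by apply: le_lt_trans t1T; rewrite lee_fin; order_lra.
have cfl := @continuous_flux R p p2.
pose e (w : R * R) : R := if in_box a c t0 t1 w then 1 else 0.
have [ie iex] := integrable_box_continuous a c t0 t1 (fun w => cvg_cst (1 : R)).
have e0 w : 0 <= e w by rewrite /e; case: ifP.
have ge w : g w != 0 -> e w = 1.
  by case: w => x t; rewrite gE /e; case: in_box => //=; rewrite eqxx.
have gout w : ~~ in_box a c t0 t1 w -> g w = 0 by case: w => x t H; rewrite gE (negbTE H).
pose P1 w := flux p (g w).
have flux0 : flux p 0 = 0 :> R by rewrite /flux mulr0.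
have mP1 : measurable_fun setT P1.
  by apply: (@measurableT_comp _ _ _ _ _ _ (flux p)) => //; exact: continuous_measurable_fun.
have iP1 : mu2.-integrable setT (EFin \o P1) := @integrable_flux R p _ _ mu2 g e p2 mg ie ge e0 ig.
have iP1x x : mu.-integrable setT (fun t => (P1 (x, t))%:E).
  apply: (@integrable_flux R p _ _ mu (fun t => g (x, t)) (fun t => e (x, t)) p2 _ (iex x) _ _ (igx x)) => //.
    by apply: (measurableT_comp mg).
  by move=> t; exact: ge.
have cP2 : continuous (fun w => flux p (VX w)).
  by move=> w; apply: (@continuous_comp _ _ _ VX (flux p)); [exact: cVX|exact: cfl].
pose P2 w := if in_box a c t0 t1 w then flux p (VX w) else 0.
have [iP2 iP2x] := integrable_box_continuous a c t0 t1 cP2.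
have cQ1 : continuous (fun w => b * Num.max 0 (U w) `^ beta).
  move=> w; apply: cvgM; first exact: cvg_cst.
  apply: (@continuous_comp _ _ _ U (fun v => Num.max 0 v `^ beta)); first exact: cU.
  exact: continuous_pos_powR.
pose Q1 w := if in_box a c t0 t1 w then b * Num.max 0 (U w) `^ beta else 0.
have [iQ1 iQ1x] := integrable_box_continuous a c t0 t1 cQ1.
have cQ2 : continuous (fun w => FX w - VT w) by move=> w; apply: cvgB; [exact: cFX|exact: cVT].
pose Q2 w := if in_box a c t0 t1 w then FX w - VT w else 0.
have [iQ2 iQ2x] := integrable_box_continuous a c t0 t1 cQ2.
have cz : continuous (fun w => sg * (U w - V w)).
  by move=> w; apply: cvgM; [exact: cvg_cst|apply: cvgB; [exact: cU|exact: cV]].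
have [M M1' [HM1 HM2 HM3 HM4]] : exists2 M, 1 <= M & [/\
    forall x t, a <= x <= c -> t0 <= t <= t1 -> `|VX (x, t)| <= M,
    forall x t, a <= x <= c -> t0 <= t <= t1 -> `|flux p (VX (x, t))| <= M,
    forall x t, a <= x <= c -> t0 <= t <= t1 ->
      `|b * Num.max 0 (U (x, t)) `^ beta| + `|FX (x, t) - VT (x, t)| <= M &
    forall x t, a <= x <= c -> t0 <= t <= t1 -> `|sg * (U (x, t) - V (x, t))| <= M].
  have [M1 M10 HM1] := box_bounded a c t0 t1 cVX.
  have [M2 M20 HM2] := box_bounded a c t0 t1 cP2.
  have [M3 M30 HM3] := box_bounded a c t0 t1 cQ1.
  have [M4 M40 HM4] := box_bounded a c t0 t1 cQ2.
  have [M5 M50 HM5] := box_bounded a c t0 t1 cz.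
  exists (1 + M1 + M2 + (M3 + M4) + M5); first by order_lra.
  split => x t xx tt.
  - by apply: (le_trans (HM1 x t xx tt)); order_lra.
  - by apply: (le_trans (HM2 x t xx tt)); order_lra.
  - by apply: (le_trans (lerD (HM3 x t xx tt) (HM4 x t xx tt))); order_lra.
  - by apply: (le_trans (HM5 x t xx tt)); order_lra.
have M0 : 0 <= M by exact: le_trans M1'.
(* One constant for all the bounds of [energy_core]: the value comes from [product_bound], and it
   also dominates 1 + M, for [P], and M^3, for [Q] times the squared positive part. *)
have [K [KE MK K0]] : exists K, [/\ K = 4 * M * (1 + M) ^+ 2, 1 + M + M ^+ 3 <= K & 0 <= K].
  exists (4 * M * (1 + M) ^+ 2); split; [by []|exact: cube_bound|].
  by apply: mulr_ge0; [apply: mulr_ge0|exact: sqr_ge0].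
pose X w := `|g w| `^ p.
have X0 w : 0 <= X w by exact: powR_ge0.
pose D w := K * (e w + X w).
have gX w : `|flux p (g w)| <= e w + X w.
  rewrite norm_flux//; have [->|g0] := eqVneq (g w) 0.
    by rewrite normr0 powR0 ?gt_eqF ?addr_ge0//; order_lra.
  by rewrite ge// powRB1_le//; order_lra.
have bP1 w : `|P1 w - P2 w| <= `|flux p (g w)| + M * e w.
  rewrite (le_trans (ler_normB _ _))// lerD2l /P2 /e; case: ifPn => [|_]; last by rewrite normr0 mulr0.
  by case: w => x t /andP[xx tt]; rewrite mulr1 HM2//.
have bQ w : `|Q1 w - Q2 w| <= M * e w.
  rewrite (le_trans (ler_normB _ _))// /Q1 /Q2 /e; case: ifPn => [|_]; last by rewrite normr0 mulr0 addr0.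
  by case: w => x t /andP[xx tt]; rewrite mulr1 HM3//.
pose P w := sg * (P1 w - P2 w).
pose Q w := sg * (Q1 w - Q2 w).
pose zx w := sg * (g w - VX w).
have nsg x : `|sg * x| = `|x| by rewrite normrM sg1 mul1r.
have sg2 : sg * sg = 1 by have := real_normK (num_real sg); rewrite sg1 expr1n expr2.
have mP2 : measurable_fun setT P2 by apply/measurable_EFinP; exact: measurable_int iP2.
have mQ1 : measurable_fun setT Q1 by apply/measurable_EFinP; exact: measurable_int iQ1.
have mQ2 : measurable_fun setT Q2 by apply/measurable_EFinP; exact: measurable_int iQ2.
have mX : measurable_fun setT X.
  by apply: (@measurableT_comp _ _ _ _ _ _ (fun s : R => s `^ p)) => //; exact: measurableT_comp.
have me : measurable_fun setT e by apply/measurable_EFinP; exact: measurable_int ie.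
have eb x t : a <= x <= c -> t0 <= t <= t1 -> e (x, t) = 1 by move=> xx tt; rewrite /e /in_box/= xx tt.
have M30' : 0 <= M ^+ 3 by rewrite exprn_ge0.
have MeK w : M * e w <= K * e w by rewrite ler_wpM2r//; order_lra.
apply: (@energy_core R a c t0 t1 L S _ zx P Q D) => //.
- by apply: measurable_funM => //; apply: measurable_funB => //; exact: continuous_measurable_fun2.
- by apply: measurable_funM => //; apply: measurable_funB.
- by apply: measurable_funM => //; apply: measurable_funB.
- by apply: measurable_funM => //; apply: measurable_funD.
- by move=> w; rewrite mulr_ge0// addr_ge0.
- exact: (integrable_mulrl measurableT K (integrable_addr measurableT ie ig)).
- by move=> x; exact: (integrable_mulrl measurableT K (integrable_addr measurableT (iex x) (igx x))).
- move=> w; rewrite nsg (le_trans (bP1 w))//.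
  apply: (@le_trans _ _ ((1 + M) * (e w + X w))).
    by rewrite mulrDl mul1r lerD// ler_wpM2l ?lerDl.
  by rewrite ler_wpM2r ?addr_ge0//; order_lra.
- move=> w; rewrite nsg (le_trans (bQ w))// (le_trans (MeK w))// ler_wpM2l// lerDl//.
- move=> x t H; have nb : in_box a c t0 t1 (x, t) = false.
    by apply/negP => /andP[xx tt]; exact: H.
  by rewrite /P /Q /P1 /P2 /Q1 /Q2 nb gout ?nb// flux0 !subrr !mulr0.
- move=> x r t xx rr tt; rewrite /D !eb// KE.
  apply: (@product_bound M (`|g (x, r)| `^ (p - 1)) `|g (x, t)|) => //.
  + by apply: powR_mulB1_le => //; order_lra.
  + by apply: powRB1_le => //; order_lra.
  + have [g1|g1] := leP `|g (x, t)| 1; first by rewrite (le_trans g1)// lerDl.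
    rewrite (@le_trans _ _ (X (x, t)))// ?lerDr// /X.
    by rewrite -[leLHS]powRr1// ler_powR ?ltW//; order_lra.
  + rewrite nsg (le_trans (bP1 _))// norm_flux// eb// mulr1//.
  + rewrite nsg (le_trans (ler_normB _ _))// lerD2l HM1//.
  + exact: (le_trans (norm_pos_le (sg * (U (x, t) - V (x, t)))) (HM4 _ _ xx tt)).
- move=> x r t xx rr tt; rewrite /D !eb//.
  have : `|Q (x, r) * Num.max 0 (sg * (U (x, t) - V (x, t))) ^+ 2| <= M ^+ 3.
    rewrite normrM (exprS M); apply: ler_pM => //.
      by rewrite nsg (le_trans (bQ _))// eb// mulr1.
    have h := le_trans (norm_pos_le (sg * (U (x, t) - V (x, t)))) (HM4 _ _ xx tt).
    by rewrite normrX; apply: lerXn2r; rewrite ?nnegrE.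
  move/le_trans; apply; rewrite (@le_trans _ _ K)//; first by order_lra.
  have := mulr_ge0 K0 (X0 (x, r)); have := mulr_ge0 K0 (X0 (x, t)); rewrite !mulrDr mulr1; order_lra.
- have FF := ae_filter_ringOfSetsType mu.
  have [_ _ wd _] := HLp.
  near=> t => tt; have tt' := tin t tt.
  have tT : (t%:E < T)%E by apply: le_lt_trans t1T; rewrite lee_fin; order_lra.
  have wdt : weak_derivative (u ^~ t) (ux ^~ t).
    have : 0 < t -> (t%:E < T)%E -> weak_derivative (u ^~ t) (ux ^~ t) by near: t.
    by apply => //; order_lra.
  have igz : forall x, a <= x <= c -> mu.-integrable `[a, x] (EFin \o (fun y => g (y, t))) /\
      u x t - u a t = \int[mu]_(y in `[a, x]) g (y, t).
    apply: (section_prim ac mN N0 mg gE cU _ tt wdt) => x xx; exact: UE.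
  have icV x : mu.-integrable `[a, x] (EFin \o (fun y => VX (y, t))).
    by apply: continuous_itv_integrable; apply: continuous_withinT; exact: continuous_sect2.
  have iz x : a <= x <= c -> mu.-integrable `[a, x] (EFin \o (fun y => zx (y, t))).
    by move=> /igz[ig' _]; apply: integrable_mulrl => //; exact: integrable_subr.
  split; first by apply: iz; rewrite ltW//=.
  move=> x xac; have [ig' ugx] := igz x xac; case/andP: (xac) => ax xc.
  rewrite RintegralZl//; last exact: integrable_subr.
  rewrite RintegralB// -ugx.
  have -> : \int[mu]_(y in `[a, x]) VX (y, t) = V (x, t) - V (a, t).
    apply: (@FTC2_itv _ _ _ (fun y => V (y, t))) => //.
    - by apply: continuous_withinT; exact: continuous_sect2.
    - by apply: continuous_withinT; exact: continuous_sect2.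
    - by move=> y /andP[ay yx]; apply: dV => //; rewrite ay (lt_le_trans yx).
  by rewrite (UE x t)// (UE a t) ?lexx ?(ltW ac)//; ring.
- by move=> t /tin; exact: lat.
- move=> r s t0r rs st1 zeta zeta1 zeta2 cz2 dz za zc.
  have wu := @weak_form_box R p b beta T u ux a c t0 t1 g U N p2 be0 ac t00 t01 t1T mux weak
    mg mN N0 gE ig igx cU UE' r s t0r rs st1 zeta zeta1 zeta2 cz2 dz za zc.
  have dF' x t : a < x < c -> t0 <= t <= t1 -> is_derive x 1 (fun x => flux p (VX (x, t))) (FX (x, t)).
    by move=> xx /tin; exact: dF.
  have dVt' x t : a < x < c -> t0 < t < t1 -> is_derive t 1 (fun t => V (x, t)) (VT (x, t)).
    by move=> xx tt; apply: dVt => //; order_lra.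
  have wv := @classical_weak_form R a c t0 t1 (flux p) V VX VT FX ac t01 cfl cV cVX cVT cFX dF' dVt'
    r s t0r rs st1 zeta zeta1 zeta2 cz2 dz za zc.
  have wc (k k' : R -> R) : (forall x, a <= x <= c -> is_derive x 1 k (k' x)) -> {within `[a, c], continuous k}.
    move=> dk; apply: derivable_within_continuous => x; rewrite in_itv/= => xac.
    by case: (dk x xac).
  have cze : {within `[a, c], continuous zeta} by apply: (wc _ zeta1) => x /dz[].
  have cze1 : {within `[a, c], continuous zeta1} by apply: (wc _ zeta2) => x /dz[].
  have := @weak_lhs_comb R a c r s sg U V P1 P2 Q1 Q2 zeta zeta1 ac rs cU cV iP1 iP1x iQ1 iQ1x
    iP2 iP2x iQ2 iQ2x cze cze1.
  by rewrite wv [X in X - _]wu subr0 mulr0.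
- move=> x t xx tt z0; split.
    rewrite /P /zx mulrACA sg2 mul1r /P2 /in_box /= xx tt /= /P1.
    exact: flux_mono.
  have := sub x t xx (tin t tt) z0; have [Ux u1] := UE' x t xx tt.
  rewrite /Q /Q1 /Q2 /in_box/= xx tt /= Ux max_r//.
  move: (u x t `^ beta) => ub; rewrite mulNr lerNl.
  by have -> : - (sg * (b * ub - (FX (x, t) - VT (x, t)))) = sg * (- (b * ub) - (VT (x, t) - FX (x, t))) by ring.
Unshelve. all: by end_near. Qed.
End ComparisonEnergy.

Section WeakComparison.
Context {R : realType}.
Local Notation mu := (@lebesgue_measure R).

Definition rect (a c d : R) : set (R * R) := [set w | a <= w.1 <= c /\ 0 <= w.2 <= d].

Lemma is_derive_clamp (f : R -> R) (a c x df : R) : a < x < c ->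
  is_derive x 1 f df -> is_derive x 1 (fun y => f (clamp a c y)) df.
Proof.
move=> /andP[ax xc] d; apply: near_eq_is_derive d.
near=> y; rewrite clamp_id//; apply: ltW; near: y; [exact: lt_nbhsr|exact: lt_nbhsl].
Unshelve. all: by end_near. Qed.

(** The 3 in [3 * L * d < 1] is the ratio of z_+^3 to the energy density. If S is the maximal energy
    on [[0, d]], then [comparison_energy] from times near 0 gives S <= 3 L S d, hence S = 0. The
    smallness of [d] thus replaces Gronwall's inequality, and the theorem concerns short times
    only. *)
Theorem weak_comparison (p b beta : R) T (u : R -> R -> R) (a c d sg L : R)
    (v vx vt Fx : R * R -> R) :
  2 < p -> 0 < beta -> weak_solution p b beta T u ->
  {within half_open_strip T, continuous (fun z : R * R => u z.1 z.2)} ->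
  a < c -> 0 < d -> (d%:E < T)%E -> 0 <= L -> 3 * L * d < 1 -> `|sg| = 1 ->
  {within rect a c d, continuous v} -> {within rect a c d, continuous vx} ->
  {within rect a c d, continuous vt} -> {within rect a c d, continuous Fx} ->
  (forall x t : R, a < x < c -> 0 < t <= d ->
     is_derive x 1 (fun x => v (x, t)) (vx (x, t)) /\
     is_derive x 1 (fun x => flux p (vx (x, t))) (Fx (x, t))) ->
  (forall x t : R, a < x < c -> 0 < t < d -> is_derive t 1 (fun t => v (x, t)) (vt (x, t))) ->
  (forall x t, a <= x <= c -> 0 < t <= d -> 0 < sg * (u x t - v (x, t)) ->
    sg * (- (b * u x t `^ beta) - (vt (x, t) - Fx (x, t))) <= L * (sg * (u x t - v (x, t)))) ->
  (forall t, 0 < t <= d -> sg * (u a t - v (a, t)) <= 0 /\ sg * (u c t - v (c, t)) <= 0) ->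
  (forall x, a <= x <= c -> sg * (u x 0 - v (x, 0)) <= 0) ->
  forall x t, a <= x <= c -> 0 <= t <= d -> sg * (u x t - v (x, t)) <= 0.
Proof.
move=> p2 be0 wu cu ac d0 dT L0 Ld sg1 cv cvx cvt cFx dv dvt sub lat ini.
have cu' : {within rect a c d, continuous (fun z : R * R => u z.1 z.2)}.
  apply: continuous_subspaceW cu => -[x t] [/= _ /andP[t0 td]]; split => //=.
  by apply: le_lt_trans dT; rewrite lee_fin.
have acl := ltW ac; have d0l := ltW d0.
have cU := clamp2_continuous acl d0l cu'.
have cV := clamp2_continuous acl d0l cv.
have cVX := clamp2_continuous acl d0l cvx.
have cVT := clamp2_continuous acl d0l cvt.
have cFX := clamp2_continuous acl d0l cFx.
set U := _ \o _ in cU; set V := _ \o _ in cV; set VX := _ \o _ in cVX.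
set VT := _ \o _ in cVT; set FX := _ \o _ in cFX.
have kE (k : R * R -> R) x t : a <= x <= c -> 0 <= t <= d -> (k \o clamp2 a c 0 d) (x, t) = k (x, t).
  by move=> xx tt; rewrite /= clamp2_id.
have UE x t : a <= x <= c -> 0 <= t <= d -> U (x, t) = u x t by exact: kE.
have VE x t : a <= x <= c -> 0 <= t <= d -> V (x, t) = v (x, t) by exact: kE.
have VXE x t : a <= x <= c -> 0 <= t <= d -> VX (x, t) = vx (x, t) by exact: kE.
have VTE x t : a <= x <= c -> 0 <= t <= d -> VT (x, t) = vt (x, t) by exact: kE.
have FXE x t : a <= x <= c -> 0 <= t <= d -> FX (x, t) = Fx (x, t) by exact: kE.
have tw t : 0 < t <= d -> 0 <= t <= d by move=> /andP[/ltW -> ->].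
have xw x : a < x < c -> a <= x <= c by move=> /andP[/ltW -> /ltW ->].
have kx (k : R * R -> R) t : 0 < t <= d -> (fun x => (k \o clamp2 a c 0 d) (x, t)) = (fun x => k (clamp a c x, t)).
  by move=> /tw /andP[t0 td]; apply/funext => x; rewrite /= /clamp2 /= (@clamp_id _ 0 d).
pose z w := sg * (U w - V w).
have cz : continuous z.
  by move=> w; apply: cvgM; [exact: cvg_cst|apply: cvgB; [exact: cU|exact: cV]].
pose m := cube_energy a c z.
have cpz3 : continuous (fun w => Num.max 0 (z w) ^+ 3 / 3).
  have cp : continuous (fun w => Num.max 0 (z w)).
    by move=> w; apply: (@continuous_comp _ _ _ z (fun v => Num.max 0 v)); [exact: cz|exact: continuous_pos].
  move=> w; apply: cvgM; last exact: cvg_cst.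
  exact: (@continuous_comp _ _ _ (fun w => Num.max 0 (z w)) (fun s => s ^+ 3) w (cp w) (@exprn_continuous _ 3 _)).
have cm : continuous m by apply: (@continuous_int_param _ (fun w => Num.max 0 (z w) ^+ 3 / 3)).
have m0 t : 0 <= m t.
  by apply: Rintegral_ge0 => x _; rewrite divr_ge0// exprn_ge0// le_max lexx.
have m00 : m 0 = 0.
  rewrite /m /cube_energy (@eq_Rintegral _ _ _ mu _ (cst 0)) ?Rintegral_cst ?mul0r// => x.
  rewrite inE/= in_itv/= => xx; have := ini x xx.
  by rewrite /z UE ?VE ?lexx// => zn; rewrite max_l// expr0n mul0r.
have [s sd sM] := EVT_max d0l (@continuous_withinT R `[0, d] m cm).
set S := m s in sM.
have step t0 t1 : 0 < t0 -> t0 < t1 -> t1 <= d -> m t1 <= m t0 + 3 * L * S * (t1 - t0).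
  move=> t00 t01 t1d.
  apply: (@comparison_energy R p b beta T u a c d sg L S t0 t1 U V VX VT FX) => //.
  - by move=> x t xx tt; rewrite UE// tw.
  - move=> x t xx tt; rewrite VXE ?xw ?tw//; have [dd _] := dv x t xx tt.
    rewrite (kx _ _ tt); exact: (is_derive_clamp xx dd).
  - move=> x t xx tt; rewrite FXE ?xw ?tw//; have [_ dd] := dv x t xx tt.
    have -> : (fun x => flux p (VX (x, t))) = (fun x => flux p (vx (clamp a c x, t))).
      by apply/funext => y; congr (flux p _); exact: (congr1 (fun f => f y) (kx vx _ tt)).
    exact: (is_derive_clamp xx dd).
  - move=> x t xx tt; have tt' : 0 <= t <= d by order_lra.
    rewrite VTE ?xw//; have dd := dvt x t xx tt.
    have -> : (fun t => V (x, t)) = (fun t => v (x, clamp 0 d t)).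
      by have /andP[ax xc] := xw x xx; apply/funext => y; rewrite /V /= /clamp2 /= (@clamp_id _ a c).
    exact: (is_derive_clamp tt dd).
  - move=> x t xx tt; have tt' := tw t tt; rewrite UE// VE// VTE// FXE//; exact: sub.
  - move=> t tt; have tt' := tw t tt; rewrite !UE ?VE ?lexx ?acl//; exact: lat.
  - by move=> t tt; apply: sM; rewrite in_itv/=; order_lra.
have S0 : 0 <= S by exact: m0.
have Sle : S <= 3 * L * S * d.
  move: (sd); rewrite in_itv/= => /andP[]; rewrite le_eqVlt => /predU1P[s0|s0] sd'.
    by rewrite /S -s0 m00 !(mulr0, mul0r).
  (* The weak formulation starts at positive times; the energy is continuous up to time 0, where it
     vanishes by the initial inequality. *)
  have lim : (fun t => m t + 3 * L * S * d) @ 0^'+ --> m 0 + 3 * L * S * d.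
    by apply: cvgD; [apply: cvg_at_right_filter; exact: cm|exact: cvg_cst].
  rewrite -[leRHS]add0r -m00.
  apply: (cvgr_to_ge lim); near=> t.
  have t0 : 0 < t by near: t; exact: nbhs_right_gt.
  have ts : t < s by near: t; exact: nbhs_right_lt.
  apply: (le_trans (step t s t0 ts sd')); rewrite lerD2l; apply: ler_wpM2l; first by rewrite !mulr_ge0.
  by move: t0 sd'; clear; order_lra.
have S00 : S = 0.
  apply/eqP; rewrite eq_le S0 andbT leNgt; apply/negP => Sp.
  have : 3 * L * S * d < S.
    have -> : 3 * L * S * d = 3 * L * d * S by ring.
    by rewrite gtr_pMl.
  by rewrite ltNge Sle.
move=> x t xx tt.
have [->|xa] := eqVneq x a.
  move: tt => /andP[]; rewrite le_eqVlt => /predU1P[<-|t0] td; first by apply: ini; rewrite lexx.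
  by apply: (lat t _).1; rewrite t0.
have [->|xc] := eqVneq x c.
  move: tt => /andP[]; rewrite le_eqVlt => /predU1P[<-|t0] td; first by apply: ini; rewrite lexx andbT.
  by apply: (lat t _).2; rewrite t0.
have xx' : a < x < c by case/andP: xx => h1 h2; rewrite !lt_neqAle eq_sym xa h1 xc h2.
have mt : m t = 0.
  by apply/eqP; rewrite eq_le m0 andbT -S00; apply: sM; rewrite in_itv.
have := continuous_integral_eq0 (@continuous_sect2 R _ t cpz3) _ mt xx'.
rewrite /= /z UE// VE// leNgt => H; apply/negP => zp.
have : Num.max 0 (sg * (u x t - v (x, t))) ^+ 3 / 3 = 0.
  by apply: H => y; rewrite divr_ge0// exprn_ge0// le_max lexx.
rewrite max_r ?ltW// => /eqP; apply/negP; rewrite gt_eqF// divr_gt0// exprn_gt0//.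
Unshelve. all: by end_near. Qed.
End WeakComparison.

(** * Barriers *)

Section PowerDerivatives.
Context {R : realType}.
Implicit Types (r s : R).

(** The difference quotient at 0 is s_+^(r - 1) f(s), which tends to 0. Mere continuity of the
    factor is what powers of [gfactor] offer, as they may fail to be differentiable at x = 0. *)
Lemma is_derive_pow_mul0 r (f : R -> R) : 1 < r -> {for 0, continuous f} ->
  is_derive (0 : R) 1 (fun s => Num.max 0 s `^ r * f s) 0.
Proof.
move=> r1 cf.
have r0 : r != 0 by rewrite gt_eqF// (lt_trans ltr01).
have c0 : (fun s : R => Num.max 0 s `^ (r - 1) * f s) @ 0^' --> (0 : R).
  apply: cvg_within_filter.
  suff : (fun s : R => Num.max 0 s `^ (r - 1) * f s) @ 0 --> Num.max 0 0 `^ (r - 1) * f 0.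
    by rewrite maxxx powR0 ?mul0r// subr_eq0 gt_eqF.
  apply: (@cvgM _ _ _ _ (fun s : R => Num.max 0 s `^ (r - 1)) f); last exact: cf.
  by apply: continuous_pos_powR; rewrite subr_gt0.
have cv : h^-1 *: ((fun s => Num.max 0 s `^ r * f s) (h *: 1 + 0) -
    (fun s => Num.max 0 s `^ r * f s) 0) @[h --> 0^'] --> (0 : R).
  apply: cvg_trans c0; apply: near_eq_cvg; near=> h.
  have h0 : h != 0 by near: h; exact: nbhs_dnbhs_neq.
  rewrite /GRing.scale/= mulr1 addr0 maxxx powR0// mul0r subr0.
  have [hp|hn|/eqP] := ltgtP h 0; last by rewrite (negbTE h0).
    by rewrite !powR0 ?mul0r ?mulr0// subr_eq0 gt_eqF.
  rewrite -(@mulr_powRB1 _ h r) ?(ltW hn)//; last by rewrite (lt_trans ltr01).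
  by rewrite -!mulrA mulKf.
split; first by apply/cvg_ex; exists 0.
exact: cvg_lim cv.
Unshelve. all: by end_near. Qed.

Lemma is_derive_pos_powR r s : 1 < r ->
  is_derive s 1 (fun s => Num.max 0 s `^ r) (r * Num.max 0 s `^ (r - 1)).
Proof.
move=> r1; have [s0|s0|<-] := ltgtP 0 s.
- apply: near_eq_is_derive (is_derive1_powR r s0).
  by near=> y; rewrite max_r// ltW//; near: y; exact: lt_nbhsr.
- rewrite powR0 ?mulr0; last by rewrite subr_eq0 gt_eqF.
  apply: near_eq_is_derive (is_derive_cst (0 : R) s 1).
  near=> y; rewrite max_l ?ltW// ?powR0//; first by rewrite gt_eqF// (lt_trans ltr01).
  by near: y; exact: lt_nbhsl.
- rewrite powR0 ?mulr0; last by rewrite subr_eq0 gt_eqF.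
  have cc : {for 0, continuous (cst 1 : R -> R)} by exact: cvg_cst.
  have := is_derive_pow_mul0 r1 cc.
  by under eq_fun do rewrite mulr1.
Unshelve. all: by end_near. Qed.

End PowerDerivatives.

(** * Vanishing of the solution on a half line *)

Section FarBarrier.
Context {R : realType}.
Implicit Types (r s : R).

Lemma is_derive_scale (f : R -> R) (x df k : R) : is_derive x 1 f df ->
  is_derive x 1 (fun y => k * f y) (k * df).
Proof. by move=> d; apply: is_derive_eq. Qed.

Lemma flux_ge0 p s : 2 < p -> 0 <= s -> flux p s = s `^ (p - 1).
Proof.
move=> p2 s0; have h : 0 <= flux p s by rewrite mulr_ge0 ?powR_ge0.
by rewrite -[LHS]ger0_norm// norm_flux// ger0_norm.
Qed.

Lemma fluxN p s : flux p (- s) = - flux p s.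
Proof. by rewrite /flux normrN mulrN. Qed.

Lemma continuous_powpos2 (f : R * R -> R) (q : R) : 0 < q -> continuous f ->
  continuous (fun w => Num.max 0 (f w) `^ q).
Proof.
move=> q0 cf w; apply: (@continuous_comp _ _ _ f (fun s => Num.max 0 s `^ q)); first exact: cf.
exact: continuous_pos_powR.
Qed.

(** [s = 1] gives |x - y|^q and [s = -1] its odd counterpart. Derivation lowers the exponent and
    changes the sign of [s], so one formula covers the barrier, its gradient and its flux. *)
Definition two_sided_pow (y s x q : R) : R := Num.max 0 (x - y) `^ q + s * Num.max 0 (y - x) `^ q.
Local Notation pw := two_sided_pow.

Let pw_at (y s q : R) : q != 0 -> pw y s y q = 0.
Proof. by move=> q0; rewrite /two_sided_pow subrr maxxx powR0// mulr0 addr0. Qed.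

Let pwr (y s x q : R) : q != 0 -> y <= x -> pw y s x q = (x - y) `^ q.
Proof.
move=> q0 yx; rewrite /two_sided_pow max_r ?subr_ge0// (@max_l _ _ 0 (y - x)) ?subr_le0// powR0//.
by rewrite mulr0 addr0.
Qed.

Let pwl (y s x q : R) : q != 0 -> x <= y -> pw y s x q = s * (y - x) `^ q.
Proof.
by move=> q0 yx; rewrite /two_sided_pow max_l ?subr_le0// (@max_r _ _ 0 (y - x)) ?subr_ge0// powR0// add0r.
Qed.

Let is_derive_pw (y s x q : R) : 1 < q -> is_derive x 1 (fun x => pw y s x q) (q * pw y (- s) x (q - 1)).
Proof.
move=> q1.
have d1 : is_derive x 1 (fun x => x - y) 1 by apply: is_derive_eq; rewrite subr0.
have d2 : is_derive x 1 (fun x => y - x) (- 1) by apply: is_derive_eq; rewrite add0r mul1r.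
have e1 : is_derive x 1 (fun x => Num.max 0 (x - y) `^ q) (q * Num.max 0 (x - y) `^ (q - 1)).
  by apply: (@is_derive_comp_eq _ (fun s => Num.max 0 s `^ q) (fun x => x - y) _ _ _ _ (is_derive_pos_powR (x - y) q1) d1); rewrite mulr1.
have e2 : is_derive x 1 (fun x => Num.max 0 (y - x) `^ q) (- (q * Num.max 0 (y - x) `^ (q - 1))).
  by apply: (@is_derive_comp_eq _ (fun s => Num.max 0 s `^ q) (fun x => y - x) _ _ _ _ (is_derive_pos_powR (y - x) q1) d2); rewrite mulrN1.
by apply: is_derive_eq; rewrite /two_sided_pow /GRing.scale/=; ring.
Qed.

Let continuous_pw (y s q : R) : 0 < q -> continuous (fun w : R * R => pw y s w.1 q).
Proof.
move=> q0 w; apply: cvgD.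
  apply: (@continuous_powpos2 (fun w => w.1 - y)) => // v.
  by apply: cvgB; [exact: cvg_fst|exact: cvg_cst].
apply: cvgM; first exact: cvg_cst.
apply: (@continuous_powpos2 (fun w => y - w.1)) => // v.
by apply: cvgB; [exact: cvg_cst|exact: cvg_fst].
Qed.

Let flux_pw (p y x c q : R) : 2 < p -> 0 <= c -> 0 < q -> flux p (c * pw y (- 1) x q) = c `^ (p - 1) * pw y (- 1) x (q * (p - 1)).
Proof.
move=> p2 c0 q0; have q0' : q != 0 by rewrite gt_eqF.
have p1 : 0 < p - 1 by lra.
have qp : q * (p - 1) != 0 by rewrite gt_eqF// mulr_gt0.
have [xy|yx] := leP x y.
  by rewrite !pwl// !mulN1r !mulrN fluxN flux_ge0// ?mulr_ge0 ?powR_ge0// powRM ?powR_ge0// -powRrM.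
by rewrite !pwr ?ltW// flux_ge0// ?mulr_ge0 ?powR_ge0// powRM ?powR_ge0// -powRrM.
Qed.

(* With [q = p / (p - 2)] the flux of [|x - y|^q] is a multiple of [|x - y|^(q + 1)], so its derivative is
   again comparable to [|x - y|^q]; this fixes the exponent of the barrier. *)
Lemma far_vanishing (p b beta : R) T (u : R -> R -> R) (K Lam T1 : R) :
  2 < p -> 0 < beta -> weak_solution p b beta T u ->
  {within half_open_strip T, continuous (fun z : R * R => u z.1 z.2)} ->
  0 < T1 -> (T1%:E < T)%E -> 0 <= K -> 0 <= Lam ->
  (forall x t, 0 <= t <= T1 -> u x t <= K * (1 + `|x|) `^ (p / (p - 2))) ->
  (forall x t, 0 < t <= T1 -> - (b * u x t `^ beta) <= Lam * u x t) ->
  (forall x, 0 <= x -> u x 0 <= 0) ->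
  exists d, [/\ 0 < d, d <= T1 & forall y t, 1 <= y -> 0 <= t <= d -> u y t <= 0].
Proof.
move=> p2 be0 wu cu T10 T1T K0 Lam0 uK uL u0.
have [q qE] : exists q, q = p / (p - 2) by exists (p / (p - 2)).
rewrite -qE in uK.
have p20 : 0 < p - 2 by order_lra.
have q1 : 1 < q by rewrite qE ltr_pdivlMr// mul1r; order_lra.
have q0 : 0 < q by order_lra.
have qp : (q - 1) * (p - 1) = q + 1 by rewrite qE; field; rewrite gt_eqF.
(* On the sides x = y/2 and x = 3y/2 one has 1 + |x| <= 5 (y/2) because y >= 1, so the growth bound
   there is at most K 5^q (y/2)^q, which the barrier exceeds. *)
have [a aE] : exists a, a = K * 5 `^ q + 1 by exists (K * 5 `^ q + 1).
have a0 : 0 < a by rewrite aE ltr_wpDl// mulr_ge0// powR_ge0.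
(* While 1 + N t <= 2, the diffusion of the barrier is at most (2 a q)^(p - 1) (q + 1) |x - y|^q and
   [Lam * v] is at most 2 Lam a |x - y|^q. The time derivative a N |x - y|^q has to dominate their
   sum; [N] is that sum divided by a |x - y|^q. *)
have [N NE] : exists N, N = a `^ (p - 2) * (2 * q) `^ (p - 1) * (q + 1) + 2 * Lam by exists (a `^ (p - 2) * (2 * q) `^ (p - 1) * (q + 1) + 2 * Lam).
have N0 : 0 <= N.
  by rewrite NE addr_ge0// mulr_ge0// ?mulr_ge0 ?powR_ge0//; order_lra.
(* None of [a], [N] and [d] depends on y, whence the uniformity of the vanishing time. *)
have [d [d0 dT1 dN dL]] : exists d, [/\ 0 < d, d <= T1, N * d <= 1 & 3 * Lam * d < 1].
  have i1 : 0 < (N + 1)^-1 by rewrite invr_gt0; order_lra.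
  have i2 : 0 < (6 * (Lam + 1))^-1 by rewrite invr_gt0; order_lra.
  exists (Num.min T1 (Num.min (N + 1)^-1 (6 * (Lam + 1))^-1)); split.
  - by rewrite !lt_min T10 i1.
  - by rewrite ge_min lexx.
  - apply: (@le_trans _ _ (N * (N + 1)^-1)); last by rewrite ler_pdivrMr; order_lra.
    by rewrite ler_wpM2l// !ge_min lexx /= orbT.
  - apply: (@le_lt_trans _ _ (3 * Lam * (6 * (Lam + 1))^-1)); last by rewrite ltr_pdivrMr; order_lra.
    by rewrite ler_wpM2l ?mulr_ge0// !ge_min lexx !orbT.
have dT : (d%:E < T)%E by apply: le_lt_trans T1T; rewrite lee_fin.
exists d; split => // y t y1 td.
pose v (w : R * R) := a * (1 + N * w.2) * pw y 1 w.1 q.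
pose vx (w : R * R) := a * (1 + N * w.2) * q * pw y (- 1) w.1 (q - 1).
pose vt (w : R * R) := a * N * pw y 1 w.1 q.
pose Fx (w : R * R) := (a * (1 + N * w.2) * q) `^ (p - 1) * ((q + 1) * pw y 1 w.1 q).
have f1 s : 0 <= s <= d -> 1 <= 1 + N * s <= 2.
  move=> /andP[s0 sd]; rewrite lerDl mulr_ge0//=.
  have : N * s <= N * d by rewrite ler_wpM2l.
  by order_lra.
have afq0 s : 0 <= s <= d -> 0 <= a * (1 + N * s) * q.
  move=> /f1 /andP[h _]; apply: mulr_ge0; last exact: ltW.
  by apply: mulr_ge0; [exact: ltW|exact: le_trans h].
have cf : continuous (fun w : R * R => 1 + N * w.2).
  move=> w; apply: cvgD; first exact: cvg_cst.
  by apply: cvgM; [exact: cvg_cst|exact: cvg_snd].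
have caf (k : R) : continuous (fun w : R * R => a * (1 + N * w.2) * k).
  move=> w; apply: cvgM; last exact: cvg_cst.
  by apply: cvgM; [exact: cvg_cst|exact: cf].
have pw0 x : 0 <= pw y 1 x q by rewrite /two_sided_pow mul1r addr_ge0 ?powR_ge0.
have q10 : 0 < q - 1 by order_lra.
have y0 : 0 < y by order_lra.
(* The barrier vanishes at its centre y, so the comparison is used at this single point. *)
suff : 1 * (u y t - v (y, t)) <= 0 by rewrite /v pw_at ?gt_eqF// mulr0 subr0 mul1r.
apply: (@weak_comparison R p b beta T u (y / 2) (3 * y / 2) d 1 Lam v vx vt Fx p2 be0 wu cu _ d0 dT Lam0 dL).
- by order_lra.
- by rewrite normr1.
- apply: continuous_subspaceT => w; apply: cvgM; last exact: continuous_pw.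
  by apply: cvgM; [exact: cvg_cst|exact: cf].
- apply: continuous_subspaceT => w; apply: cvgM; last exact: continuous_pw.
  exact: caf.
- apply: continuous_subspaceT => w; apply: cvgM; last exact: continuous_pw.
  exact: cvg_cst.
- apply: (@subspace_eq_continuous _ _ _ (fun w => Num.max 0 (a * (1 + N * w.2) * q) `^ (p - 1) * ((q + 1) * pw y 1 w.1 q))).
    move=> w; rewrite inE /= => -[_ /afq0 ff]; by rewrite /from_subspace /Fx max_r.
  apply: continuous_subspaceT => w; apply: cvgM.
    by apply: (@continuous_powpos2 (fun w => a * (1 + N * w.2) * q)); [order_lra|exact: caf].
  by apply: cvgM; [exact: cvg_cst|exact: continuous_pw].
- move=> x s _ sd; split.
    have e1 := is_derive_pw y 1 x q1.
    by rewrite /v /vx /= -mulrA; exact: is_derive_scale e1.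
  have ff : 0 <= s <= d by order_lra.
  have -> : (fun x => flux p (vx (x, s))) = (fun x => (a * (1 + N * s) * q) `^ (p - 1) * pw y (- 1) x (q + 1)).
    by apply/funext => x'; rewrite /vx/= flux_pw ?qp//; apply: afq0; order_lra.
  have q2 : 1 < q + 1 by order_lra.
  have e1 := is_derive_pw y (- 1) x q2; rewrite opprK addrK in e1.
  by rewrite /Fx /=; exact: is_derive_scale e1.
- move=> x s _ _; rewrite /v /vt /=.
  have e1 : is_derive s 1 (fun s => a * (1 + N * s)) (a * N).
    by apply: is_derive_eq; rewrite /GRing.scale/=; ring.
  rewrite [X in is_derive _ _ X _](_ : _ = fun s => pw y 1 x q * (a * (1 + N * s))); last first.
    by apply/funext => s'; rewrite mulrC.
  by rewrite mulrC; exact: is_derive_scale e1.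
- move=> x s _ sd _; have us := uL x s _.
  rewrite !mul1r.
  have ff : 1 <= 1 + N * s <= 2 by apply: f1; order_lra.
  (* As - b u^beta <= Lam u, it is enough that the barrier is a supersolution of the equation with
     the linear source Lam v. *)
  have key : Lam * v (x, s) <= vt (x, s) - Fx (x, s).
    rewrite /v /vt /Fx /= -subr_ge0.
    set f := 1 + N * s in ff *; set W := pw y 1 x q.
    have -> : a * N * W - (a * f * q) `^ (p - 1) * ((q + 1) * W) - Lam * (a * f * W) =
      W * (a * N - (a * f * q) `^ (p - 1) * (q + 1) - Lam * a * f) by ring.
    rewrite mulr_ge0//; first exact: pw0.
    have h1 : (a * f * q) `^ (p - 1) <= a * a `^ (p - 2) * (2 * q) `^ (p - 1).
      have -> : a * a `^ (p - 2) = a `^ (p - 1).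
        have -> : p - 2 = (p - 1) - 1 by ring.
        by rewrite mulr_powRB1//; order_lra.
      rewrite -powRM; [|exact: ltW|order_lra].
      apply: ge0_ler_powR; rewrite ?nnegrE; [order_lra|by apply: afq0; order_lra|by apply: mulr_ge0; order_lra|].
      by rewrite -mulrA ler_wpM2l ?ler_wpM2r//; order_lra.
    have h2 : (a * f * q) `^ (p - 1) * (q + 1) <= a * a `^ (p - 2) * (2 * q) `^ (p - 1) * (q + 1).
      by rewrite ler_wpM2r//; order_lra.
    have h3 : Lam * a * f <= Lam * a * 2 by rewrite ler_wpM2l ?mulr_ge0//; order_lra.
    have -> : a * N = a * a `^ (p - 2) * (2 * q) `^ (p - 1) * (q + 1) + Lam * a * 2 by rewrite NE; ring.
    by order_lra.
  have := uL x s; order_lra.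
- move=> s sd; have ff : 1 <= 1 + N * s <= 2 by apply: f1; order_lra.
  have lat x : 0 <= x <= 3 * y / 2 -> pw y 1 x q = (y / 2) `^ q -> 1 * (u x s - v (x, s)) <= 0.
    move=> /andP[x0 xy] xE; rewrite mul1r subr_le0 /v /= xE.
    apply: (le_trans (uK x s _)); first by order_lra.
    have h1 : (1 + `|x|) `^ q <= 5 `^ q * (y / 2) `^ q.
      rewrite -powRM//; last by order_lra.
      by rewrite ger0_norm//; apply: ge0_ler_powR; rewrite ?nnegrE; order_lra.
    apply: (le_trans (ler_wpM2l K0 h1)); rewrite mulrA ler_wpM2r ?powR_ge0//.
    apply: (@le_trans _ _ a); first by rewrite aE lerDl.
    by rewrite ler_peMr//; [exact: ltW|case/andP: ff].
  split; apply: lat.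
  + by order_lra.
  + by rewrite pwl ?gt_eqF//; [rewrite mul1r; congr (_ `^ _); field|order_lra].
  + by order_lra.
  + by rewrite pwr ?gt_eqF//; [congr (_ `^ _); field|order_lra].
- move=> x xx; rewrite mul1r subr_le0; apply: (@le_trans _ _ 0); first by apply: u0; order_lra.
  by rewrite /v /= mulr0 addr0 mulr1 mulr_ge0// ltW.
- by order_lra.
- exact: td.
Qed.

End FarBarrier.

(** * Calculus of the barriers near the origin *)

Section BarrierCalculus.
Context {R : realType}.
Implicit Types (x t : R) (w : R * R).
Variables (k g : R).
Hypothesis g0 : 0 < g.

Definition negpart x : R := Num.max 0 (- x).
Local Notation Y := negpart.
(* [gbarrier] is [A * negpart x ^ alpha * gfactor ^ (- 1 / (beta - 1))], a form without negative powers
   of [x]. *)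
Definition gfactor w : R := 1 + k * Y w.1 `^ g * w.2.
Local Notation G := gfactor.

Lemma is_derive_addl (f : R -> R) x df l : is_derive x 1 f df ->
  is_derive x 1 (fun y => l + f y) df.
Proof. by move=> d; have := is_deriveD (is_derive_cst l x 1) d; rewrite add0r. Qed.

Lemma continuous_negpart_powR (a : R) : 0 < a -> continuous (fun x => Y x `^ a).
Proof.
move=> a0 x; apply: (@continuous_comp _ _ _ (fun x : R => - x) (fun s => Num.max 0 s `^ a)).
  exact: opp_continuous.
exact: continuous_pos_powR.
Qed.

Lemma continuous_gfactor : continuous G.
Proof.
move=> w; apply: cvgD; first exact: cvg_cst.
apply: cvgM; last exact: cvg_snd.
apply: cvgM; first exact: cvg_cst.
apply: (@continuous_comp _ _ _ fst (fun x => Y x `^ g)); first exact: cvg_fst.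
exact: continuous_negpart_powR.
Qed.

Lemma continuous_powR_gt0 (a c : R) : 0 < a -> {for a, continuous (fun s : R => s `^ c)}.
Proof.
move=> a0; apply: differentiable_continuous; apply/derivable1_diffP.
by apply: derivable_powR; rewrite in_itv/= andbT.
Qed.

Lemma continuous_gfactor_powR (c : R) w : 0 < G w -> {for w, continuous (fun w => G w `^ c)}.
Proof.
move=> Gw; apply: (@continuous_comp _ _ _ G (fun s => s `^ c)); first exact: continuous_gfactor.
exact: continuous_powR_gt0.
Qed.

Lemma continuous_bterm (a c : R) w : 0 < a -> 0 < G w ->
  {for w, continuous (fun w => Y w.1 `^ a * G w `^ c)}.
Proof.
move=> a0 Gw; apply: cvgM; last exact: continuous_gfactor_powR.
apply: (@continuous_comp _ _ _ fst (fun x => Y x `^ a)); first exact: cvg_fst.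
exact: continuous_negpart_powR.
Qed.

Lemma is_derive_negpart_powR x (a : R) : x < 0 ->
  is_derive x 1 (fun x => Y x `^ a) (- (a * Y x `^ (a - 1))).
Proof.
move=> x0; have mx0 : 0 < - x by rewrite oppr_gt0.
have e0 : is_derive x 1 (fun x : R => - x) (- 1) by exact: is_deriveN.
have e1 : is_derive x 1 (fun x : R => (- x) `^ a) (- (a * (- x) `^ (a - 1))).
  by apply: (@is_derive_comp_eq _ (fun s : R => s `^ a) (fun x => - x) x _ _ _ (is_derive1_powR a mx0) e0); rewrite mulrN1.
have E : forall y, y < 0 -> Y y = - y by move=> y y0; rewrite /Y max_r// oppr_ge0 ltW.
rewrite (E x)//; apply: near_eq_is_derive e1.
by near=> y; rewrite E//; near: y; exact: lt_nbhsl.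
Unshelve. all: by end_near. Qed.

(** Writing k Y^g t as [G - 1] hides the factor Y^(g - 1), whose exponent may be negative. In this
    form the derivative is continuous across x = 0, where it vanishes because a > 1. *)
Lemma is_derive_bterm (a c : R) x t : 1 < a -> 0 < G (x, t) ->
  is_derive x 1 (fun x => Y x `^ a * G (x, t) `^ c)
    (- (Y x `^ (a - 1) * G (x, t) `^ (c - 1) * (a * G (x, t) + c * g * (G (x, t) - 1)))).
Proof.
move=> a1 Gx; have a0 : a != 0 by rewrite gt_eqF// (lt_trans ltr01).
have a10 : a - 1 != 0 by rewrite subr_eq0 gt_eqF.
have [x0|x0|x0] := ltgtP x 0.
- have y0 : 0 < Y x by rewrite /Y lt_max oppr_gt0 x0 orbT.
  have d1 := is_derive_negpart_powR a x0.
  have d2 := is_derive_negpart_powR g x0.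
  have d3 : is_derive x 1 (fun x => G (x, t)) (k * (- (g * Y x `^ (g - 1))) * t).
    rewrite /G /=; have d4 := is_derive_scale k d2.
    have d5 := is_derive_scale t d4.
    rewrite [X in is_derive _ _ X _](_ : _ = fun x => 1 + t * (k * Y x `^ g)); last first.
      by apply/funext => y /=; rewrite [t * _]mulrC.
    by rewrite mulrC; exact: is_derive_addl d5.
  have d4 := @is_derive_comp_eq _ (fun s : R => s `^ c) (fun x => G (x, t)) x _ _ _
    (is_derive1_powR c Gx) d3 erefl.
  apply: is_derive_eq; rewrite /GRing.scale/=.
  have e1 : Y x `^ a = Y x * Y x `^ (a - 1).
    by rewrite mulr_powRB1 ?(ltW y0)//; lra.
  have e2 : G (x, t) `^ c = G (x, t) * G (x, t) `^ (c - 1).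
    by rewrite -[X in _ = X * _]powRr1 ?(ltW Gx)// -powRD; [congr (_ `^ _); ring|rewrite (gt_eqF Gx) implybT].
  have e3 : G (x, t) - 1 = k * (Y x * Y x `^ (g - 1)) * t.
    by rewrite /G /= mulr_powRB1 ?(ltW y0)// addrC addKr.
  rewrite e3 e1 e2; ring.
- have Yx : Y x = 0 by rewrite /Y max_l// oppr_le0 ltW.
  rewrite Yx powR0// !mul0r oppr0.
  apply: near_eq_is_derive (is_derive_cst (0 : R) x 1).
  near=> y; rewrite /Y max_l ?powR0 ?mul0r// oppr_le0 ltW//.
  by near: y; exact: lt_nbhsr.
- have Yx : Y x = 0 by rewrite /Y x0 oppr0 maxxx.
  rewrite Yx powR0// !mul0r oppr0.
  have cf : {for 0, continuous (fun s : R => G (- s, t) `^ c)}.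
    apply: (@continuous_comp _ _ _ (fun s : R => (- s, t)) (fun w => G w `^ c)); last first.
      by rewrite oppr0 -x0; exact: continuous_gfactor_powR.
    apply: (@cvg_pair _ _ _ (nbhs (0 : R)) (nbhs (- 0 : R)) (nbhs t)); last exact: cvg_cst.
    exact: opp_continuous.
  have d0 := is_derive_pow_mul0 a1 cf.
  have d0' : is_derive (- x) 1 (fun s : R => Num.max 0 s `^ a * G (- s, t) `^ c) 0 by rewrite x0 oppr0.
  have dm : is_derive x 1 (fun x : R => - x) (- 1) by exact: is_deriveN.
  rewrite [X in is_derive _ _ X _](_ : _ = fun x => (fun s : R => Num.max 0 s `^ a * G (- s, t) `^ c) (- x)); last first.
    by apply/funext => y; rewrite opprK.
  by apply: (is_derive_comp_eq d0' dm); rewrite mul0r.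
Unshelve. all: by end_near. Qed.

Lemma is_derive_bterm_time (a c : R) x t : 0 < G (x, t) ->
  is_derive t 1 (fun t => Y x `^ a * G (x, t) `^ c)
    (Y x `^ a * (c * G (x, t) `^ (c - 1) * (k * Y x `^ g))).
Proof.
move=> Gx.
have d1 : is_derive t 1 (fun t => G (x, t)) (k * Y x `^ g).
  rewrite -[X in is_derive _ _ _ X]mulr1.
  exact: (is_derive_addl 1 (is_derive_scale (k * Y x `^ g) (is_derive_id t 1))).
apply: is_derive_scale.
exact: (@is_derive_comp_eq _ (fun s : R => s `^ c) (fun t => G (x, t)) t _ _ _
    (is_derive1_powR c Gx) d1 erefl).
Qed.

End BarrierCalculus.

Section BarrierSign.
Context {R : realType}.

(* [1 + s] stands for [gfactor]; the profile is the dependence of the diffusion term on it. *)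
Lemma continuous_profile (a c c' : R) :
  (fun s : R => (1 + s) `^ c * (a * (1 + s) + c' * s)) @ 0 --> a.
Proof.
suff : (fun s : R => (1 + s) `^ c * (a * (1 + s) + c' * s)) @ 0 --> (1 + 0) `^ c * (a * (1 + 0) + c' * 0).
  by rewrite addr0 powR1 mulr0 addr0 !mulr1 mul1r.
have c1 : (fun s : R => 1 + s) @ 0 --> (1 + 0 : R) by apply: cvgD; [exact: cvg_cst|exact: cvg_id].
apply: cvgM.
  have h : {for (1 + 0 : R), continuous (fun s : R => s `^ c)} by apply: continuous_powR_gt0; lra.
  exact: (cvg_comp _ _ c1 h).
apply: cvgD; apply: cvgM; [exact: cvg_cst|exact: c1|exact: cvg_cst|exact: cvg_id].
Qed.

Lemma profile_near (a c c' tol : R) : 0 < tol -> exists2 eta, 0 < eta <= 1 / 2 &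
  forall s, `|s| <= eta -> `|(1 + s) `^ c * (a * (1 + s) + c' * s) - a| <= tol.
Proof.
move=> tol0; have /cvgrPdist_le /(_ _ tol0) := @continuous_profile a c c'.
move=> /nbhs_ballP[e /= e0 He].
exists (Num.min (e / 2) (1 / 2)).
  by rewrite ge_min lexx orbT andbT lt_min !divr_gt0.
move=> s; rewrite le_min => /andP[se _]; rewrite distrC; apply: He.
rewrite /ball /= sub0r normrN (le_lt_trans se)//; lra.
Qed.

Lemma powR_small (sigma tol : R) : 0 < sigma -> 0 < tol -> exists2 h, 0 < h &
  forall y, 0 < y <= h -> y `^ sigma <= tol.
Proof.
move=> s0 t0; exists (tol `^ sigma^-1); first exact: powR_gt0.
move=> y /andP[y0 yh].
rewrite -[leRHS](powRr1 (ltW t0)) -(@mulVf _ sigma) ?gt_eqF// powRrM.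
by apply: ge0_ler_powR; rewrite ?nnegrE ?powR_ge0// ltW.
Qed.

(** At the critical exponent the diffusion of A (-x)_+^alpha is the right side times (-x)_+^(alpha
    beta), the same power as in the reaction. [Cstar] is the amplitude at which the coefficients
    agree: for b > 0 the profile with A = [Cstar] is stationary. *)
Lemma Cstar_identity (p b beta A : R) : 2 < p -> b != 0 -> 1 < beta -> beta < p - 1 -> 0 < A ->
  let alpha := p / (p - 1 - beta) in
  `|b| * A `^ beta * (A / Cstar p b beta) `^ (p - 1 - beta) =
  (alpha * A) `^ (p - 1) * ((alpha - 1) * (p - 1)).
Proof.
move=> p2 b0 be1 bp A0 alpha.
set rho := p - 1 - beta in alpha *.
have rho0 : 0 < rho by rewrite /rho; lra.
have p0 : 0 < p by lra.
have nb0 : 0 < `|b| by rewrite normr_gt0.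
have pp : 0 < p `^ (p - 1) by exact: powR_gt0.
have rr : 0 < rho `^ (p - 1) by exact: powR_gt0.
have rp : rho `^ p = rho * rho `^ (p - 1) by rewrite mulr_powRB1//; exact: ltW.
have CE : Cstar p b beta `^ rho = `|b| * rho `^ p / ((1 + beta) * p `^ (p - 1) * (p - 1)).
  rewrite /Cstar -/rho -powRrM div1r mulVf ?gt_eqF// powRr1//.
  by rewrite divr_ge0// ?mulr_ge0// ?powR_ge0//; lra.
have AE : A `^ (p - 1) = A `^ beta * A `^ rho.
  by rewrite -powRD; [congr (_ `^ _); rewrite /rho; ring|rewrite (gt_eqF A0) implybT].
have C0 : 0 <= Cstar p b beta by exact: powR_ge0.
have VE : (Cstar p b beta)^-1 `^ rho = (Cstar p b beta `^ rho)^-1.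
  rewrite -powR_inv1// -powRrM mulN1r.
  by rewrite powRN.
rewrite powRM ?invr_ge0// ?(ltW A0)// VE CE rp.
rewrite powRM ?(ltW A0)//; last by rewrite divr_ge0// ltW.
have -> : alpha `^ (p - 1) = p `^ (p - 1) / rho `^ (p - 1).
  rewrite /alpha powRM ?invr_ge0 ?ltW//; congr (_ * _).
  by rewrite -powR_inv1 ?ltW// -powRrM mulN1r powRN.
rewrite AE /alpha.
have -> : p / rho - 1 = (1 + beta) / rho by rewrite /rho; field; rewrite -/rho gt_eqF.
move: (A `^ beta) (A `^ rho) (p `^ (p - 1)) (rho `^ (p - 1)) pp rr => X1 X2 X3 X4 pp rr.
field.
rewrite !gt_eqF//; lra.
Qed.

(** With s = [gfactor] - 1, the signed expression is the residual of the barrier divided by nothing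
    but its sign: as v_t = - b (1 - d) v^beta, the residual v_t - (flux)_x + b v^beta equals b d
    v^beta minus the diffusion. The margin is |b| eps A^beta, since sg e = eps. *)
Lemma barrier_sign (p b beta alpha C eps e sg : R) :
  2 < p -> b != 0 -> 1 < beta -> beta < p - 1 -> p / (p - 1 - beta) <= alpha ->
  0 < C + e -> 0 < eps -> sg * sg = 1 -> e = sg * eps ->
  let A := C + e in let d := dcoef p b beta alpha C e in
  let a := (alpha - 1) * (p - 1) in let r := (beta - 1)^-1 in
  let c := - ((r + 1) * (p - 1)) in let g := alpha * (beta - 1) in
  exists eta h0, [/\ 0 < eta <= 1 / 2, 0 < h0 & forall y s, 0 < y <= h0 -> `|s| <= eta ->
    0 <= sg * (b * d * A `^ beta * (y `^ (alpha * beta) * (1 + s) `^ (- r - 1)) -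
      (alpha * A) `^ (p - 1) * (y `^ (a - 1) * (1 + s) `^ (c - 1) * (a * (1 + s) + c * g * s)))].
Proof.
move=> p2 b0 be1 bp al A0 eps0 sg1 eE A d a r c g.
have rho0 : 0 < p - 1 - beta by lra.
have alp : p <= alpha * (p - 1 - beta) by rewrite -ler_pdivrMr.
have al0 : 0 < alpha by apply: lt_le_trans al; rewrite divr_gt0//; lra.
pose B := (alpha * A) `^ (p - 1).
have B0 : 0 < B by rewrite powR_gt0 ?mulr_gt0.
(* The excess of the power of y in the diffusion over that in v^beta. It is nonnegative by the lower
   bound on [alpha] and is 0 exactly at the critical exponent. *)
pose sigma := a - 1 - alpha * beta.
have sigmaE : sigma = alpha * (p - 1 - beta) - p by rewrite /sigma /a; ring.
have Ab0 : 0 < A `^ beta by exact: powR_gt0.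
have nb0 : 0 < `|b| by rewrite normr_gt0.
pose psi s := (1 + s) `^ (c + r) * (a * (1 + s) + c * g * s).
suff [eta [h0 [etaP h00 H]]] : exists eta h0, [/\ 0 < eta <= 1 / 2, 0 < h0 &
    forall y s, 0 < y <= h0 -> `|s| <= eta -> 0 <= sg * (b * d * A `^ beta - B * (y `^ sigma * psi s))].
  exists eta, h0; split => // y s yh se.
  have s1 : 0 < 1 + s.
    by move: se etaP; rewrite ler_norml => /andP[se _] /andP[_ e2]; lra.
  case/andP: (yh) => y0 _.
  have -> : y `^ (a - 1) = y `^ (alpha * beta) * y `^ sigma.
    by rewrite -powRD; [congr (_ `^ _); rewrite /sigma; ring|rewrite (gt_eqF y0) implybT].
  have -> : (1 + s) `^ (c - 1) = (1 + s) `^ (- r - 1) * (1 + s) `^ (c + r).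
    by rewrite -powRD; [congr (_ `^ _); ring|rewrite (gt_eqF s1) implybT].
  have := mulr_ge0 (mulr_ge0 (powR_ge0 y (alpha * beta)) (powR_ge0 (1 + s) (- r - 1))) (H y s yh se).
  rewrite /psi -/B; congr (0 <= _); ring.
have sge : sg * e = eps by rewrite eE mulrA sg1 mul1r.
have nsg x : `|sg * x| = `|x|.
  have : `|sg| ^+ 2 = 1 by rewrite -normrX expr2 sg1 normr1.
  by rewrite normrM => /eqP; rewrite sqrp_eq1// => /eqP ->; rewrite mul1r.
have tol0 : 0 < `|b| * eps * A `^ beta by rewrite !mulr_gt0.
have bsg : b * Num.sg b = `|b| by rewrite mulrC normrEsg.
have [alt|ale] := boolP (p / (p - 1 - beta) < alpha).
  have dE : b * d = `|b| * e by rewrite /d /dcoef alt mulrCA bsg mulrC.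
  have sig0 : 0 < sigma by rewrite sigmaE subr_gt0 -ltr_pdivrMr.
  (* Any tolerance serves for the profile here, the smallness being that of y^sigma; at the critical
     exponent it must come from the profile itself, with a tolerance set by the margin. *)
  have [eta etaP Heta] := @profile_near a (c + r) (c * g) 1 ltr01.
  have Ba : 0 < B * (`|a| + 1) by rewrite mulr_gt0// ltr_wpDl.
  have [h0 h00 Hh] := powR_small sig0 (divr_gt0 tol0 Ba).
  exists eta, h0; split => // y s yh se.
  have h1 : `|psi s| <= `|a| + 1.
    have := Heta s se; rewrite -/(psi s) => h.
    by rewrite -[psi s](subrKC a) (le_trans (ler_normD _ _))// lerD2l.
  have h2 := Hh y yh.
  have h3 : `|sg * (B * (y `^ sigma * psi s))| <= `|b| * eps * A `^ beta.
    rewrite nsg normrM (ger0_norm (ltW B0)) normrM (ger0_norm (powR_ge0 _ _)).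
    have -> : `|b| * eps * A `^ beta = B * ((`|b| * eps * A `^ beta / (B * (`|a| + 1))) * (`|a| + 1)).
      rewrite invfM; field; rewrite gt_eqF//= gt_eqF// ltr_wpDl//.
    by rewrite ler_wpM2l ?(ltW B0)// ler_pM// powR_ge0.
  rewrite mulrBr dE.
  have -> : sg * (`|b| * e * A `^ beta) = `|b| * eps * A `^ beta by rewrite -sge; ring.
  by rewrite subr_ge0 (le_trans (ler_norm _)).
have alE : alpha = p / (p - 1 - beta).
  by apply/eqP; rewrite eq_le al andbT leNgt.
have sig0 : sigma = 0 by rewrite sigmaE alE divfK ?subrr// gt_eqF.
have dE : b * d * A `^ beta = `|b| * e * A `^ beta + B * a.
  have CI := Cstar_identity p2 b0 be1 bp A0; rewrite /= -alE in CI.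
  rewrite /B /a -CI /d /dcoef (negbTE ale) -/A.
  by rewrite [b * (_ * _)]mulrCA bsg; ring.
have [eta etaP Heta] := @profile_near a (c + r) (c * g) (`|b| * eps * A `^ beta / B) (divr_gt0 tol0 B0).
exists eta, 1; split => // y s yh se.
rewrite sig0 powRr0 mul1r dE.
have -> : sg * (`|b| * e * A `^ beta + B * a - B * psi s) =
  `|b| * eps * A `^ beta - sg * (B * (psi s - a)) by rewrite -sge; ring.
rewrite subr_ge0 (le_trans (ler_norm _))// nsg normrM (ger0_norm (ltW B0)).
by rewrite mulrC -ler_pdivlMr//; exact: Heta.
Qed.

End BarrierSign.

Section BarrierShape.
Context {R : realType}.

Lemma powR_lip (beta M x y : R) : 1 < beta -> 0 <= x <= M -> 0 <= y <= M ->
  `|x `^ beta - y `^ beta| <= beta * M `^ (beta - 1) * `|x - y|.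
Proof.
move=> b1 xM yM.
wlog xy : x y xM yM / x <= y.
  by move=> H; have [/H|/ltW /H] := leP x y; [apply|rewrite distrC [`|x - y|]distrC; apply].
move: xy; rewrite le_eqVlt => /predU1P[->|xy]; first by rewrite !subrr normr0 mulr0.
have d (s : R) : is_derive s 1 (fun s => Num.max 0 s `^ beta) (beta * Num.max 0 s `^ (beta - 1)).
  exact: is_derive_pos_powR.
have [c] := @MVT R _ _ x y xy (fun s _ => d s) (@continuous_withinT R `[x, y] _ (continuous_pos_powR (lt_trans ltr01 b1))).
rewrite in_itv/= => /andP[xc cy].
case/andP: xM => x0 xM; case/andP: yM => y0 yM.
rewrite !max_r ?(ltW (le_lt_trans x0 xc))// => E.
rewrite distrC E normrM [`|x - y|]distrC ler_wpM2r// ger0_norm; last first.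
  by rewrite mulr_ge0 ?powR_ge0//; lra.
rewrite ler_wpM2l//; first by lra.
by apply: ge0_ler_powR; rewrite ?nnegrE; lra.
Qed.

(** For x < 0 the first term of [gbase] is taken out as a factor: what remains is [gfactor], and the
    exponent 1 / (1 - beta) turns the factor into (C + e) |x|^alpha. For x >= 0 both sides are 0. *)
Lemma gbarrierE (p b beta alpha C e x t : R) : 1 < beta -> 0 < C + e -> 0 < alpha ->
  let k := b * (beta - 1) * (1 - dcoef p b beta alpha C e) * (C + e) `^ (beta - 1) in
  let g := alpha * (beta - 1) in
  0 < gfactor k g (x, t) ->
  (x < 0 -> 0 < gbase p b beta alpha C e x t) /\
  gbarrier p b beta alpha C e x t =
    (C + e) * (negpart x `^ alpha * gfactor k g (x, t) `^ (- (beta - 1)^-1)).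
Proof.
move=> b1 A0 al0 k g G0; rewrite /gbarrier.
pose A := C + e; rewrite -/A in A0 *.
have [x0|x0] := ltP x 0; last first.
  by split => //; rewrite /negpart max_l ?oppr_le0// powR0 ?gt_eqF// mul0r mulr0.
have y0 : 0 < - x by rewrite oppr_gt0.
have Yx : negpart x = - x by rewrite /negpart max_r// ltW.
have be0 : beta - 1 != 0 by rewrite subr_eq0 gt_eqF.
have be0' : 1 - beta != 0 by rewrite subr_eq0 lt_eqF.
have E : gbase p b beta alpha C e x t = A `^ (1 - beta) * (- x) `^ (- g) * gfactor k g (x, t).
  rewrite /gbase -/A ltr0_norm// /gfactor /= Yx.
  have -> : alpha * (1 - beta) = - g by rewrite /g; ring.
  rewrite [RHS]mulrDr mulr1; congr (_ + _); rewrite /k -/A.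
  have e1 : A `^ (1 - beta) * A `^ (beta - 1) = 1.
    by rewrite -powRD ?(gt_eqF A0) ?implybT// (_ : 1 - beta + (beta - 1) = 0) ?powRr0//; ring.
  have e2 : (- x) `^ (- g) * (- x) `^ g = 1.
    by rewrite -powRD ?(gt_eqF y0) ?implybT// addNr powRr0.
  set K := b * _ * _.
  have -> : A `^ (1 - beta) * (- x) `^ (- g) * (K * A `^ (beta - 1) * (- x) `^ g * t) =
    (A `^ (1 - beta) * A `^ (beta - 1)) * ((- x) `^ (- g) * (- x) `^ g) * (K * t) by ring.
  by rewrite e1 e2 !mul1r.
split=> [_|]; first by rewrite E !mulr_gt0 ?powR_gt0.
rewrite E Yx powRM ?mulr_ge0 ?powR_ge0 ?ltW// powRM ?powR_ge0// -!powRrM.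
rewrite (_ : (1 - beta) * (1 / (1 - beta)) = 1); last by field.
rewrite (_ : - g * (1 / (1 - beta)) = alpha); last by rewrite /g; field.
rewrite (_ : 1 / (1 - beta) = - (beta - 1)^-1); last by field; rewrite be0.
by rewrite powRr1 ?mulrA// ltW.
Qed.

End BarrierShape.

Section NearComparison.
Context {R : realType}.

Lemma flux_bterm (p m a c y G : R) : 2 < p -> 0 <= m ->
  flux p (- (m * (y `^ a * G `^ c))) = - (m `^ (p - 1) * (y `^ (a * (p - 1)) * G `^ (c * (p - 1)))).
Proof.
move=> p2 m0; rewrite fluxN flux_ge0// ?mulr_ge0 ?powR_ge0//.
by rewrite !powRM ?mulr_ge0 ?powR_ge0// -!powRrM.
Qed.

(** Passes from the sign of the barrier's residual, with D = v_t - F_x, to the inequality required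
    by [weak_comparison]: the reaction at the barrier is exchanged for that at the solution at the
    cost of the Lipschitz constant of the power on [[0, M]]. *)
Lemma reaction_lip (b beta M sg x y D : R) : 1 < beta -> sg * sg = 1 -> 0 <= x <= M -> 0 <= y <= M ->
  0 <= sg * (D + b * y `^ beta) -> 0 < sg * (x - y) ->
  sg * (- (b * x `^ beta) - D) <= `|b| * (beta * M `^ (beta - 1)) * (sg * (x - y)).
Proof.
move=> b1 sg1 xM yM D0 xy.
have lip := powR_lip b1 xM yM.
have sgn z : `|sg * z| = `|z|.
  have : `|sg| ^+ 2 = 1 by rewrite -normrX expr2 sg1 normr1.
  by rewrite normrM => /eqP; rewrite sqrp_eq1// => /eqP ->; rewrite mul1r.
have h1 : - (sg * (b * (x `^ beta - y `^ beta))) <= `|b| * (beta * M `^ (beta - 1)) * (sg * (x - y)).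
  rewrite (le_trans (ler_norm _))// normrN sgn normrM -mulrA ler_wpM2l//.
  by rewrite -(ger0_norm (ltW xy)) sgn.
apply: le_trans h1; rewrite -subr_ge0.
by move: D0; congr (0 <= _); ring.
Qed.

(** On the side x = - h the initial inequality is strict and persists for a short time by
    continuity; on the side x = 1 solution and barrier both vanish. The threshold [h0] precedes [h]
    so that the upper and the lower barrier can share one [h], while the time [d0] depends on
    [h]. *)
Lemma near_comparison (p b beta alpha C eps e sg M T1 h1 : R) T (u : R -> R -> R) :
  2 < p -> b != 0 -> 1 < beta -> beta < p - 1 -> p / (p - 1 - beta) <= alpha ->
  0 < C + e -> 0 < eps -> sg * sg = 1 -> e = sg * eps ->
  weak_solution p b beta T u ->
  {within half_open_strip T, continuous (fun z : R * R => u z.1 z.2)} ->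
  0 < T1 -> (T1%:E < T)%E -> 0 <= M ->
  (forall x t, -1 <= x <= 1 -> 0 <= t <= T1 -> 0 <= u x t <= M) ->
  (forall t, 0 <= t <= T1 -> u 1 t = 0) ->
  (forall x, 0 <= x <= 1 -> u x 0 = 0) ->
  0 < h1 -> (forall x, - h1 <= x < 0 -> 0 < sg * ((C + e) * (- x) `^ alpha - u x 0)) ->
  exists2 h0, 0 < h0 & forall h, 0 < h <= h0 ->
  exists d0, [/\ 0 < d0, d0 <= T1 & forall x t, - h <= x <= 1 -> 0 <= t <= d0 ->
    (x < 0 -> 0 < gbase p b beta alpha C e x t) /\
    sg * (u x t - gbarrier p b beta alpha C e x t) <= 0].
Proof.
move=> p2 b0 be1 bp al A0 eps0 sg1 eE wu cu T10 T1T M0 uM u1 u0 h10 ini.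
have rho0 : 0 < p - 1 - beta by order_lra.
have al1 : 1 < alpha by apply: lt_le_trans al; rewrite ltr_pdivlMr//; order_lra.
have al0 : 0 < alpha by order_lra.
have [eta [h0 [etaP h00]]] := barrier_sign p2 b0 be1 bp al A0 eps0 sg1 eE.
have [k kE] : exists k, k = b * (beta - 1) * (1 - dcoef p b beta alpha C e) * (C + e) `^ (beta - 1) by exists (b * (beta - 1) * (1 - dcoef p b beta alpha C e) * (C + e) `^ (beta - 1)).
have [A AE] : exists A, A = C + e by exists (C + e).
have [a aE] : exists a, a = (alpha - 1) * (p - 1) by exists ((alpha - 1) * (p - 1)).
have [r rE] : exists r, r = (beta - 1)^-1 by exists (beta - 1)^-1.
have [c cE] : exists c, c = - ((r + 1) * (p - 1)) by exists (- ((r + 1) * (p - 1))).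
have [g gE] : exists g, g = alpha * (beta - 1) by exists (alpha * (beta - 1)).
rewrite -AE -rE -cE -aE -gE => bs.
rewrite -AE in A0 ini.
have be0 : beta - 1 != 0 by rewrite subr_eq0 gt_eqF.
have g0 : 0 < g by rewrite gE mulr_gt0// subr_gt0.
have r0 : 0 < r by rewrite rE invr_gt0 subr_gt0.
have rg : r * g = alpha by rewrite rE gE; field.
have rb : - r * beta = - r - 1 by rewrite rE; field.
(* The flux of the barrier behaves like Y^a, and a > 1 makes it differentiable across x = 0 with a
   continuous derivative. *)
have a1 : 1 < a.
  have : p <= alpha * (p - 1 - beta) by rewrite -ler_pdivrMr.
  have := mulr_gt0 al0 (lt_trans ltr01 be1).
  rewrite aE => ? ?; have -> : (alpha - 1) * (p - 1) = alpha * (p - 1 - beta) - p + 1 + alpha * beta by ring.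
  order_lra.
pose G := gfactor k g.
pose v w := A * (negpart w.1 `^ alpha * G w `^ (- r)).
pose vx w := - (alpha * A * (negpart w.1 `^ (alpha - 1) * G w `^ (- r - 1))).
pose vt w := A * (negpart w.1 `^ alpha * (- r * G w `^ (- r - 1) * (k * negpart w.1 `^ g))).
pose Fx w := (alpha * A) `^ (p - 1) * (negpart w.1 `^ (a - 1) * G w `^ (c - 1) * (a * G w + c * g * (G w - 1))).
have G_0 x : G (x, 0) = 1 by rewrite /G /gfactor /= mulr0 addr0.
exists (Num.min 1 (Num.min h0 h1)); first by rewrite !lt_min ltr01 h00 h10.
move=> h /andP[hh0]; rewrite !le_min => /andP[hle1 /andP[hleh0 hleh1]].
have Y01 x : - h <= x -> 0 <= negpart x <= h.
  move=> hx; rewrite /negpart le_max lexx /= ge_max (ltW hh0) /=; order_lra.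
(* A common bound for the solution and the barrier, the latter because [negpart] is at most 1 and
   [gfactor] at least 1/2 on the window; it fixes the Lipschitz constant [L]. *)
have [M2 M2E] : exists M2, M2 = M + A * (1 / 2) `^ (- r) by exists (M + A * (1 / 2) `^ (- r)).
have M20 : 0 <= A * (1 / 2) `^ (- r) by rewrite mulr_ge0 ?powR_ge0// ltW.
have [L LE] : exists L, L = `|b| * (beta * M2 `^ (beta - 1)) by exists (`|b| * (beta * M2 `^ (beta - 1))).
have L0 : 0 <= L by rewrite LE !mulr_ge0 ?powR_ge0//; order_lra.
have [dl dl0 Hdl] : exists2 dl, 0 < dl & forall t, 0 <= t <= dl -> t <= T1 -> 0 <= sg * (v (- h, t) - u (- h) t).
  have cu' : {within [set w : R * R | -1 <= w.1 <= 1 /\ 0 <= w.2 <= T1], continuous (fun z : R * R => u z.1 z.2)}.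
    apply: continuous_subspaceW cu => -[x t] [/= _ /andP[t0 td]]; split => //=.
    by apply: le_lt_trans T1T; rewrite lee_fin.
  have m11 : -1 <= 1 :> R by order_lra.
  have cU := clamp2_continuous m11 (ltW T10) cu'.
  have UE t : 0 <= t <= T1 -> ((fun z : R * R => u z.1 z.2) \o clamp2 (-1) 1 0 T1) (- h, t) = u (- h) t.
    by move=> tt; rewrite [LHS]/comp clamp2_id//; order_lra.
  set U := _ \o _ in cU UE.
  have cF : {for 0, continuous (fun t => sg * (v (- h, t) - U (- h, t)))}.
    apply: cvgM; first exact: cvg_cst.
    apply: cvgB; last exact: continuous_sect1 cU _.
    apply: cvgM; first exact: cvg_cst.
    have cp : (- h, s) @[s --> (0 : R)] --> (- h, 0 : R).
      by apply: (@cvg_pair _ _ _ (nbhs (0 : R)) (nbhs (- h)) (nbhs (0 : R))); [exact: cvg_cst|exact: cvg_id].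
    have G00 : 0 < gfactor k g (- h, 0) by rewrite -/G G_0.
    have cb : {for (- h, 0 : R), continuous (fun w => negpart w.1 `^ alpha * G w `^ (- r))} by exact: continuous_bterm.
    exact: (cvg_comp _ _ cp cb).
  have F0 : 0 < sg * (v (- h, 0) - U (- h, 0)).
    rewrite UE ?lexx ?(ltW T10)//.
    rewrite /v G_0 powR1 mulr1 /= /negpart opprK max_r ?(ltW hh0)//.
    have hx : - h1 <= - h < 0 by order_lra.
    by have := ini (- h) hx; rewrite opprK.
  have /cvgrPdist_lt /(_ _ F0) /nbhs_ballP[d /= d0 Hd] := cF.
  exists (d / 2); first by rewrite divr_gt0.
  move=> t /andP[t0 td] tT.
  have tb : ball (0 : R) d t by rewrite /ball /= sub0r normrN ger0_norm//; order_lra.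
  have := Hd t tb; rewrite /= (UE t) ?t0//.
  by rewrite ltr_norml => /andP[_]; rewrite ltrBlDr ltrDl => /ltW.
(* As h <= 1, the bound [|k| * d0 <= eta] keeps [gfactor] within [eta] of 1, the range of
   [barrier_sign]. *)
have [d0 [d00 d0T d0l d0e d0L]] : exists d0, [/\ 0 < d0, d0 <= T1, d0 <= dl, `|k| * d0 <= eta & 3 * L * d0 < 1].
  case/andP: etaP => eta0 _.
  have i1 : 0 < eta / (`|k| + 1) by rewrite divr_gt0// ltr_wpDl.
  have i2 : 0 < (6 * (L + 1))^-1 by rewrite invr_gt0; order_lra.
  exists (Num.min (Num.min T1 dl) (Num.min (eta / (`|k| + 1)) (6 * (L + 1))^-1)); split.
  - by rewrite !lt_min T10 dl0 i1.
  - by rewrite !ge_min lexx.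
  - by rewrite !ge_min lexx orbT.
  - apply: (@le_trans _ _ (`|k| * (eta / (`|k| + 1)))).
      by rewrite ler_wpM2l// !ge_min lexx !orbT.
    by rewrite mulrCA ler_piMr ?(ltW eta0)// ler_pdivrMr ?mul1r ?lerDl// ltr_wpDl.
  - apply: (@le_lt_trans _ _ (3 * L * (6 * (L + 1))^-1)); last by rewrite ltr_pdivrMr; order_lra.
    by rewrite ler_wpM2l ?mulr_ge0// !ge_min lexx !orbT.
exists d0; split => //.
have Gs x t : - h <= x -> 0 <= t <= d0 -> `|G (x, t) - 1| <= eta.
  move=> hx /andP[t0 td]; have /andP[y0 yh] := Y01 x hx.
  rewrite /G /gfactor /= addrC addKr !normrM (ger0_norm t0) (ger0_norm (powR_ge0 _ _)).
  apply: le_trans d0e; apply: ler_pM; [by rewrite mulr_ge0 ?powR_ge0|by []| |by []].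
  rewrite ler_piMr//; apply: (@le_trans _ _ (1 `^ g)); last by rewrite powR1.
  by apply: ge0_ler_powR; [exact: ltW|rewrite nnegrE|rewrite nnegrE|exact: le_trans yh hle1].
have G12 x t : - h <= x -> 0 <= t <= d0 -> 1 / 2 <= G (x, t).
  move=> hx tt; have := Gs x t hx tt; case/andP: etaP => _ e2; rewrite ler_norml => /andP[e3 _].
  by move: e3 e2; clear; move: (G (x, t)) => z; order_lra.
have Gp x t : - h <= x -> 0 <= t <= d0 -> 0 < G (x, t).
  by move=> hx tt; apply: lt_le_trans (G12 x t hx tt).
suff H x t : - h <= x <= 1 -> 0 <= t <= d0 -> sg * (u x t - v (x, t)) <= 0.
  move=> x t xx tt; have hx : - h <= x by case/andP: xx.
  have Gx := Gp x t hx tt; rewrite /G gE kE in Gx.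
  have A0' := A0; rewrite AE in A0'.
  have [h2 ->] := gbarrierE be1 A0' al0 Gx.
  by split => //; have := H x t xx tt; rewrite /v /G kE -AE -rE -gE.
move: x t.
have nsg : `|sg| = 1 by apply/eqP; rewrite -sqrp_eq1// -normrX expr2 sg1 normr1.
have dT : (d0%:E < T)%E by apply: le_lt_trans T1T; rewrite lee_fin.
have m1 x : - h <= x <= 1 -> -1 <= x <= 1 by move=> /andP[? ->]; rewrite andbT; order_lra.
have Yr x : 0 <= x -> negpart x = 0 by move=> x0; rewrite /negpart max_l// oppr_le0.
have vr x t : 0 <= x -> v (x, t) = 0.
  by move=> x0; rewrite /v /= Yr// powR0 ?gt_eqF// mul0r mulr0.
have vM x t : - h <= x -> 0 <= t <= d0 -> 0 <= v (x, t) <= M2.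
  move=> hx tt; rewrite /v !mulr_ge0 ?powR_ge0 ?(ltW A0)//= M2E.
  apply: (@le_trans _ _ (A * (1 / 2) `^ (- r))); last by rewrite lerDr.
  rewrite ler_wpM2l ?(ltW A0)//.
  rewrite -[leRHS]mul1r; apply: ler_pM; rewrite ?powR_ge0//.
    have /andP[y0 yh] := Y01 x hx.
    apply: (@le_trans _ _ (1 `^ alpha)); last by rewrite powR1.
    by apply: ge0_ler_powR; [exact: ltW|rewrite nnegrE|rewrite nnegrE|exact: le_trans yh hle1].
  have g12 := G12 x t hx tt.
  have Gx := Gp x t hx tt.
  have h2 : 0 < 1 / 2 :> R by order_lra.
  rewrite !powRN lef_pV2 ?posrE ?powR_gt0//.
  by apply: ge0_ler_powR; [exact: ltW|by rewrite nnegrE ltW|by rewrite nnegrE ltW|].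
have inr w : rect (- h) 1 d0 w -> 0 < G w by case: w => x t [/= /andP[hx _] tt]; exact: Gp.
have crect (f : R * R -> R) : (forall w, 0 < G w -> {for w, continuous f}) -> {within rect (- h) 1 d0, continuous f}.
  move=> cf; apply/subspace_continuousP => w /inr Gw.
  by apply: cvg_within_filter; exact: cf.
have cG := @continuous_gfactor R k g g0.
have ag0 : 0 < alpha - 1 by order_lra.
have aa0 : 0 < a - 1 by order_lra.
move=> x t xx tt.
apply: (@weak_comparison R p b beta T u (- h) 1 d0 sg L v vx vt Fx p2 (lt_trans ltr01 be1) wu cu _ d00 dT L0 d0L nsg).
- by order_lra.
- apply: crect => w Gw; apply: cvgM; first exact: cvg_cst.
  exact: continuous_bterm.
- apply: crect => w Gw; apply: cvgN; apply: cvgM; first exact: cvg_cst.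
  exact: continuous_bterm.
- apply: crect => w Gw; apply: cvgM; first exact: cvg_cst.
  apply: cvgM.
    apply: (@continuous_comp _ _ _ fst (fun x => negpart x `^ alpha)); first exact: cvg_fst.
    exact: continuous_negpart_powR.
  apply: cvgM.
    by apply: cvgM; [exact: cvg_cst|exact: continuous_gfactor_powR].
  apply: cvgM; first exact: cvg_cst.
  apply: (@continuous_comp _ _ _ fst (fun x => negpart x `^ g)); first exact: cvg_fst.
  exact: continuous_negpart_powR.
- apply: crect => w Gw; apply: cvgM; first exact: cvg_cst.
  apply: cvgM; first exact: continuous_bterm.
  apply: cvgD; apply: cvgM; [exact: cvg_cst|exact: cG|exact: cvg_cst|].
  by apply: cvgB; [exact: cG|exact: cvg_cst].
- move=> z s zz ss.
  have ss' : 0 <= s <= d0 by case/andP: ss => /ltW -> ->.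
  have Gz : 0 < G (z, s) by apply: Gp => //; case/andP: zz => /ltW.
  split.
    have := is_derive_scale A (@is_derive_bterm R k g g0 alpha (- r) z s al1 Gz).
    rewrite /v /vx /=; congr (is_derive _ _ _ _).
    have -> : alpha * gfactor k g (z, s) + - r * g * (gfactor k g (z, s) - 1) = alpha by rewrite mulNr rg; ring.
    rewrite -/G; ring.
  have := is_derive_scale (- (alpha * A) `^ (p - 1)) (@is_derive_bterm R k g g0 a c z s a1 Gz).
  rewrite mulrNN => D; rewrite (_ : (fun z => _) = fun z => - (alpha * A) `^ (p - 1) * (negpart z `^ a * gfactor k g (z, s) `^ c))//.
  apply/funext => y; rewrite /vx /= flux_bterm//; last by rewrite mulr_ge0// ltW.
  rewrite mulNr aE cE; congr (- (_ * (_ * _ `^ _))); ring.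
- move=> z s zz ss.
  have ss' : 0 <= s <= d0 by case/andP: ss => /ltW -> /ltW ->.
  have Gz : 0 < G (z, s) by apply: Gp => //; case/andP: zz => /ltW.
  exact: (is_derive_scale A (@is_derive_bterm_time R k g alpha (- r) z s Gz)).
- move=> z s zz ss uv; rewrite LE.
  have ss' : 0 <= s <= d0 by case/andP: ss => /ltW -> ->.
  have hz : - h <= z by case/andP: zz.
  have sT : 0 <= s <= T1 by case/andP: ss' => ->; move/le_trans; apply.
  apply: (reaction_lip be1 sg1 _ (vM z s hz ss')) => //.
    have /andP[-> uz] := uM z s (m1 z zz) sT.
    by rewrite (le_trans uz)// M2E lerDl.
  (* To the right of the origin every term of the residual is a positive power of 0. *)
  have [z0|z0] := leP 0 z.
    rewrite vr// /vt /Fx /= Yr// !powR0 ?gt_eqF//; last by order_lra.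
    by rewrite !(mul0r, mulr0) subr0 addr0 mulr0.
  have y0 : 0 < negpart z <= h0.
    have /andP[_ yh] := Y01 z hz; rewrite (le_trans yh hleh0) andbT.
    by rewrite /negpart lt_max oppr_gt0 z0 orbT.
  have := bs _ _ y0 (Gs z s hz ss').
  rewrite (addrC 1) subrK; congr (0 <= sg * _).
  have Gz : 0 < G (z, s) by exact: Gp.
  have vb : v (z, s) `^ beta = A `^ beta * (negpart z `^ (alpha * beta) * G (z, s) `^ (- r - 1)).
    by rewrite /v powRM ?mulr_ge0 ?powR_ge0 ?(ltW A0)// powRM ?powR_ge0// -!powRrM rb.
  have e1 : negpart z `^ (alpha * beta) = negpart z `^ alpha * negpart z `^ g.
    case/andP: y0 => y0 _; rewrite -powRD; last by rewrite (gt_eqF y0) implybT.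
    by congr (_ `^ _); rewrite gE; ring.
  have e2 : A * (r * k) = b * (1 - dcoef p b beta alpha C e) * A `^ beta.
    have -> : A `^ beta = A * A `^ (beta - 1) by rewrite mulr_powRB1// ?(ltW A0)//; order_lra.
    by rewrite kE rE -AE; field.
  rewrite vb /vt /Fx /= -/G e1.
  have -> : A * (negpart z `^ alpha * (- r * G (z, s) `^ (- r - 1) * (k * negpart z `^ g))) =
    - (A * (r * k)) * (negpart z `^ alpha * negpart z `^ g * G (z, s) `^ (- r - 1)) by ring.
  rewrite e2; ring.
- move=> s ss.
  have ss' : 0 <= s <= d0 by case/andP: ss => /ltW -> ->.
  have sT : 0 <= s <= T1 by case/andP: ss' => ->; move/le_trans; apply.
  split; last by rewrite u1// vr// subrr mulr0.
  rewrite -oppr_ge0 -mulrN opprB; apply: Hdl; last by case/andP: sT.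
  by case/andP: ss' => -> /le_trans; apply.
- move=> z zz; have [z0|z0] := leP 0 z.
    by rewrite vr// u0 ?subrr ?mulr0//; case/andP: zz => _ ->; rewrite z0.
  rewrite /v G_0 powR1 mulr1 -oppr_ge0 -mulrN opprB ltW//.
  have -> : negpart (z, 0).1 = - z by rewrite /negpart /= max_r// oppr_ge0 ltW.
  by apply: ini; rewrite z0 andbT; case/andP: zz => hz _; order_lra.
- exact: xx.
- exact: tt.
Qed.

End NearComparison.

(** * Growth classes, initial data and conclusion *)

Section Assembly.
Context {R : realType}.

(** Merges the two growth classes into the hypotheses of [far_vanishing]. For bounded u the reaction
    is at most |b| M^(beta - 1) u, with M a bound of u; for b >= 0 its sign is favourable and
    [Lam = 0]. *)
Lemma growth_bound (p b beta : R) (T : \bar R) (u0 : R -> R) (u : R -> R -> R) (T1 : R) :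
  2 < p -> 1 < beta -> growth_class p b T u0 u -> 0 < T1 -> (T1%:E < T)%E ->
  (forall x t, 0 <= t <= T1 -> 0 <= u x t) ->
  exists K Lam : R, [/\ 0 <= K, 0 <= Lam,
    forall x t, 0 <= t <= T1 -> u x t <= K * (1 + `|x|) `^ (p / (p - 2)) &
    forall x t, 0 < t <= T1 -> - (b * u x t `^ beta) <= Lam * u x t].
Proof.
move=> p2 b1 gr T10 T1T u0le.
have q0 : 0 <= p / (p - 2) by rewrite divr_ge0//; order_lra.
have x1 (x : R) : 1 <= 1 + `|x| by rewrite lerDl.
case: gr => [[_ /(_ T1 T10 T1T) [M HM]]|[b0 [K [ga [K0 gaP _ /(_ T1 T10 T1T) [K' HK]]]]]].
  exists (Num.max 0 M), (`|b| * Num.max 0 M `^ (beta - 1)).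
  have M0 : 0 <= Num.max 0 M by rewrite le_max lexx.
  have uM x t : 0 <= t <= T1 -> u x t <= Num.max 0 M.
    by move=> tt; rewrite le_max (HM x t tt) orbT.
  split => //; first by rewrite mulr_ge0 ?powR_ge0.
    move=> x t tt; rewrite (le_trans (uM x t tt))// ler_peMr//.
    apply: (@le_trans _ _ (1 `^ (p / (p - 2)))); first by rewrite powR1.
    by apply: ge0_ler_powR; rewrite ?nnegrE// (le_trans ler01).
  move=> x t /andP[t0 tT]; have tt : 0 <= t <= T1 by rewrite ltW.
  have u0' := u0le x t tt.
  rewrite -mulNr -(@mulr_powRB1 _ (u x t) beta)//; last by order_lra.
  rewrite [leLHS]mulrCA [leRHS]mulrC ler_wpM2l//.
  apply: (@le_trans _ _ (`|b| * u x t `^ (beta - 1))).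
    by rewrite ler_wpM2r ?powR_ge0// -normrN ler_norm.
  rewrite ler_wpM2l//; apply: ge0_ler_powR; rewrite ?nnegrE//; first by order_lra.
  exact: uM.
exists `|K'|, 0; split => //.
  move=> x t tt; rewrite (le_trans (HK x t tt))//.
  apply: (@le_trans _ _ (`|K'| * (1 + `|x|) `^ ga)).
    by rewrite ler_wpM2r ?powR_ge0// ler_norm.
  rewrite ler_wpM2l//; apply: ler_powR; first exact: x1.
  by case/andP: gaP => _ /ltW.
by move=> x t _; rewrite mul0r oppr_le0 mulr_ge0 ?powR_ge0.
Qed.

Lemma ereal_lt_mid (T : \bar R) : (0 < T)%E -> exists2 T1 : R, 0 < T1 & (T1%:E < T)%E.
Proof.
case: T => [r| |]//.
- by rewrite lte_fin => r0; exists (r / 2); [rewrite divr_gt0|rewrite lte_fin; lra].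
- by move=> _; exists 1 => //; rewrite ltry.
Qed.

Lemma support_vanishing (u0 : R -> R) : (forall x, 0 <= u0 x) -> continuous u0 ->
  ereal_sup [set x%:E | x in [set x : R | 0 < u0 x]] = 0%E -> forall x, 0 <= x -> u0 x = 0.
Proof.
move=> u00 cu sup0.
have pos x : 0 < x -> u0 x = 0.
  move=> x0; apply/eqP; rewrite eq_le u00 andbT leNgt; apply/negP => ux.
  have : (x%:E <= 0)%E by rewrite -sup0; apply: ereal_sup_ubound; exists x.
  by rewrite lee_fin leNgt x0.
move=> x; rewrite le_eqVlt => /predU1P[<-|]; last exact: pos.
apply/eqP; rewrite eq_le u00 andbT.
have lim : u0 x @[x --> 0^'+] --> u0 0 by apply: cvg_at_right_filter; exact: cu.
apply: (cvgr_to_le lim); apply: filterS (nbhs_right_gt 0) => y y0.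
by rewrite pos.
Qed.

Lemma initial_bounds (u0 : R -> R) (C alpha eps : R) : 0 < C -> 0 < eps ->
  u0 x / (C * (- x) `^ alpha) @[x --> 0^'-] --> (1 : R) ->
  exists2 h, 0 < h & forall x, - h <= x < 0 ->
    (C - eps) * (- x) `^ alpha < u0 x < (C + eps) * (- x) `^ alpha.
Proof.
move=> C0 e0 lim.
have eC : 0 < eps / C by rewrite divr_gt0.
have /cvgrPdist_lt /(_ _ eC) := lim.
rewrite near_withinE => /nbhs_ballP[d /= d0 Hd].
exists (d / 2); first by rewrite divr_gt0.
move=> x /andP[xd x0].
have bx : ball (0 : R) d x by rewrite /ball /= sub0r normrN ltr0_norm//; lra.
have := Hd x bx x0.
have y0 : 0 < (- x) `^ alpha by rewrite powR_gt0// oppr_gt0.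
have W0 : 0 < C * (- x) `^ alpha by exact: mulr_gt0.
set w := (- x) `^ alpha in y0 W0 *.
rewrite distrC ltr_norml => /andP[h1 h2].
have e1 : u0 x = u0 x / (C * w) * (C * w) by rewrite divfK ?gt_eqF.
have e2 : eps / C * (C * w) = eps * w by field; rewrite gt_eqF.
apply/andP; split.
  have : (1 - eps / C) * (C * w) < u0 x / (C * w) * (C * w) by rewrite ltr_pM2r//; lra.
  by rewrite -e1 mulrBl mul1r e2 -mulrBl.
have : u0 x / (C * w) * (C * w) < (1 + eps / C) * (C * w) by rewrite ltr_pM2r//; lra.
by rewrite -e1 mulrDl mul1r e2 -mulrDl.
Qed.

End Assembly.

Theorem mainTheorem7 (R : realType) (p b beta alpha C : R) (T : \bar R)
    (u0 : R -> R) (u : R -> R -> R) :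
  2 < p -> b != 0 -> 1 < beta -> beta < p - 1 ->
  p / (p - 1 - beta) <= alpha -> 0 < C -> (0 < T)%E ->
  (forall x : R, 0 <= u0 x) -> continuous u0 ->
  ereal_sup [set x%:E | x in [set x : R | 0 < u0 x]] = 0%E ->
  u0 x / (C * (- x) `^ alpha) @[x --> 0^'-] --> (1 : R) ->
  cauchy_solution p b beta T u0 u ->
  growth_class p b T u0 u ->
  forall eps : R, 0 < eps < C ->
  exists x_eps delta_eps : R,
    [/\ x_eps < 0, 0 < delta_eps, (delta_eps%:E < T)%E,
        (forall e x t : R, (e = eps \/ e = - eps) ->
           x_eps <= x < 0 -> 0 <= t <= delta_eps ->
           0 < gbase p b beta alpha C e x t) &
        forall x t : R, x_eps <= x -> 0 <= t <= delta_eps ->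
          gbarrier p b beta alpha C (- eps) x t <= u x t /\
          u x t <= gbarrier p b beta alpha C eps x t].
Proof.
move=> p2 b0 be1 bp al C0 T0 u00 cu0 sup0 lim [wu cu ui] gr eps /andP[eps0 epsC].
have [T2 T20 T2T] := ereal_lt_mid T0.
have u_ge0 x t : 0 <= t <= T2 -> 0 <= u x t.
  case/andP; rewrite le_eqVlt => /predU1P[<- _|t0 tT]; first by rewrite ui.
  case: wu => _ wu0 _ _; apply: wu0 => //.
  by apply: le_lt_trans T2T; rewrite lee_fin.
have uz := support_vanishing u00 cu0 sup0.
have [K [Lam [K0 Lam0 uK uL]]] := growth_bound p2 be1 gr T20 T2T u_ge0.
have uz' x : 0 <= x -> u x 0 <= 0 by move=> x0; rewrite ui uz.
(* Up to [T1] the solution vanishes on x >= 1, which supplies the lateral value at x = 1 and the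
   bounds of the theorem beyond it. *)
have [T1 [T10 T12 far]] := far_vanishing p2 (lt_trans ltr01 be1) wu cu T20 T2T K0 Lam0 uK uL uz'.
have T1T : (T1%:E < T)%E by apply: le_lt_trans T2T; rewrite lee_fin.
have u_ge0' x t : 0 <= t <= T1 -> 0 <= u x t.
  by move=> /andP[t0 tT]; apply: u_ge0; rewrite t0 (le_trans tT).
have far0 x t : 1 <= x -> 0 <= t <= T1 -> u x t = 0.
  by move=> x1 tt; apply/eqP; rewrite eq_le u_ge0' ?far.
have [M M0 uM] : exists2 M, 0 <= M & forall x t, -1 <= x <= 1 -> 0 <= t <= T1 -> 0 <= u x t <= M.
  have cu' : {within [set w : R * R | -1 <= w.1 <= 1 /\ 0 <= w.2 <= T1], continuous (fun z : R * R => u z.1 z.2)}.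
    apply: continuous_subspaceW cu => -[x t] [/= _ /andP[t0 td]]; split => //=.
    by apply: le_lt_trans T1T; rewrite lee_fin.
  have m11 : -1 <= 1 :> R by order_lra.
  have [M M0 HM] := box_bounded (-1) 1 0 T1 (clamp2_continuous m11 (ltW T10) cu').
  exists M => // x t xx tt; rewrite u_ge0'//=.
  by have := HM x t xx tt; rewrite [X in `|X|]/comp clamp2_id//=; apply: le_trans; exact: ler_norm.
have [h1 h10 ini] := initial_bounds C0 eps0 lim.
have u1 t : 0 <= t <= T1 -> u 1 t = 0 by exact: far0.
have ui0 x : 0 <= x <= 1 -> u x 0 = 0 by move=> /andP[x0 _]; rewrite ui uz.
have s1 : 1 * 1 = 1 :> R by rewrite mulr1.
have s2 : -1 * -1 = 1 :> R by rewrite mulrNN mulr1.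
have e1 : eps = 1 * eps by rewrite mul1r.
have e2 : - eps = -1 * eps by rewrite mulN1r.
have A1 : 0 < C + eps by order_lra.
have A2 : 0 < C + - eps by order_lra.
have i1 x : - h1 <= x < 0 -> 0 < 1 * ((C + eps) * (- x) `^ alpha - u x 0).
  by move=> /ini /andP[_ h]; rewrite mul1r subr_gt0 ui.
have i2 x : - h1 <= x < 0 -> 0 < -1 * ((C + - eps) * (- x) `^ alpha - u x 0).
  by move=> /ini /andP[h _]; rewrite mulN1r oppr_gt0 subr_lt0 ui.
have [hp hp0 Hp] := near_comparison p2 b0 be1 bp al A1 eps0 s1 e1 wu cu T10 T1T M0 uM u1 ui0 h10 i1.
have [hm hm0 Hm] := near_comparison p2 b0 be1 bp al A2 eps0 s2 e2 wu cu T10 T1T M0 uM u1 ui0 h10 i2.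
have h0 : 0 < Num.min hp hm by rewrite lt_min hp0.
have [] := Hp (Num.min hp hm); first by rewrite h0 ge_min lexx.
move=> dp [dp0 dpT Hdp].
have [] := Hm (Num.min hp hm); first by rewrite h0 ge_min lexx orbT.
move=> dm [dm0 dmT Hdm].
move: h0 Hdp Hdm; set h := Num.min hp hm => h0 Hdp Hdm.
exists (- h), (Num.min dp dm); split.
- by rewrite oppr_lt0.
- by rewrite lt_min dp0.
- by apply: le_lt_trans T1T; rewrite lee_fin ge_min dpT.
- move=> e x t ee /andP[hx x0] /andP[t0]; rewrite le_min => /andP[tp tm].
  have xx : - h <= x <= 1 by rewrite hx; order_lra.
  case: ee => ->.
    by have [+ _] := Hdp x t xx ltac:(by rewrite t0); apply.
  by have [+ _] := Hdm x t xx ltac:(by rewrite t0); apply.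
- move=> x t hx /andP[t0]; rewrite le_min => /andP[tp tm].
  (* Beyond the window of comparison the barriers are 0 by definition, and so is the solution. *)
  have [x1|x1] := leP x 1.
    have xx : - h <= x <= 1 by rewrite hx.
    have [_ up] := Hdp x t xx ltac:(by rewrite t0).
    have [_ lo] := Hdm x t xx ltac:(by rewrite t0).
    by rewrite mul1r subr_le0 in up; rewrite mulN1r oppr_le0 subr_ge0 in lo.
  have xF : (x < 0) = false by apply/negbTE; rewrite -leNgt; order_lra.
  by rewrite /gbarrier xF far0 ?(ltW x1)// t0 (le_trans tp dpT).
Qed.
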